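(* Let $q$ be a positive integer and let $p_1,p_2,s_1,s_2$ be integers with $\gcd(p_1,p_2,q)=1$ and $\gcd(s_1,s_2,q)=1$. Let $L_1=L(q:p_1,p_2)$ and $L_2=L(q:s_1,s_2)$ be the corresponding $3$-dimensional (orbifold) lens spaces. If $L_1$ is isospectral to $L_2$, then $L_1$ and $L_2$ are isometric.
   Context: For $\theta\in\mathbb{R}$ put $R(\theta)=\begin{pmatrix}\cos 2\pi\theta & \sin 2\pi\theta\\ -\sin 2\pi\theta & \cos 2\pi\theta\end{pmatrix}$. For integers $p_1,p_2$ with $\gcd(p_1,p_2,q)=1$, let $g\in SO(4)$ be the block diagonal matrix with diagonal blocks $R(p_1/q),R(p_2/q)$; it generates a cyclic group $G=\langle g\rangle$ of order $q$. The lens space is $L(q:p_1,p_2)=\mathbb{S}^3/G$, where $\mathbb{S}^3$ is the unit sphere in $\mathbb{R}^4$ with the round metric of constant curvature $1$. The group $G$ is allowed to have elements with fixed points, so $L(q:p_1,p_2)$ is a Riemannian orbifold with the metric induced from $\mathbb{S}^3$ (a manifold if each $p_i$ is coprime to $q$). Smooth functions on $\mathbb{S}^3/G$ are identified, via the projection $\pi:\mathbb{S}^3\to\mathbb{S}^3/G$, with the $G$-invariant smooth functions on $\mathbb{S}^3$, and the Laplacian $\Delta$ on $\mathbb{S}^3/G$ is defined by $\pi^*(\Delta f)=\widetilde{\Delta}(\pi^*f)$, where $\widetilde\Delta$ is the Laplacian of $\mathbb{S}^3$. Two such spaces are isospectral if their Laplacians have the same eigenvalues with the same multiplicities. An isometry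 of the quotients is an isometry of Riemannian orbifolds; for finite subgroups $G,G'\subset O(4)$, $\mathbb{S}^3/G$ and $\mathbb{S}^3/G'$ are isometric if and only if $G$ and $G'$ are conjugate in $O(4)$. *)

(* Defs.v *)
From HB Require Import structures.
From mathcomp Require Import all_boot all_order all_algebra.
From mathcomp Require Import all_classical all_reals all_analysis.

Set Implicit Arguments.
Unset Strict Implicit.
Unset Printing Implicit Defensive.

Import Order.TTheory GRing.Theory Num.Theory.
Import numFieldNormedType.Exports.

Local Open Scope classical_set_scope.
Local Open Scope ring_scope.

Definition dotv (R : realType) (x y : 'cV[R]_4) : R :=
  \sum_(i < 4) x i 0 * y i 0.

Definition sphere3 (R : realType) := {x : 'cV[R]_4 | dotv x x == 1}.

Definition sphere_dist (R : realType) (x y : sphere3 R) : R :=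
  acos (dotv (val x) (val y)).

Definition sphere_ball (R : realType) (x : sphere3 R) (r : R) :
    set (sphere3 R) := [set y | sphere_dist x y < r].

Lemma base_point_subproof (R : realType) :
  dotv (delta_mx 0 0 : 'cV[R]_4) (delta_mx 0 0) == 1.
Proof.
rewrite /dotv (bigD1 ord0) //= big1 ?addr0 => [|i /negPf i0].
  by rewrite mxE eqxx mulr1.
by rewrite mxE i0 mul0r.
Qed.

Definition base_point (R : realType) : sphere3 R :=
  exist (fun x : 'cV[R]_4 => dotv x x == 1) _ (base_point_subproof R).

(* [hext f] is the extension of [f] to R^4 \ {0} that is constant on rays; its
   value at 0 is irrelevant. *)
Definition hext (R : realType) (f : sphere3 R -> R) (y : 'cV[R]_4) : R :=
  f (insubd (base_point R) ((Num.sqrt (dotv y y))^-1 *: y)).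

Definition iter_derive (R : realType) (V : normedModType R) (vs : seq V)
  (f : V -> R) : V -> R := foldr (fun v g => 'D_v g) f vs.

(* C^infinity on the open set U: all iterated directional derivatives exist and
   are continuous at every point of U. *)
Definition smooth_on (R : realType) (V : normedModType R) (U : set V)
    (f : V -> R) : Prop :=
  forall (vs : seq V) (x : V), U x ->
    {for x, continuous (iter_derive vs f)} /\
    (forall v : V, derivable (iter_derive vs f) x v).

Definition sphere_smooth (R : realType) (f : sphere3 R -> R) : Prop :=
  smooth_on [set y : 'cV[R]_4 | y != 0] (hext f).

Definition tangent_frame (R : realType) (x : sphere3 R)
    (e : 'I_3 -> 'cV[R]_4) : Prop :=
  (forall i, dotv (val x) (e i) = 0) /\
  (forall i j, dotv (e i) (e j) = (i == j)%:R).

(* [f] along the unit-speed geodesic (great circle) t |-> cos t x + sin t v,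
   where v is a unit tangent vector at x. *)
Definition along_geodesic (R : realType) (f : sphere3 R -> R) (x : sphere3 R)
    (v : 'cV[R]_4) (t : R) : R :=
  hext f (cos t *: val x + sin t *: v).

(* [h] is the Laplacian of the smooth function [f]. The Laplace-Beltrami
   operator is the trace of the covariant Hessian, and Hess f (v, v) is the
   second derivative at 0 of [f] along the geodesic with initial velocity v.
   The sign makes the spectrum nonnegative. *)
Definition is_sphere_laplacian (R : realType) (f h : sphere3 R -> R) : Prop :=
  forall (x : sphere3 R) (e : 'I_3 -> 'cV[R]_4), tangent_frame x e ->
    h x = - \sum_(i < 3) derive1n 2 (along_geodesic f x (e i)) 0.

Section Quotient.
Variables (R : realType) (G : set 'M[R]_4).

Definition orbit3 (x : sphere3 R) : set (sphere3 R) :=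
  [set y | exists2 g, G g & val y = g *m val x].

(* The space S^3/G of orbits, for a subgroup G of O(4). *)
Definition quotient3 := {A : set (sphere3 R) | exists x, A = orbit3 x}.

Definition proj3 (x : sphere3 R) : quotient3 :=
  exist _ (orbit3 x) (ex_intro _ x erefl).

Definition quotient_smooth (f : quotient3 -> R) : Prop :=
  sphere_smooth (f \o proj3).

Definition is_laplacian (f h : quotient3 -> R) : Prop :=
  is_sphere_laplacian (f \o proj3) (h \o proj3).

Definition eigenspace3 (lambda : R) : set (quotient3 -> R) :=
  [set f | quotient_smooth f /\ is_laplacian f (fun a => lambda * f a)].

End Quotient.

Arguments orbit3 {R} G x.
Arguments proj3 {R} G x.
Arguments eigenspace3 {R} G lambda.

(* The linear subspace [E] of the space of real functions on T has a basis of
   n elements. *)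
Definition has_dim (R : realType) (T : Type) (E : set (T -> R)) (n : nat) :
    Prop :=
  exists b : 'I_n -> T -> R,
    [/\ forall i, E (b i),
        forall c : 'I_n -> R,
          (forall a, \sum_(i < n) c i * b i a = 0) -> forall i, c i = 0
      & forall f, E f ->
          exists c : 'I_n -> R, forall a, f a = \sum_(i < n) c i * b i a].

(* Multiplicity n = 0 means that lambda is not an eigenvalue. *)
Definition isospectral (R : realType) (G G' : set 'M[R]_4) : Prop :=
  forall (lambda : R) (n : nat),
    has_dim (eigenspace3 G lambda) n <-> has_dim (eigenspace3 G' lambda) n.

(* Isometry of Riemannian orbifolds S^3/G -> S^3/G': a bijection that lifts,
   near every point of S^3 (on an orbifold chart), to a Riemannian isometry
   between geodesic balls of S^3. Such lifts are invertible, so the bijection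
   is a homeomorphism and its inverse lifts in the same way. *)
Definition orbifold_isometry (R : realType) (G G' : set 'M[R]_4)
    (phi : quotient3 G -> quotient3 G') : Prop :=
  bijective phi /\
  forall x : sphere3 R,
    exists (r : R) (x' : sphere3 R) (F : sphere3 R -> sphere3 R),
      [/\ 0 < r,
          set_bij (sphere_ball x r) (sphere_ball x' r) F,
          {in sphere_ball x r &, forall y z,
             sphere_dist (F y) (F z) = sphere_dist y z}
        & {in sphere_ball x r, forall y, proj3 G' (F y) = phi (proj3 G y)}].

Definition isometric (R : realType) (G G' : set 'M[R]_4) : Prop :=
  exists phi : quotient3 G -> quotient3 G', orbifold_isometry phi.

Definition rot2 (R : realType) (theta : R) : 'M[R]_2 :=
  \matrix_(i < 2, j < 2)
    if i == j then cos (2 * pi * theta)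
    else if (i < j)%N then sin (2 * pi * theta)
    else - sin (2 * pi * theta).

Definition lens_gen (R : realType) (q : nat) (p1 p2 : int) : 'M[R]_4 :=
  (block_mx (rot2 (p1%:~R / q%:R)) 0 0 (rot2 (p2%:~R / q%:R)) : 'M[R]_(2 + 2)).

(* The cyclic group generated by [lens_gen]; the lens space L(q:p1,p2) is the
   orbifold [quotient3 (lens_group R q p1 p2)]. *)
Definition lens_group (R : realType) (q : nat) (p1 p2 : int) : set 'M[R]_4 :=
  range (fun k : int => lens_gen R q p1 p2 ^ k).

Arguments lens_group : clear implicits.

(* Main.v *)
(* Let e_k be the multiplicity of the eigenvalue k(k+2) on S^3/G. Its
   eigenfunctions are the restrictions of the G-invariant harmonic homogeneous
   polynomials of degree k: the extension of an eigenfunction which is homogeneous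
   of degree k is harmonic outside 0, its derivatives of order k + 1 are harmonic
   and homogeneous of degree -1, and these vanish by the maximum principle.
   Splitting an invariant polynomial of degree k into eigenfunctions gives
   e_k + e_(k-2) + ... = number of monomials of degree k in z1, conj z1, z2,
   conj z2 invariant under G. Dividing such a monomial by powers of |z1|^2 and
   |z2|^2, one recovers from these numbers how many vectors of each 1-norm the
   lattice {(a, b) : q divides a p1 + b p2} contains. Two plane lattices of the
   same determinant with these counts equal differ by a signed permutation of the
   coordinates, as one sees by comparing reduced bases. Hence
   (s1, s2) = c (+- p_1, +- p_2) mod q up to order with c invertible, and the two
   groups are conjugate by a signed permutation matrix. *)

From HB Require Import structures.
From Stdlib Require Import ZArith Lia List.
From mathcomp Require Import all_boot all_order all_algebra.
From mathcomp Require Import all_classical all_reals all_analysis.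
From mathcomp Require Import ring lra zify ssrZ complex.
Require Import Defs.

Set Implicit Arguments.
Unset Strict Implicit.
Unset Printing Implicit Defensive.

Import Order.TTheory GRing.Theory Num.Theory.
Import numFieldNormedType.Exports.

Local Open Scope classical_set_scope.
Local Open Scope ring_scope.

(** * Plane lattices in the sup norm *)

(** The counts only tell how many vectors of each norm there are, not where they lie. A reduced
    basis contributes its two norms [s <= t], the determinant gives one relation between the two
    remaining parameters, and the shortest vector off the axes of the basis gives another. The
    obstacle is that these data need not suffice: there are different lattices with equal minima,
    equal determinant and equal third norm, since the third norm may be a minimum of two
    expressions. They are told apart only by the next norms, at a radius that depends on
    inequalities between the parameters; this is the source of the long case distinctions. The
    determinants agree because both lattices have index [q], by the gcd conditions. On the analytic
    side the Laplacian is given by second derivatives along great circles. For a homogeneous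
    extension these differ from Euclidean second derivatives by radial terms, which the Euler
    relation evaluates; this is how the eigenvalue [k (k + 2)] becomes harmonicity of the
    extension. *)

Section PlaneLattices.
Local Open Scope Z_scope.

Definition supn (X Y : Z) : Z := Z.max (Z.abs X) (Z.abs Y).

(** Lists without repetition stand for cardinals, so finiteness of the balls is part of the notion.
    Closed balls are counted: agreement for all [r] is agreement of the number of vectors of each
    norm. *)
Definition same_count (N N' : Z -> Z -> Z) (P P' : Z -> Z -> Prop) : Prop :=
  forall r : Z, exists l l' : list (Z * Z),
    (NoDup l /\ forall n m, In (n, m) l <-> P n m /\ N n m <= r) /\
    (NoDup l' /\ forall n m, In (n, m) l' <-> P' n m /\ N' n m <= r) /\
    length l = length l'.

Definition gcount (g g' : Z -> Z -> Z) : Prop :=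
  same_count g g' (fun _ _ => True) (fun _ _ => True).

Lemma gcount_sym g g' : gcount g g' -> gcount g' g.
Proof.
intros H r; destruct (H r) as [l [l' [A [B C]]]].
exists l', l; auto.
Qed.

(** Equal finite cardinals exclude that one ball is strictly contained in the other. *)
Lemma gcount_strict_sub g g' r n0 m0 : gcount g g' ->
  (forall n m, g' n m <= r -> g n m <= r) ->
  g n0 m0 <= r -> r < g' n0 m0 -> False.
Proof.
intros H Hsub H1 H2; destruct (H r) as [l [l' [[Nl Il] [[Nl' Il'] E]]]].
assert (L : (length ((n0, m0) :: l') <= length l)%coq_nat).
  apply NoDup_incl_length.
    constructor; auto; intro I; apply Il' in I; lia.
  intros [n m] [e | I].
    injection e as <- <-; apply Il; auto.
  apply Il' in I; apply Il; split; auto; apply Hsub; tauto.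
simpl in L; lia.
Qed.

Definition negv (p : Z * Z) : Z * Z := (- p.1, - p.2).

(** Norms sharing this record with the same [s] and [t] agree on the axes, where the two counts
    therefore cancel. *)
Record axis_norm (g : Z -> Z -> Z) (s t : Z) : Prop := AxisNorm {
  an_s : forall n, g n 0 = Z.abs n * s;
  an_t : forall m, g 0 m = Z.abs m * t;
  an_neg : forall n m, g (- n) (- m) = g n m }.

(* Counting off the axes, and one vector out of each pair [v], [- v]. *)
Lemma gcount_half g g' s t r (l l' : list (Z * Z)) : gcount g g' ->
  axis_norm g s t -> axis_norm g' s t ->
  NoDup l -> (forall n m, In (n, m) l -> 1 <= n /\ m <> 0 /\ g n m <= r) ->
  (forall n m, 1 <= n -> m <> 0 -> g' n m <= r -> In (n, m) l') ->
  (length l <= length l')%coq_nat.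
Proof.
intros H A A' Nl Hl Hl'; destruct (H r) as [b [b' [[Nb Ib] [[Nb' Ib'] E]]]].
set (ax := List.filter (fun p : Z * Z => Z.eqb (p.1 * p.2) 0) b).
assert (Iax : forall n m, In (n, m) ax <-> n * m = 0 /\ g n m <= r).
  intros n m; unfold ax; rewrite filter_In Ib /= Z.eqb_eq; tauto.
assert (Eax : forall n m, n * m = 0 -> g n m = g' n m).
  intros n m e; apply Z.mul_eq_0 in e; destruct e as [-> | ->].
    rewrite (an_t A) (an_t A') //.
  rewrite (an_s A) (an_s A') //.
assert (L1 : (length (List.app ax (List.app l (List.map negv l))) <= length b)%coq_nat).
  apply NoDup_incl_length.
    apply NoDup_app; [apply NoDup_filter; auto | apply NoDup_app; auto | ].
    - apply NoDup_map_NoDup_ForallPairs; auto.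
      intros [a c] [d e] _ _ i; injection i as i1 i2; f_equal; lia.
    - intros [n m] I J; apply in_map_iff in J; destruct J as [[c d] [e J]].
      injection e as e1 e2; apply Hl in I; apply Hl in J; lia.
    - intros [n m] I J; apply Iax in I; apply in_app_or in J.
      destruct J as [J | J].
        apply Hl in J; nia.
      apply in_map_iff in J; destruct J as [[c d] [e J]].
      injection e as e1 e2; apply Hl in J; nia.
  intros [n m] I; apply in_app_or in I; destruct I as [I | I].
    apply Iax in I; apply Ib; tauto.
  apply in_app_or in I; destruct I as [I | I].
    apply Hl in I; apply Ib; tauto.
  apply in_map_iff in I; destruct I as [[c d] [e I]].
  injection e as <- <-; apply Hl in I; apply Ib; rewrite (an_neg A); tauto.
assert (L2 : (length b' <= length (List.app ax (List.app l' (List.map negv l'))))%coq_nat).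
  apply NoDup_incl_length; auto.
  intros [n m] I; apply Ib' in I; destruct I as [_ I].
  apply in_or_app; destruct (Z.eq_dec (n * m) 0) as [z | z].
    left; apply Iax; rewrite Eax; auto.
  right; apply in_or_app; destruct (Z_le_gt_dec 1 n) as [k | k].
    left; apply Hl'; auto; intro e; subst; lia.
  right; apply in_map_iff; exists (- n, - m); split.
    unfold negv; simpl; f_equal; lia.
  assert (n <> 0 /\ m <> 0) by (split; intro e; subst; lia).
  apply Hl'; [lia | lia | rewrite (an_neg A'); auto].
rewrite !length_app !length_map in L1 L2; lia.
Qed.

(** * Successive minima and the two kinds of reduced bases *)

Definition red_norm (g : Z -> Z -> Z) (s t : Z) : Prop :=
  axis_norm g s t /\ 0 < s <= t /\ (forall n m, m <> 0 -> t <= g n m).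

(** If [s < s'], the second ball of radius [s] is reduced to 0. If [s = s'] and [t < t'], the second
    ball of radius [t] lies on the first axis, where the norms agree, and misses (0, 1). *)
Lemma red_norm_minima g g' s t s' t' : gcount g g' ->
  red_norm g s t -> red_norm g' s' t' -> s = s' /\ t = t'.
Proof.
assert (Hs : forall g g' s t s' t', gcount g g' ->
  red_norm g s t -> red_norm g' s' t' -> s' <= s).
  clear; intros g g' s t s' t' H [A [st Ht]] [A' [st' Ht']].
  destruct (Z_le_gt_dec s' s) as [k | k]; auto; exfalso.
  apply (@gcount_strict_sub _ _ s 1 0 H); [| rewrite (an_s A); lia | rewrite (an_s A'); lia].
  intros n m gr; assert (m = 0).
    destruct (Z.eq_dec m 0) as [e | e]; auto; specialize (Ht' n m e); lia.
  subst m; rewrite (an_s A') in gr; assert (n = 0) by nia; subst n.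
  rewrite (an_s A); lia.
assert (Ht : forall g g' s t t', gcount g g' ->
  red_norm g s t -> red_norm g' s t' -> t' <= t).
  clear; intros g g' s t t' H [A [st Ht]] [A' [st' Ht']].
  destruct (Z_le_gt_dec t' t) as [k | k]; auto; exfalso.
  apply (@gcount_strict_sub _ _ t 0 1 H); [| rewrite (an_t A); lia | rewrite (an_t A'); lia].
  intros n m gr; assert (m = 0).
    destruct (Z.eq_dec m 0) as [e | e]; auto; specialize (Ht' n m e); lia.
  subst m; rewrite (an_s A') in gr; rewrite (an_s A); lia.
intros H R R'; assert (e : s = s').
  pose proof (Hs _ _ _ _ _ _ H R R').
  pose proof (Hs _ _ _ _ _ _ (gcount_sym H) R' R); lia.
subst s'; split; auto.
pose proof (Ht _ _ _ _ _ H R R').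
pose proof (Ht _ _ _ _ _ (gcount_sym H) R' R); lia.
Qed.

(* Every lattice of rank two has, up to a symmetry of the square, a basis
   (s, y), (-x, t) or (s, y), (t, -z) realizing its successive minima s <= t;
   [gI] and [gII] are the sup norm in the coordinates of these bases. *)
Definition gI (s t x y n m : Z) : Z := supn (n * s - m * x) (n * y + m * t).
Definition gII (s t y z n m : Z) : Z := supn (n * s + m * t) (n * y - m * z).

(** The last clause says that the difference of the basis vectors is not shorter than [t]: it is (s
    + x, y - t) here and (s - t, y + z) in [okII]. Their sum is never shorter. *)
Definition okI s t x y := 0 <= y <= s /\ 0 < s <= t /\ 0 <= x <= t /\ (y = 0 \/ t <= s + x).
Definition okII s t y z := 0 <= y <= s /\ 0 < s <= t /\ 0 <= z <= t /\ t <= y + z.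

(** If [n] and [m] have the same sign, the second coordinate is at least [t]. For opposite signs the
    first is at least [s + x], and if [y = 0] the second is still [|m| t]. *)
Lemma gI_red s t x y : okI s t x y -> red_norm (gI s t x y) s t.
Proof.
unfold okI, gI, supn; intros K; split; [split | split].
- intro n; nia.
- intro m; nia.
- intros n m; f_equal; lia.
- lia.
- intros n m Hm.
assert (Hm' : m <= - 1 \/ 1 <= m) by lia; assert (Hn : n <= -1 \/ n = 0 \/ 1 <= n) by lia.
destruct Hn as [Hn | [Hn | Hn]]; [ | nia | ].
  assert (n*s <= -s) by nia; assert (n * y <= - y) by nia.
  destruct Hm' as [Hm' | Hm']; [assert (m * x <= - x) by nia; assert (m * t <= - t) by nia; lia
   | assert (x <= m * x) by nia; assert (t <= m * t) by nia].
  destruct K as [? [? [? [-> | ?]]]]; nia.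
assert (s <= n*s) by nia; assert (y <= n * y) by nia.
destruct Hm' as [Hm' | Hm']; [assert (m * x <= - x) by nia; assert (m * t <= - t) by nia
   | assert (x <= m * x) by nia; assert (t <= m * t) by nia; lia].
destruct K as [? [? [? [-> | ?]]]]; nia.
Qed.

Lemma gII_red s t y z : okII s t y z -> red_norm (gII s t y z) s t.
Proof.
unfold okII, gII, supn; intros K; split; [split | split].
- intro n; nia.
- intro m; nia.
- intros n m; f_equal; lia.
- lia.
- intros n m Hm.
assert (Hm' : m <= - 1 \/ 1 <= m) by lia; assert (Hn : n <= -1 \/ n = 0 \/ 1 <= n) by lia.
destruct Hn as [Hn | [Hn | Hn]]; [ | nia | ].
  assert (n*s <= -s) by nia; assert (n * y <= - y) by nia.
  destruct Hm' as [Hm' | Hm']; [assert (m * t <= - t) by nia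
   | assert (z <= m * z) by nia]; lia.
assert (s <= n*s) by nia; assert (y <= n * y) by nia.
destruct Hm' as [Hm' | Hm']; [assert (m * z <= - z) by nia
   | assert (t <= m * t) by nia; lia]; lia.
Qed.

Lemma gI0_inj s t x x' : 0 < s <= t -> 0 <= 2 * x <= s -> 0 <= 2 * x' <= s ->
  gcount (gI s t x 0) (gI s t x' 0) -> x' <= x.
Proof.
intros st Hx Hx' H; destruct (Z_le_gt_dec x' x) as [k | k]; auto; exfalso.
(* [j] is the least integer with [t <= j s + x]. This radius is below [2 t], so only the rows
   [m = 0, 1, -1] matter; in row 1 the first lattice has the vectors [-j <= n <= j], the second only
   [-j < n <= j]. *)
pose (j := (t - x + s - 1) / s).
assert (Hj : t <= j * s + x < t + s).
  pose proof (Z.div_mod (t - x + s - 1) s); pose proof (Z.mod_pos_bound (t - x + s - 1) s).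
  fold j in H0; nia.
apply (@gcount_strict_sub _ _ (j * s + x) (- j) 1 H); unfold gI, supn; [ | nia | nia].
intros n m gr; assert (Hm : m = 0 \/ m = 1 \/ m = -1) by nia.
assert (m * t = 0 \/ m * t = t \/ m * t = - t) by nia.
destruct Hm as [-> | [-> | ->]]; [lia | | ].
  assert (- j + 1 <= n <= j) by nia; nia.
assert (- j <= n <= j - 1) by nia; nia.
Qed.

(** * Comparison of short vectors off the axes *)

Lemma supn_le X Y r : supn X Y <= r <-> - r <= X <= r /\ - r <= Y <= r.
Proof. unfold supn; lia. Qed.

(** For large coefficients the products are only bounded, which keeps all goals linear; at the radii
    in use these cases are contradictory. *)
Ltac vector_cases n m s t x y Hn Hm :=
  let an := fresh in let am := fresh in
  assert (an : n = 1 \/ n = 2 \/ n = 3 \/ 4 <= n) by lia;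
  assert (am : m <= - 3 \/ m = - 2 \/ m = - 1 \/ m = 1 \/ m = 2 \/ 3 <= m) by lia;
  clear Hn Hm;
  destruct an as [-> | [-> | [-> | an]]];
  [ | | | assert (4 * s <= n * s) by (apply Z.mul_le_mono_nonneg_r; lia); assert (4 * y <= n * y) by (apply Z.mul_le_mono_nonneg_r; lia)];
  (destruct am as [am | [-> | [-> | [-> | [-> | am]]]]];
   [ assert (m * x <= - 3 * x) by (apply Z.mul_le_mono_nonneg_r; lia); assert (m * t <= - 3 * t) by (apply Z.mul_le_mono_nonneg_r; lia)
   | | | | | assert (3 * x <= m * x) by (apply Z.mul_le_mono_nonneg_r; lia); assert (3 * t <= m * t) by (apply Z.mul_le_mono_nonneg_r; lia)]).

Ltac complete s t x y :=
  let n := fresh "n" in let m := fresh "m" in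
  let Hn := fresh in let Hm := fresh in let Hg := fresh in
  intros n m Hn Hm Hg; unfold gI, gII in Hg; apply supn_le in Hg;
  vector_cases n m s t x y Hn Hm;
  first [ exfalso; lia | simpl; tauto ].

Ltac contains :=
  let n := fresh "n" in let m := fresh "m" in let J := fresh in
  intros n m J; simpl in J; unfold gI, gII; rewrite supn_le;
  repeat (destruct J as [J | J]); try contradiction;
  injection J as <- <-; lia.

Ltac nodup := repeat constructor; simpl; intuition discriminate.

(* [l] consists of vectors of the first lattice of norm at most [r] and [l'] of
   all those of the second one, up to sign and off the axes: it is too short. *)
Ltac clash H A A' r l l' s t x y :=
  exfalso; let K := fresh in
  assert (K : (length l <= length l')%coq_nat);
  [ apply (@gcount_half _ _ _ _ r l l' H A A');
    [ nodup | contains | complete s t x y ]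
  | simpl in K; lia ].

(** With [y + z] fixed, (2, -1) has norm [2 y + z], which is smaller for the smaller [y]. The vector
    (1, 1) has norm [2 s] in both lattices, hence the case distinction. *)
Lemma gII_inj_eq s y z y' z' : okII s s y z -> okII s s y' z' ->
  gcount (gII s s y z) (gII s s y' z') -> y + z = y' + z' -> y < y' -> y' <= z' -> False.
Proof.
intros K K' H E l1 l2; unfold okII in K, K'.
pose proof (proj1 (gII_red K)) as A; pose proof (proj1 (gII_red K')) as A'.
destruct (Z_le_gt_dec (2 * s) (2 * y + z)) as [k | k].
  clash H A A' (2 * y + z) [:: (1, -1); (2, -1); (1, 1)] [:: (1, -1); (1, 1)] s s z' y'.
clash H A A' (2 * y + z) [:: (1, -1); (2, -1)] [:: (1, -1)] s s z' y'.
Qed.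

(** The shortest vector off the axes is (1, -1), of norm [y + z]. *)
Lemma gII_third s t y z y' z' : okII s t y z -> okII s t y' z' ->
  gcount (gII s t y z) (gII s t y' z') -> y' + z' <= y + z.
Proof.
intros K K' H; unfold okII in K, K'; destruct (Z_le_gt_dec (y' + z') (y + z)); auto; exfalso.
pose proof (proj1 (gII_red K)) as A; pose proof (proj1 (gII_red K')) as A'.
clash H A A' (y + z) [:: (1, -1)] (@nil (Z * Z)) s t z' y'.
Qed.

Lemma gII_inj s t y z y' z' : okII s t y z -> okII s t y' z' ->
  s * z + t * y = s * z' + t * y' ->
  gcount (gII s t y z) (gII s t y' z') ->
  (y = y' /\ z = z') \/ (s = t /\ y = z' /\ z = y').
Proof.
intros K K' D H.
pose proof (gII_third K K' H); pose proof (gII_third K' K (gcount_sym H)).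
(* For [s < t] the sum [y + z] and the determinant are independent linear equations. For [s = t]
   they coincide, and exchanging the basis vectors exchanges [y] and [z]. *)
destruct (Z.eq_dec s t) as [e | ne]; [subst t | unfold okII in K, K'; nia].
assert (Sw : forall u v, okII s s u v -> okII s s v u) by (unfold okII; lia).
assert (Hsw : forall u v n m, gII s s u v n m = gII s s v u m n).
  intros; unfold gII, supn; lia.
assert (Gsw : forall g u v, gcount g (gII s s u v) -> gcount g (gII s s v u)).
  intros g u v G r; destruct (G r) as [l [l' [B [[Nl Il] e]]]].
  exists l, (List.map (fun p : Z * Z => (p.2, p.1)) l'); split; [auto | split; [split | ]].
  - apply NoDup_map_NoDup_ForallPairs; auto.
    intros [a c] [d f] _ _ i; injection i as i1 i2; subst; auto.
  - intros n m; rewrite in_map_iff; split.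
      intros [[a c] [i I]]; injection i as <- <-; apply Il in I; simpl; rewrite Hsw; auto.
    intros [_ I]; exists (m, n); split; auto; apply Il; rewrite Hsw; auto.
  - rewrite length_map; auto.
destruct (Z_le_gt_dec y z) as [l | l]; destruct (Z_le_gt_dec y' z') as [l' | l'].
- destruct (Z.lt_trichotomy y y') as [c | [c | c]]; [ | lia | ].
    exfalso; apply (gII_inj_eq K K' H); lia.
  exfalso; apply (gII_inj_eq K' K (gcount_sym H)); lia.
- destruct (Z.lt_trichotomy y z') as [c | [c | c]]; [ | lia | ].
    exfalso; apply (gII_inj_eq K (Sw _ _ K') (Gsw _ _ _ H)); lia.
  exfalso; apply (gII_inj_eq (Sw _ _ K') K (gcount_sym (Gsw _ _ _ H))); lia.
- destruct (Z.lt_trichotomy z y') as [c | [c | c]]; [ | lia | ].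
    exfalso; apply (gII_inj_eq (Sw _ _ K) K' (gcount_sym (Gsw _ _ _ (gcount_sym H)))); lia.
  exfalso; apply (gII_inj_eq K' (Sw _ _ K) (Gsw _ _ _ (gcount_sym H))); lia.
pose proof (gcount_sym (Gsw _ _ _ (gcount_sym (Gsw _ _ _ H)))) as H'.
destruct (Z.lt_trichotomy z z') as [c | [c | c]]; [ | lia | ].
  exfalso; apply (gII_inj_eq (Sw _ _ K) (Sw _ _ K') H'); lia.
exfalso; apply (gII_inj_eq (Sw _ _ K') (Sw _ _ K) (gcount_sym H')); lia.
Qed.

(** The vectors (1, -1) and (1, 1) have norms [s + x] and [t + y], and any other vector off the axes
    is at least as long as one of them. *)
Lemma gI_third s t x y x' y' : okI s t x y -> okI s t x' y' -> 0 < y -> 0 < y' ->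
  gcount (gI s t x y) (gI s t x' y') ->
  Z.min (s + x') (t + y') <= Z.min (s + x) (t + y).
Proof.
intros K K' y0 y0' H; unfold okI in K, K'.
destruct (Z_le_gt_dec (Z.min (s + x') (t + y')) (Z.min (s + x) (t + y))) as [l | l]; auto.
pose proof (proj1 (gI_red K)) as A; pose proof (proj1 (gI_red K')) as A'.
destruct (Z_le_gt_dec (s + x) (t + y)) as [k | k].
  clash H A A' (s + x) [:: (1, -1)] (@nil (Z * Z)) s t x' y'.
clash H A A' (t + y) [:: (1, 1)] (@nil (Z * Z)) s t x' y'.
Qed.

Section DoubledPair.
Variables s t a b : Z.
Hypotheses (b0 : 0 < b) (ba : b < a) (ts : t = s + a - b).
Hypotheses (s_ge : a + b <= s) (s_lt : s < 3 * a + b).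
Let g1 := gI s t a (2 * b).
Let g2 := gI s t (2 * a) b.

(* These two lattices have the same determinant and the same smallest norms;
   [M] and [N] are the next norms that occur, and their relative position
   decides at which radius the counts differ. *)
Lemma gI_doubled_neq : gcount g1 g2 -> False.
Proof.
intros H; pose proof (gcount_sym H) as H'; unfold g1, g2 in H, H'.
assert (A1 : axis_norm (gI s t a (2 * b)) s t) by (apply gI_red; unfold okI; lia).
assert (A2 : axis_norm (gI s t (2 * a) b) s t) by (apply gI_red; unfold okI; lia).
subst t.
(* [M] is the norm of (3, 1) in the second lattice, [N] that of (2, 1) in the first. *)
pose (M := Z.max (s + a + 2 * b) (3 * s - 2 * a)).
pose (N := Z.max (s + a + 3 * b) (2 * s - a)).
destruct (Z_lt_le_dec M (s + 2 * a)) as [ms | ms].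
  destruct (Z.lt_trichotomy N M) as [c | [c | c]].
  - clash H A1 A2 N [:: (1, -1); (1, 1); (2, 1)] [:: (1, 1); (2, 1)]
      s (s + a - b) (2 * a) b.
  - clash H' A2 A1 (s + 2 * a) [:: (1, 1); (2, 1); (3, 1); (1, -1)]
      [:: (1, -1); (1, 1); (2, 1)] s (s + a - b) a (2 * b).
  - clash H' A2 A1 M [:: (1, 1); (2, 1); (3, 1)]
      [:: (1, -1); (1, 1)] s (s + a - b) a (2 * b).
destruct (Z_le_gt_dec s (4 * b)) as [s4 | s4].
  destruct (Z_lt_le_dec M (Z.min N (2 * s + a))) as [c | c].
    clash H' A2 A1 M [:: (1, 1); (2, 1); (1, -1); (3, 1)]
      [:: (1, -1); (1, 1); (1, -2)] s (s + a - b) a (2 * b).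
  destruct (Z_lt_le_dec N M) as [d | d].
    clash H A1 A2 N [:: (1, -1); (1, 1); (1, -2); (2, 1)]
      [:: (1, 1); (2, 1); (1, -1)] s (s + a - b) (2 * a) b.
  destruct (Z_lt_le_dec (2 * s + a) M) as [e | e].
    clash H A1 A2 (2 * s + a) [:: (1, -1); (1, 1); (1, -2); (2, -1)]
      [:: (1, 1); (2, 1); (1, -1)] s (s + a - b) (2 * a) b.
  clash H A1 A2 (2 * s + a) [:: (1, -1); (1, 1); (1, -2); (2, -1); (2, 1)]
    [:: (1, 1); (2, 1); (1, -1); (3, 1)] s (s + a - b) (2 * a) b.
destruct (Z.lt_trichotomy N (s + 2 * a)) as [c | [c | c]].
- clash H A1 A2 N [:: (1, -1); (1, 1); (2, 1)]
    [:: (1, 1); (2, 1)] s (s + a - b) (2 * a) b.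
(* [N = s + 2 a] means [a = 3 b] or [s = 3 a]. *)
- destruct (Z.eq_dec a (3 * b)) as [e | e].
    assert (e1 : s + a - b = s + 2 * b) by lia; rewrite e1 e in H, H', A1, A2.
    destruct (Z.lt_trichotomy s (8 * b)) as [f | [f | f]].
    + clash H' A2 A1 (3 * s - 6 * b) [:: (1, 1); (2, 1); (1, -1); (3, 1)]
        [:: (1, -1); (1, 1); (2, 1)] s (s + 2 * b) (3 * b) (2 * b).
    + clash H A1 A2 (2 * s + 3 * b) [:: (1, -1); (1, 1); (2, 1); (1, -2); (2, -1)]
        [:: (1, 1); (2, 1); (1, -1); (3, 1)] s (s + 2 * b) (2 * (3 * b)) b.
    + clash H A1 A2 (2 * s + 2 * b) [:: (1, -1); (1, 1); (2, 1); (1, -2)]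
        [:: (1, 1); (2, 1); (1, -1)] s (s + 2 * b) (2 * (3 * b)) b.
  (* Now [s = 3 a], and the radius is the larger of the norms of (2, -1) and (1, -2) in the first
     lattice. *)
  clash H A1 A2 (Z.max (7 * a) (8 * a - 4 * b))
    [:: (1, -1); (1, 1); (2, 1); (1, -2); (2, -1)]
    [:: (1, 1); (2, 1); (1, -1); (3, 1)] s (s + a - b) (2 * a) b.
- clash H' A2 A1 (s + 2 * a) [:: (1, 1); (2, 1); (1, -1)]
    [:: (1, -1); (1, 1)] s (s + a - b) a (2 * b).
Qed.

End DoubledPair.

(** The equation [a y = b x] says that [(x, y)] is a multiple of [(a, b)]. The third norms agree,
    and comparing the next ones leaves only the factor 2, the case of [gI_doubled_neq]. *)
Lemma gI_neq s t a b x y : okI s t a y -> okI s t x b ->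
  0 < b -> b < y -> 0 < a -> a < x -> s + a = t + b -> a * y = b * x -> s < t ->
  gcount (gI s t a y) (gI s t x b) -> False.
Proof.
intros K1 K2 b0 hy a0 hx E P l H; pose proof (gcount_sym H) as H'; unfold okI in K1, K2.
pose proof (proj1 (gI_red K1)) as A1; pose proof (proj1 (gI_red K2)) as A2.
assert (F : y - b < x - a) by nia.
(* [B] is the norm of (1, -2) in the first lattice, where (1, 1) has norm [t + y]; [A] is the norm
   of (2, 1) in the second. *)
pose (B := Z.max (s + 2 * a) (2 * t - y)); pose (A := Z.max (t + 2 * b) (2 * s - x)).
assert (e : A = Z.min (t + y) B).
  destruct (Z.lt_trichotomy A (Z.min (t + y) B)) as [c | [c | c]]; auto.
    clash H' A2 A1 A [:: (1, 1); (2, 1)] [:: (1, -1)] s t a y.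
  destruct (Z_le_gt_dec (t + y) B) as [d | d].
    clash H A1 A2 (t + y) [:: (1, -1); (1, 1)] [:: (1, 1)] s t x b.
  clash H A1 A2 B [:: (1, -1); (1, -2)] [:: (1, 1)] s t x b.
assert (e' : A = t + y) by lia.
destruct (Z_le_gt_dec (t + y) (2 * s - x)) as [c | c].
  clash H' A2 A1 (s + x) [:: (1, 1); (2, 1); (1, -1)] [:: (1, -1); (1, 1)] s t a y.
assert (ey : y = 2 * b) by lia.
assert (ex : x = 2 * a) by nia.
subst x y.
apply (@gI_doubled_neq s t a b); auto; lia.
Qed.

(** For [x < x'] equal products give [y' < y], so the third norms can only agree in the form
    [s + x = t + y']. *)
Lemma gI_inj s t x y x' y' : okI s t x y -> okI s t x' y' ->
  0 < y -> 0 < y' -> 0 < x -> 0 < x' -> x * y = x' * y' ->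
  gcount (gI s t x y) (gI s t x' y') ->
  (x = x' /\ y = y') \/ (s = t /\ x = y' /\ y = x').
Proof.
assert (W : forall x y x' y', okI s t x y -> okI s t x' y' ->
  0 < y -> 0 < y' -> 0 < x -> 0 < x' -> x * y = x' * y' -> x < x' ->
  gcount (gI s t x y) (gI s t x' y') -> s = t /\ x = y' /\ y = x').
  clear; intros x y x' y' K K' y0 y0' x0 x0' P l H.
  pose proof (gI_third K K' y0 y0' H); pose proof (gI_third K' K y0' y0 (gcount_sym H)).
  assert (ly : y' < y) by nia.
  assert (E : s + x = t + y') by lia.
  destruct (Z_lt_le_dec s t) as [c | c].
    exfalso; apply (gI_neq K K'); auto; lia.
  unfold okI in K; assert (s = t) by lia; assert (x = y') by lia; subst.
  split; [auto | split; [auto | nia]].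
intros K K' y0 y0' x0 x0' P H.
destruct (Z.lt_trichotomy x x') as [c | [c | c]].
- right; apply (W _ _ _ _ K K'); auto.
- left; subst; split; auto; nia.
- right; destruct (W _ _ _ _ K' K) as [e [e1 e2]]; auto using gcount_sym.
Qed.

(** * Lattices of different kinds compared *)

Section MixedPair.
Variables s t x y y' z' : Z.
Hypotheses (K : okI s t x y) (K' : okII s t y' z').
Hypotheses (x0 : 0 < x) (y0 : 0 < y) (y'0 : 0 < y') (z'_lt : z' < t).
Hypothesis H : gcount (gI s t x y) (gII s t y' z').

Lemma gI_gII_third : Z.min (s + x) (t + y) = y' + z'.
Proof.
pose proof (gcount_sym H) as H'.
pose proof (proj1 (gI_red K)) as A; pose proof (proj1 (gII_red K')) as A'.
unfold okI in K; unfold okII in K'.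
destruct (Z.lt_trichotomy (Z.min (s + x) (t + y)) (y' + z')) as [c | [c | c]]; auto.
  destruct (Z_le_gt_dec (s + x) (t + y)) as [k | k].
    clash H A A' (s + x) [:: (1, -1)] (@nil (Z * Z)) s t z' y'.
  clash H A A' (t + y) [:: (1, 1)] (@nil (Z * Z)) s t z' y'.
clash H' A' A (y' + z') [:: (1, -1)] (@nil (Z * Z)) s t x y.
Qed.

(** In the defects [d = t - s], [be = s - y], [al = s - y'] equality of the determinants reads
    [x be = d al]. Comparing the next norms one after another either separates the counts or adds a
    linear relation to this equation. *)
Lemma gI_gII_neq : s * t + x * y = s * z' + t * y' -> y' + z' = s + x -> s + x < t + y ->
  s < t -> t - s < x -> y < s -> False.
Proof.
intros D E c st xd ys; pose proof (gcount_sym H) as H'.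
pose proof (proj1 (gI_red K)) as A; pose proof (proj1 (gII_red K')) as A'.
unfold okI in K; unfold okII in K'.
pose (d := t - s); pose (be := s - y); pose (al := s - y').
assert (ez : z' = x + al) by lia.
assert (P : x * be = d * al) by (unfold d, be; subst z'; nia).
assert (ab : be < al) by nia.
assert (Ed : t = s + d) by lia; assert (Eb : y = s - be) by lia; assert (Ea : y' = s - al) by lia.
clearbody d be al; subst t y y' z'.
(* [B] is the norm of (1, -2) in the first lattice, where (1, 1) has norm [2 s + d - be]; in the
   second, (2, -1) has norm [2 s + x - al]. *)
pose (B := Z.max (s + 2 * x) (s + 2 * d + be)).
assert (e : Z.min (2 * s + d - be) B = 2 * s + x - al).
  destruct (Z.lt_trichotomy (Z.min (2 * s + d - be) B) (2 * s + x - al)) as [k | [k | k]]; auto.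
    destruct (Z_le_gt_dec (2 * s + d - be) B) as [l | l].
      clash H A A' (2 * s + d - be) [:: (1, -1); (1, 1)] [:: (1, -1)]
        s (s + d) (x + al) (s - al).
    clash H A A' B [:: (1, -1); (1, -2)] [:: (1, -1)] s (s + d) (x + al) (s - al).
  clash H' A' A (2 * s + x - al) [:: (1, -1); (2, -1)] [:: (1, -1)] s (s + d) x (s - be).
destruct (Z_le_gt_dec (2 * s + d - be) B) as [l | l].
  (* [d - be = x - al] and [x be = d al] give [(x - d) (x - al) = 0]. *)
  assert (db : d = be) by (clear - P xd l e st; nia); assert (xa : x = al) by lia; subst be al.
  assert (sx : 2 * x < s + d) by lia; assert (ds : d < x < s) by lia.
  clear e D P xd ab E z'_lt y'0 y0 x0 K K'.
  (* [P1] is the least norm of (1, -2), (2, 1), (2, -1) in the first lattice, [P2] that of (1, 1),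
     (1, -2), (3, -1) in the second. *)
  pose (P1 := Z.min B (Z.min (3 * s - d) (2 * s + x))).
  pose (P2 := Z.min (2 * s + d) (Z.min (s + 3 * x) (3 * s - x))).
  destruct (Z.lt_trichotomy P1 P2) as [k | [k | k]].
  - destruct (Z_le_gt_dec B P1) as [f | f].
      clash H A A' P1 [:: (1, -1); (1, 1); (1, -2)] [:: (1, -1); (2, -1)]
        s (s + d) (x + x) (s - x).
    destruct (Z_le_gt_dec (3 * s - d) P1) as [f' | f'].
      clash H A A' P1 [:: (1, -1); (1, 1); (2, 1)] [:: (1, -1); (2, -1)]
        s (s + d) (x + x) (s - x).
    clash H A A' P1 [:: (1, -1); (1, 1); (2, -1)] [:: (1, -1); (2, -1)]
      s (s + d) (x + x) (s - x).
  - assert (k' : 3 * s - x = B) by lia.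
    clash H' A' A (2 * s + d) [:: (1, -1); (2, -1); (3, -1); (1, 1)]
      [:: (1, -1); (1, 1); (1, -2)] s (s + d) x (s - d).
  - destruct (Z_le_gt_dec (2 * s + d) P2) as [f | f].
      clash H' A' A P2 [:: (1, -1); (2, -1); (1, 1)] [:: (1, -1); (1, 1)]
        s (s + d) x (s - d).
    destruct (Z_le_gt_dec (s + 3 * x) P2) as [f' | f'].
      clash H' A' A P2 [:: (1, -1); (2, -1); (1, -2)] [:: (1, -1); (1, 1)]
        s (s + d) x (s - d).
    clash H' A' A P2 [:: (1, -1); (2, -1); (3, -1)] [:: (1, -1); (1, 1)]
      s (s + d) x (s - d).
(* Norms of (1, -2) and (3, -1) in the second lattice. *)
pose (F := s + 2 * x + al); pose (C := Z.max (3 * s + x - 2 * al) (2 * s - d)).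
destruct (Z.lt_trichotomy (2 * s + d - be) (Z.min F C)) as [k | [k | k]].
- clash H A A' (2 * s + d - be) [:: (1, -1); (1, -2); (1, 1)] [:: (1, -1); (2, -1)]
    s (s + d) (x + al) (s - al).
- exfalso; destruct (Z.eq_dec (2 * s + d - be) F) as [f | f]; [lia | ].
  destruct (Z.eq_dec be (2 * d)) as [g | g].
    assert (al = 2 * x) by (subst be; clear - P st; nia); lia.
  assert (h : 2 * s + d - be = 3 * s + x - 2 * al) by lia.
  assert (h' : be < 2 * d) by lia.
  destruct (Z_le_gt_dec (s + 2 * d + be) (s + 2 * x)) as [q | q].
    assert (ea : al = 2 * x - d + be) by lia; rewrite ea in P.
    assert (Q : (be - 2 * d) * (x - d) = d * d) by lia; clear - Q xd h' st.
    assert (0 < d * d) by nia; assert (be - 2 * d < 0) by lia; nia.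
  assert (ea : al = d + 2 * be) by lia; rewrite ea in P.
  assert (Q : be * (x - 2 * d) = d * d) by lia.
  assert (2 * d < x) by (clear - Q st ys; nia); lia.
destruct (Z_le_gt_dec F C) as [f | f].
  clash H' A' A F [:: (1, -1); (2, -1); (1, -2)] [:: (1, -1); (1, -2)]
    s (s + d) x (s - be).
clash H' A' A C [:: (1, -1); (2, -1); (3, -1)] [:: (1, -1); (1, -2)]
  s (s + d) x (s - be).
Qed.

(** The outcomes are the lattices having reduced bases of both kinds: in the first, the second basis
    vector is replaced by the difference; in the second, the coordinates are swapped; the others
    need [s = t]. *)
Lemma gI_gII_inj : s * t + x * y = s * z' + t * y' ->
  (x = t - s /\ y' = y /\ z' = t - y) \/ (y = s /\ y' = s /\ z' = x) \/
  (s = t /\ x = s) \/ (s = t /\ y = s).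
Proof.
intros D; pose proof gI_gII_third as E.
pose proof gI_gII_neq as N; unfold okI in K; unfold okII in K'.
destruct (Z_le_gt_dec (t + y) (s + x)) as [c | c].
  destruct (Z.eq_dec s t) as [e | e]; [right; right; left; split; auto; nia | nia].
destruct (Z.eq_dec y s) as [e | e].
  subst y; destruct (Z.eq_dec s t) as [f | f]; [lia | ].
  right; left; assert (z' = s + x - y') by lia; subst z'.
  assert ((t - s) * (s - y') = 0) by lia; nia.
destruct (Z.eq_dec s t) as [f | f].
  subst t; assert (z' = s + x - y') by lia; subst z'.
  assert (x * (s - y) = 0) by lia; nia.
destruct (Z.eq_dec x (t - s)) as [g | g].
  left; subst x; assert (z' = t - y') by lia; subst z'.
  assert ((t - s) * (y - y') = 0) by lia; nia.
exfalso; apply N; lia.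
Qed.

End MixedPair.

(* Equality up to a symmetry of the square. *)
Inductive D4eq : (Z -> Z -> Prop) -> (Z -> Z -> Prop) -> Prop :=
| D4_ext P Q : (forall X Y, P X Y <-> Q X Y) -> D4eq P Q
| D4_swap P Q : D4eq (fun X Y => P Y X) Q -> D4eq P Q
| D4_neg P Q : D4eq (fun X Y => P (- X) Y) Q -> D4eq P Q.

Lemma D4eq_trans P Q S : D4eq P Q -> D4eq Q S -> D4eq P S.
Proof.
intros H; revert S; induction H as [P Q E | P Q H IH | P Q H IH]; intros S HS.
- revert P E; induction HS as [Q S E' | Q S H IH | Q S H IH]; intros P E.
  + apply D4_ext; intros X Y; rewrite E; apply E'.
  + apply D4_swap; apply IH; intros X Y; apply E.
  + apply D4_neg; apply IH; intros X Y; apply E.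
- apply D4_swap; auto.
- apply D4_neg; auto.
Qed.

Lemma D4eq_sym P Q : D4eq P Q -> D4eq Q P.
Proof.
intros H; induction H as [P Q E | P Q H IH | P Q H IH].
- apply D4_ext; intros X Y; split; apply E.
- apply (D4eq_trans IH), D4_swap, D4_ext; tauto.
- apply (D4eq_trans IH), D4_neg, D4_ext; intros X Y; rewrite Z.opp_involutive; tauto.
Qed.

Lemma same_count_sym N N' P Q : same_count N N' P Q -> same_count N' N Q P.
Proof.
intros H r; destruct (H r) as [l [l' [A [B C]]]].
exists l', l; auto.
Qed.

Lemma same_count_invol N' P P' Q (f : Z * Z -> Z * Z) :
  (forall p, f (f p) = p) -> (forall p, supn (f p).1 (f p).2 = supn p.1 p.2) ->
  (forall p, P' p.1 p.2 <-> P (f p).1 (f p).2) ->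
  same_count supn N' P Q -> same_count supn N' P' Q.
Proof.
intros ff nf PP H r; destruct (H r) as [l [l' [[Nl Il] [B C]]]].
exists (List.map f l), l'; split; [split | split; [auto | rewrite length_map; auto]].
  apply NoDup_map_NoDup_ForallPairs; auto.
  intros p q _ _ e; rewrite -(ff p) e; auto.
intros n m; rewrite in_map_iff; split.
  intros [p [e I]]; pose proof (PP (n, m)) as Pf; pose proof (nf (n, m)) as Nf.
  rewrite -e ff in Pf; rewrite -e ff in Nf; simpl in Pf, Nf.
  destruct p as [p1 p2]; apply Il in I; rewrite e in Pf Nf; simpl in *.
  rewrite -Nf; tauto.
intros [I1 I2]; exists (f (n, m)); split; auto.
destruct (f (n, m)) as [c d] eqn:e; apply Il.
pose proof (PP (n, m)) as Pf; pose proof (nf (n, m)) as Nf; rewrite e in Pf Nf; simpl in *.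
rewrite Nf; tauto.
Qed.

Lemma same_count_D4 N' P P' Q : D4eq P P' ->
  same_count supn N' P Q -> same_count supn N' P' Q.
Proof.
intros H; induction H as [P P' E | P P' H IH | P P' H IH]; intros C.
- apply (@same_count_invol _ _ _ _ id) with (4 := C); auto; split; apply E.
- apply IH; apply (@same_count_invol _ _ _ _ (fun p => (p.2, p.1))) with (4 := C); auto.
  + intros [a b]; auto.
  + intros [a b]; unfold supn; simpl; lia.
  + simpl; tauto.
- apply IH; apply (@same_count_invol _ _ _ _ (fun p => (- p.1, p.2))) with (4 := C); auto.
  + intros [a b]; simpl; f_equal; lia.
  + intros [a b]; unfold supn; simpl; lia.
  + simpl; tauto.
Qed.

(** * Lattices in the plane and their bases *)

Definition Lat (u1 u2 v1 v2 X Y : Z) : Prop :=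
  exists n m, X = n * u1 + m * v1 /\ Y = n * u2 + m * v2.
Definition latI (s t x y : Z) := Lat s y (- x) t.
Definition latII (s t y z : Z) := Lat s y t (- z).

(** A nonzero determinant makes the coefficients of a lattice vector unique, so counting vectors is
    counting coefficients. *)
Lemma same_count_basis u1 u2 v1 v2 u1' u2' v1' v2' :
  u1 * v2 - u2 * v1 <> 0 -> u1' * v2' - u2' * v1' <> 0 ->
  same_count supn supn (Lat u1 u2 v1 v2) (Lat u1' u2' v1' v2') ->
  gcount (fun n m => supn (n * u1 + m * v1) (n * u2 + m * v2))
         (fun n m => supn (n * u1' + m * v1') (n * u2' + m * v2')).
Proof.
assert (W : forall u1 u2 v1 v2 r l, u1 * v2 - u2 * v1 <> 0 ->
  NoDup l -> (forall n m, In (n, m) l <-> Lat u1 u2 v1 v2 n m /\ supn n m <= r) ->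
  exists k, length k = length l /\ NoDup k /\
   forall n m, In (n, m) k <-> True /\ supn (n * u1 + m * v1) (n * u2 + m * v2) <= r).
  clear; intros u1 u2 v1 v2 r l det Nl Il.
  pose (f := fun p : Z * Z => (p.1 * u1 + p.2 * v1, p.1 * u2 + p.2 * v2)).
  assert (injf : forall p q, f p = f q -> p = q).
    intros [a b] [c d] e; injection e as e1 e2.
    assert ((a - c) * (u1 * v2 - u2 * v1) = 0).
      replace ((a - c) * (u1 * v2 - u2 * v1)) with ((a * u1 + b * v1 - (c * u1 + d * v1)) * v2 - (a * u2 + b * v2 - (c * u2 + d * v2)) * v1) by ring.
      simpl in e1, e2; rewrite e1 e2; ring.
    assert ((b - d) * (u1 * v2 - u2 * v1) = 0).
      replace ((b - d) * (u1 * v2 - u2 * v1)) with ((a * u2 + b * v2 - (c * u2 + d * v2)) * u1 - (a * u1 + b * v1 - (c * u1 + d * v1)) * u2) by ring.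
      simpl in e1, e2; rewrite e1 e2; ring.
    f_equal; nia.
  assert (Ek : exists k, List.map f k = l).
    assert (Hl : forall p, In p l -> exists q, f q = p).
      intros [n m] I; apply Il in I; destruct I as [[a [b [-> ->]]] _].
      exists (a, b); auto.
    clear Nl Il; induction l as [ | p l IH]; [exists nil; auto | ].
    destruct IH as [k ek]; [intros; apply Hl; simpl; auto | ].
    destruct (Hl p) as [q eq]; [simpl; auto | ].
    exists (q :: k); simpl; congruence.
  destruct Ek as [k <-]; exists k; split; [rewrite length_map; auto | split].
    apply (NoDup_map_inv _ _ Nl).
  intros n m; split.
    intro I; apply (in_map f) in I; apply Il in I; tauto.
  intros [_ I].
  assert (J : In (f (n, m)) (List.map f k)).
    apply Il; split; [exists n, m; auto | auto].
  apply in_map_iff in J; destruct J as [q [e J]]; apply injf in e; subst; auto.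
intros d d' H r; destruct (H r) as [l [l' [[Nl Il] [[Nl' Il'] e]]]].
destruct (W _ _ _ _ r l d Nl Il) as [k [e1 K]].
destruct (W _ _ _ _ r l' d' Nl' Il') as [k' [e2 K']].
exists k, k'; split; [auto | split; [auto | congruence]].
Qed.

Lemma gcount_ext g g' h h' : (forall n m, g n m = h n m) ->
  (forall n m, g' n m = h' n m) -> gcount g g' -> gcount h h'.
Proof.
intros e e' H r; destruct (H r) as [l [l' [[Nl Il] [[Nl' Il'] E]]]].
exists l, l'; split; [split | split; [split | ]]; auto.
  intros; rewrite Il e; tauto.
intros; rewrite Il' e'; tauto.
Qed.

Lemma latI_count s t x y s' t' x' y' : okI s t x y -> okI s' t' x' y' ->
  same_count supn supn (latI s t x y) (latI s' t' x' y') ->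
  gcount (gI s t x y) (gI s' t' x' y').
Proof.
intros K K' H; apply same_count_basis in H; [ | unfold okI in K; nia | unfold okI in K'; nia].
apply (gcount_ext) with (3 := H); intros; unfold gI, supn; lia.
Qed.

Lemma latI_latII_count s t x y s' t' y' z' : okI s t x y -> okII s' t' y' z' ->
  same_count supn supn (latI s t x y) (latII s' t' y' z') ->
  gcount (gI s t x y) (gII s' t' y' z').
Proof.
intros K K' H; apply same_count_basis in H; [ | unfold okI in K; nia | unfold okII in K'; nia].
apply (gcount_ext) with (3 := H); intros; unfold gI, gII, supn; lia.
Qed.

Lemma latII_count s t y z s' t' y' z' : okII s t y z -> okII s' t' y' z' ->
  same_count supn supn (latII s t y z) (latII s' t' y' z') ->
  gcount (gII s t y z) (gII s' t' y' z').
Proof.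
intros K K' H; apply same_count_basis in H; [ | unfold okII in K; nia | unfold okII in K'; nia].
apply (gcount_ext) with (3 := H); intros; unfold gII, supn; lia.
Qed.

Ltac lat_eq a b c d :=
  intros X Y; unfold Lat, latI, latII;
  split; [intros [n [m [? ?]]]; exists (a n m), (b n m) | intros [n [m [? ?]]]; exists (c n m), (d n m)];
  subst; cbv beta; lia.

Lemma latII_flip s y z : D4eq (latII s s y z) (latII s s z y).
Proof.
unfold latII; apply D4_swap, D4_neg, D4_swap, D4_ext.
lat_eq (fun _ m : Z => m) (fun n _ : Z => n) (fun _ m : Z => m) (fun n _ : Z => n).
Qed.

Lemma latI_flip s x y : D4eq (latI s s x y) (latI s s y x).
Proof.
unfold latI; apply D4_swap, D4_neg, D4_ext.
lat_eq (fun _ m : Z => - m) (fun n _ : Z => n) (fun _ m : Z => m) (fun n _ : Z => - n).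
Qed.

(** * Reduction to a normal form *)

(** Lagrange reduction in the sup norm: while [b + a] or [b - a] is shorter than the longer basis
    vector [b], it replaces [b]. The sum of the two norms is a natural number that decreases. *)
Lemma reduced_basis u1 u2 v1 v2 : u1 * v2 - u2 * v1 <> 0 ->
  exists w1 w2 z1 z2, (forall X Y, Lat u1 u2 v1 v2 X Y <-> Lat w1 w2 z1 z2 X Y) /\
    Z.abs (u1 * v2 - u2 * v1) = Z.abs (w1 * z2 - w2 * z1) /\
    supn w1 w2 <= supn z1 z2 /\ supn z1 z2 <= supn (z1 - w1) (z2 - w2) /\
    supn z1 z2 <= supn (z1 + w1) (z2 + w2).
Proof.
assert (pos : forall X Y, 0 <= supn X Y) by (unfold supn; lia).
assert (W : forall k : nat, forall u1 u2 v1 v2, supn u1 u2 + supn v1 v2 <= Z.of_nat k ->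
  exists w1 w2 z1 z2, (forall X Y, Lat u1 u2 v1 v2 X Y <-> Lat w1 w2 z1 z2 X Y) /\
    Z.abs (u1 * v2 - u2 * v1) = Z.abs (w1 * z2 - w2 * z1) /\
    supn w1 w2 <= supn z1 z2 /\ supn z1 z2 <= supn (z1 - w1) (z2 - w2) /\
    supn z1 z2 <= supn (z1 + w1) (z2 + w2)); last first.
  intros _; apply (W (Z.to_nat (supn u1 u2 + supn v1 v2))).
  rewrite Z2Nat.id; [lia | pose proof (pos u1 u2); pose proof (pos v1 v2); lia].
clear u1 u2 v1 v2; intros k; induction k as [ | k IH]; intros u1 u2 v1 v2 Hk.
  exists u1, u2, v1, v2; split; [tauto | split; [auto | ]].
  unfold supn in *; assert (u1 = 0) by lia; assert (u2 = 0) by lia.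
  assert (v1 = 0) by lia; assert (v2 = 0) by lia; subst; lia.
assert (red : forall a1 a2 b1 b2, supn a1 a2 + supn b1 b2 <= Z.of_nat k.+1 ->
  supn a1 a2 <= supn b1 b2 ->
  exists w1 w2 z1 z2, (forall X Y, Lat a1 a2 b1 b2 X Y <-> Lat w1 w2 z1 z2 X Y) /\
    Z.abs (a1 * b2 - a2 * b1) = Z.abs (w1 * z2 - w2 * z1) /\
    supn w1 w2 <= supn z1 z2 /\ supn z1 z2 <= supn (z1 - w1) (z2 - w2) /\
    supn z1 z2 <= supn (z1 + w1) (z2 + w2)).
  clear u1 u2 v1 v2 Hk; intros a1 a2 b1 b2 Hk l.
  destruct (Z_le_gt_dec (supn b1 b2) (supn (b1 - a1) (b2 - a2))) as [c | c].
    destruct (Z_le_gt_dec (supn b1 b2) (supn (b1 + a1) (b2 + a2))) as [d | d].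
      exists a1, a2, b1, b2; tauto.
    destruct (IH a1 a2 (b1 + a1) (b2 + a2)) as [w1 [w2 [z1 [z2 [E [D F]]]]]]; [lia | ].
    exists w1, w2, z1, z2; split; [ | split; [ | auto]].
      intros X Y; rewrite -E; revert X Y.
      lat_eq (fun n m : Z => n - m) (fun _ m : Z => m) (fun n m : Z => n + m) (fun _ m : Z => m).
    rewrite -D; f_equal; lia.
  destruct (IH a1 a2 (b1 - a1) (b2 - a2)) as [w1 [w2 [z1 [z2 [E [D F]]]]]]; [lia | ].
  exists w1, w2, z1, z2; split; [ | split; [ | auto]].
    intros X Y; rewrite -E; revert X Y.
    lat_eq (fun n m : Z => n + m) (fun _ m : Z => m) (fun n m : Z => n - m) (fun _ m : Z => m).
  rewrite -D; f_equal; lia.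
destruct (Z_le_gt_dec (supn u1 u2) (supn v1 v2)) as [c | c]; [apply red; auto | ].
destruct (red v1 v2 u1 u2) as [w1 [w2 [z1 [z2 [E [D F]]]]]]; [lia | lia | ].
exists w1, w2, z1, z2; split; [ | split; [ | auto]].
  intros X Y; rewrite -E; revert X Y.
  lat_eq (fun _ m : Z => m) (fun n _ : Z => n) (fun _ m : Z => m) (fun n _ : Z => n).
rewrite -D; lia.
Qed.

(** On the boundaries excluded by the side conditions, the lattice also belongs, up to symmetry, to
    another of the three families. *)
Definition normal_form (P : Z -> Z -> Prop) (D : Z) : Prop :=
  (exists s t x, (0 < s <= t /\ 0 <= 2 * x <= s) /\ D = s * t /\ D4eq P (latI s t x 0)) \/
  (exists s t x y, (okI s t x y /\ 0 < x /\ 0 < y) /\ D = s * t + x * y /\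
     D4eq P (latI s t x y)) \/
  (exists s t y z, (okII s t y z /\ 0 < y /\ z < t /\ ~ (s = t /\ y + z = s)) /\
     D = s * z + t * y /\ D4eq P (latII s t y z)).

(** [x] matters only modulo [s] and up to sign, so it can be folded into [[0, s/2]]. *)
Lemma normal_form_rect P s t x : 0 < s <= t -> D4eq P (latI s t x 0) ->
  normal_form P (s * t).
Proof.
intros st H; left; pose proof (Z.div_mod x s) as E; pose proof (Z.mod_pos_bound x s) as B.
destruct (Z_le_gt_dec (2 * (x mod s)) s) as [c | c].
  exists s, t, (x mod s); split; [lia | split; [auto | ]].
  apply (D4eq_trans H), D4_ext; unfold latI.
  pose (k := x / s); assert (e : x = s * k + x mod s) by (unfold k; lia).
  clearbody k; set (r := x mod s) in *; clearbody r; subst x.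
  lat_eq (fun n m : Z => n - m * k) (fun _ m : Z => m) (fun n m : Z => n + m * k) (fun _ m : Z => m).
exists s, t, (s - x mod s); split; [lia | split; [auto | ]].
apply (D4eq_trans H), D4_neg, D4_ext; unfold latI.
pose (k := x / s); assert (e : x = s * k + x mod s) by (unfold k; lia).
clearbody k; set (r := x mod s) in *; clearbody r; subst x.
lat_eq (fun n m : Z => - n + m * (k + 1)) (fun _ m : Z => m)
  (fun n m : Z => - n + m * (k + 1)) (fun _ m : Z => m).
Qed.

(** Here (0, s) is among the shortest vectors; swapping the coordinates makes it horizontal. *)
Lemma normal_form_edge P s y : 0 < s -> D4eq P (latI s s 0 y) -> normal_form P (s * s).
Proof.
intros s0 H; apply (@normal_form_rect _ s s (- y)); [lia | ].
apply (D4eq_trans H), D4_swap, D4_ext; unfold latI.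
lat_eq (fun _ m : Z => m) (fun n _ : Z => n) (fun _ m : Z => m) (fun n _ : Z => n).
Qed.

Lemma normal_form_I P s t x y : okI s t x y -> D4eq P (latI s t x y) ->
  normal_form P (s * t + x * y).
Proof.
intros K H; unfold okI in K; destruct (Z.eq_dec y 0) as [e | e].
  subst y; replace (s * t + x * 0) with (s * t) by lia.
  apply (@normal_form_rect _ s t x); [lia | auto].
destruct (Z.eq_dec x 0) as [f | f].
  subst x; assert (s = t) by lia; subst t.
  replace (s * s + 0 * y) with (s * s) by lia.
  apply (@normal_form_edge _ s y); [lia | auto].
right; left; exists s, t, x, y; unfold okI; split; [lia | auto].
Qed.

Lemma normal_form_II P s t y z : okII s t y z -> 0 < y -> z < t ->
  D4eq P (latII s t y z) -> normal_form P (s * z + t * y).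
Proof.
intros K y0 zt H; unfold okII in K; destruct (Z.eq_dec s t) as [e | e].
  subst t; destruct (Z.eq_dec (y + z) s) as [f | f].
    replace (s * z + s * y) with (s * s) by nia.
    apply (@normal_form_edge _ s y); [lia | ].
    apply (D4eq_trans H), D4_ext; assert (z = s - y) by lia; subst z.
    lat_eq (fun n m : Z => n + m) (fun _ m : Z => - m) (fun n m : Z => n + m) (fun _ m : Z => - m).
  right; right; exists s, s, y, z; unfold okII; split; [lia | auto].
right; right; exists s, t, y, z; unfold okII; split; [lia | auto].
Qed.

Lemma normal_form_ext P Q D : D4eq P Q -> normal_form Q D -> normal_form P D.
Proof.
intros H [[s [t [x [K [d E]]]]] | [[s [t [x [y [K [d E]]]]]] | [s [t [y [z [K [d E]]]]]]]].
- left; exists s, t, x; split; [auto | split; [auto | apply (D4eq_trans H E)]].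
- right; left; exists s, t, x, y; split; [auto | split; [auto | apply (D4eq_trans H E)]].
- right; right; exists s, t, y, z; split; [auto | split; [auto | apply (D4eq_trans H E)]].
Qed.

Lemma supn_oppE a b c d :
  supn (- a) (- b) = supn a b /\ supn (- a) b = supn a b /\ supn a (- b) = supn a b /\
  supn b a = supn a b /\
  supn (- a - c) (- b - d) = supn (a + c) (b + d) /\
  supn (- a + c) (- b + d) = supn (a - c) (b - d) /\
  supn (- a - - c) (b - d) = supn (a - c) (b - d) /\
  supn (- a + - c) (b + d) = supn (a + c) (b + d) /\
  supn (a - c) (- b - - d) = supn (a - c) (b - d) /\
  supn (a + c) (- b + - d) = supn (a + c) (b + d).
Proof. unfold supn; repeat split; lia. Qed.

Lemma lattice_normal_form u1 u2 v1 v2 : u1 * v2 - u2 * v1 <> 0 ->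
  normal_form (Lat u1 u2 v1 v2) (Z.abs (u1 * v2 - u2 * v1)).
Proof.
intros D; destruct (reduced_basis D) as [w1 [w2 [z1 [z2 [E [F [A [B C]]]]]]]].
rewrite F; apply (normal_form_ext (D4_ext E)).
assert (D' : w1 * z2 - w2 * z1 <> 0) by lia.
clear u1 u2 v1 v2 D E F.
assert (swp : forall u1 u2 v1 v2, D4eq (Lat u1 u2 v1 v2) (Lat u2 u1 v2 v1)).
  intros; apply D4_swap, D4_ext.
  lat_eq (fun n _ : Z => n) (fun _ m : Z => m) (fun n _ : Z => n) (fun _ m : Z => m).
assert (ngX : forall u1 u2 v1 v2, D4eq (Lat u1 u2 v1 v2) (Lat (- u1) u2 (- v1) v2)).
  intros; apply D4_neg, D4_ext.
  lat_eq (fun n _ : Z => n) (fun _ m : Z => m) (fun n _ : Z => n) (fun _ m : Z => m).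
assert (ngY : forall u1 u2 v1 v2, D4eq (Lat u1 u2 v1 v2) (Lat u1 (- u2) v1 (- v2))).
  intros; apply D4_swap, D4_neg, D4_swap, D4_ext.
  lat_eq (fun n _ : Z => n) (fun _ m : Z => m) (fun n _ : Z => n) (fun _ m : Z => m).
assert (ngv : forall u1 u2 v1 v2, D4eq (Lat u1 u2 v1 v2) (Lat u1 u2 (- v1) (- v2))).
  intros; apply D4_ext.
  lat_eq (fun n _ : Z => n) (fun _ m : Z => - m) (fun n _ : Z => n) (fun _ m : Z => - m).
(* The first basis vector already lies in the octant [0 <= y <= s]; the larger coordinate of the
   second decides the kind of basis. *)
assert (core : forall s y v1 v2, 0 <= y <= s -> 0 < s ->
  s <= supn v1 v2 -> supn v1 v2 <= supn (v1 - s) (v2 - y) ->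
  supn v1 v2 <= supn (v1 + s) (v2 + y) ->
  normal_form (Lat s y v1 v2) (Z.abs (s * v2 - y * v1))).
  clear - ngX ngv; intros s y v1 v2 Hy s0 A B C.
  assert (half : forall v1 v2, 0 < v2 -> Z.abs v1 <= v2 -> s <= v2 ->
    supn v1 v2 <= supn (v1 - s) (v2 - y) -> supn v1 v2 <= supn (v1 + s) (v2 + y) ->
    normal_form (Lat s y v1 v2) (Z.abs (s * v2 - y * v1))).
    clear v1 v2 A B C; intros x t t0 H st B C.
    destruct (Z_le_gt_dec x 0) as [c | c].
      replace (Z.abs (s * t - y * x)) with (s * t + (- x) * y) by nia.
      apply normal_form_I.
        unfold okI; unfold supn in B, C; lia.
      unfold latI; rewrite Z.opp_involutive; apply D4_ext; tauto.
    (* For [x > 0] the difference of the basis vectors can only be as long as [t] if [y = 0]. *)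
    assert (y = 0) by (unfold supn in B; lia); subst y.
    replace (Z.abs (s * t - 0 * x)) with (s * t + x * 0) by nia.
    apply normal_form_I; [unfold okI; lia | ].
    apply (D4eq_trans (ngX _ _ _ _)), D4_ext.
    lat_eq (fun n _ : Z => - n) (fun _ m : Z => m) (fun n _ : Z => - n) (fun _ m : Z => m).
  assert (st : s <= Z.max (Z.abs v1) (Z.abs v2)) by auto.
  assert (sgn : supn (- v1) (- v2) <= supn (- v1 - s) (- v2 - y) /\
                supn (- v1) (- v2) <= supn (- v1 + s) (- v2 + y)).
    pose proof (supn_oppE v1 v2 s y) as E; decompose [and] E; clear E; split; congruence.
  destruct (Z_le_gt_dec (Z.abs v1) (Z.abs v2)) as [c | c].
    destruct (Z_le_gt_dec v2 0) as [d | d].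
      replace (s * v2 - y * v1) with (- (s * (- v2) - y * (- v1))) by lia.
      rewrite Z.abs_opp; apply (normal_form_ext (ngv _ _ _ _)).
      clear A B C; apply half; try apply sgn; lia.
    clear sgn A; apply half; auto; lia.
  assert (right : forall t v, 0 < t -> Z.abs v < t -> s <= t ->
    supn t v <= supn (t - s) (v - y) ->
    normal_form (Lat s y t v) (Z.abs (s * v - y * t))).
    clear v1 v2 A B C c sgn st; intros t v t0 H st B; unfold supn in B.
    replace (Z.abs (s * v - y * t)) with (s * (- v) + t * y) by nia.
    apply normal_form_II; [unfold okII; lia | lia | lia | ].
    unfold latII; rewrite Z.opp_involutive; apply D4_ext; tauto.
  destruct (Z_le_gt_dec v1 0) as [d | d].
    replace (s * v2 - y * v1) with (- (s * (- v2) - y * (- v1))) by lia.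
    rewrite Z.abs_opp; apply (normal_form_ext (ngv _ _ _ _)).
    clear A B C; apply right; try apply sgn; lia.
  clear sgn A; apply right; auto; lia.
(* Reflections move a first vector with dominant first coordinate into that octant. *)
assert (mid : forall u1 u2 v1 v2, Z.abs u2 <= Z.abs u1 -> u1 <> 0 ->
  supn u1 u2 <= supn v1 v2 -> supn v1 v2 <= supn (v1 - u1) (v2 - u2) ->
  supn v1 v2 <= supn (v1 + u1) (v2 + u2) ->
  normal_form (Lat u1 u2 v1 v2) (Z.abs (u1 * v2 - u2 * v1))).
  clear - core ngX ngY.
  assert (mid' : forall u1 u2 v1 v2, Z.abs u2 <= u1 -> 0 < u1 ->
    supn u1 u2 <= supn v1 v2 -> supn v1 v2 <= supn (v1 - u1) (v2 - u2) ->
    supn v1 v2 <= supn (v1 + u1) (v2 + u2) ->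
    normal_form (Lat u1 u2 v1 v2) (Z.abs (u1 * v2 - u2 * v1))).
    intros u1 u2 v1 v2 l u0 A B C.
    assert (A' : forall v1 v2, supn u1 u2 <= supn v1 v2 -> u1 <= supn v1 v2) by (unfold supn; lia).
    destruct (Z_le_gt_dec u2 0) as [d | d].
      replace (u1 * v2 - u2 * v1) with (- (u1 * (- v2) - (- u2) * v1)) by lia.
      rewrite Z.abs_opp; apply (normal_form_ext (ngY _ _ _ _)).
      pose proof (supn_oppE v1 v2 u1 u2) as E; decompose [and] E; clear E.
      apply A' in A; apply core; [lia | lia | congruence | congruence | congruence].
    apply A' in A; apply core; auto; lia.
  intros u1 u2 v1 v2 l u0 A B C; destruct (Z_le_gt_dec u1 0) as [c | c].
    replace (u1 * v2 - u2 * v1) with (- ((- u1) * v2 - u2 * (- v1))) by lia.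
    rewrite Z.abs_opp; apply (normal_form_ext (ngX _ _ _ _)).
    pose proof (supn_oppE v1 v2 u1 u2) as E; decompose [and] E; clear E.
    pose proof (supn_oppE u1 u2 v1 v2) as E; decompose [and] E; clear E.
    apply mid'; [lia | lia | congruence | congruence | congruence].
  apply mid'; auto; lia.
destruct (Z_le_gt_dec (Z.abs w2) (Z.abs w1)) as [c | c].
  apply mid; auto; intro e; subst w1; assert (w2 = 0) by lia; subst w2; lia.
replace (w1 * z2 - w2 * z1) with (- (w2 * z1 - w1 * z2)) by lia.
rewrite Z.abs_opp; apply (normal_form_ext (swp _ _ _ _)).
assert (sw : forall X Y, supn X Y = supn Y X) by (unfold supn; lia).
apply mid; [lia | lia | | | ]; rewrite (sw z2) (sw w2) || rewrite (sw z2) (sw (z2 - w2)) || rewrite (sw z2) (sw (z2 + w2)); auto.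
Qed.

(** * The counts determine the normal form *)

Lemma latI_latII_D4 P Q s t x y s' t' y' z' :
  okI s t x y -> 0 < x -> 0 < y -> okII s' t' y' z' -> 0 < y' -> z' < t' ->
  s * t + x * y = s' * z' + t' * y' ->
  D4eq P (latI s t x y) -> D4eq Q (latII s' t' y' z') ->
  same_count supn supn P Q -> D4eq P Q.
Proof.
intros K x0 y0 K' y0' zt D HP HQ H.
apply (same_count_D4 HP), same_count_sym, (same_count_D4 HQ), same_count_sym in H.
pose proof (latI_latII_count K K' H) as G.
destruct (red_norm_minima G (gI_red K) (gII_red K')) as [-> ->].
apply (D4eq_trans HP), D4eq_sym, (D4eq_trans HQ), D4eq_sym.
(* For [s = t] with [x = s] or [y = s], the first lattice is up to symmetry itself of the second
   kind, and two lattices of that kind remain to be compared. *)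
assert (viaII : forall u v, okII s' s' u v -> s' = t' -> s' * v + s' * u = s' * z' + s' * y' ->
  D4eq (latI s' t' x y) (latII s' s' u v) -> D4eq (latI s' t' x y) (latII s' t' y' z')).
  intros u v Ku e Duv Huv; subst t'; apply (D4eq_trans Huv).
  pose proof (latII_count Ku K' (same_count_D4 Huv H)) as G'.
  destruct (gII_inj Ku K' Duv G') as [[-> ->] | [_ [-> ->]]].
    apply D4_ext; tauto.
  apply latII_flip.
destruct (gI_gII_inj K K' x0 y0 y0' zt G D) as [[e1 [e2 e3]] | [[e1 [e2 e3]] | [[e1 e2] | [e1 e2]]]].
- subst; apply D4_ext.
  lat_eq (fun n m : Z => n + m) (fun _ m : Z => - m) (fun n m : Z => n + m) (fun _ m : Z => - m).
- subst; apply D4_swap, D4_ext.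
  lat_eq (fun n _ : Z => n) (fun _ m : Z => m) (fun n _ : Z => n) (fun _ m : Z => m).
- subst; apply (viaII y t'); unfold okI in K; [unfold okII; lia | lia | lia | ].
  apply D4_ext.
  lat_eq (fun n _ : Z => n) (fun _ m : Z => - m) (fun n _ : Z => n) (fun _ m : Z => - m).
- subst; apply (viaII t' x); unfold okI in K; [unfold okII; lia | lia | lia | ].
  apply D4_swap, D4_ext.
  lat_eq (fun n _ : Z => n) (fun _ m : Z => m) (fun n _ : Z => n) (fun _ m : Z => m).
Qed.

(** With equal minima the determinant is [s t] here, but [s t + x' y' > s t] for the other lattices
    of the first kind. For the second kind, [s (t - z') = t y'] and [t <= y' + z'] leave only the
    excluded case [s = t = y' + z']. *)
Lemma normal_form_I0_unique P Q D s t x : 0 < s <= t -> 0 <= 2 * x <= s -> D = s * t ->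
  D4eq P (latI s t x 0) -> normal_form Q D -> same_count supn supn P Q -> D4eq P Q.
Proof.
intros st Hx d HP HQ H; apply (same_count_D4 HP), same_count_sym in H.
assert (L : okI s t x 0) by (unfold okI; lia).
destruct HQ as [[s' [t' [x' [K' [d' HQ]]]]] |
  [[s' [t' [x' [y' [K' [d' HQ]]]]]] | [s' [t' [y' [z' [K' [d' HQ]]]]]]]];
apply (same_count_D4 HQ), same_count_sym in H.
- assert (L' : okI s' t' x' 0) by (unfold okI; lia).
  pose proof (latI_count L L' H) as G.
  destruct (red_norm_minima G (gI_red L) (gI_red L')) as [<- <-].
  assert (x = x').
    apply Z.le_antisymm.
      apply (gI0_inj st (proj2 K') Hx), gcount_sym; auto.
    apply (gI0_inj st Hx (proj2 K')); auto.
  subst; apply (D4eq_trans HP), D4eq_sym, HQ.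
- destruct K' as [L' [x0 y0]]; pose proof (latI_count L L' H) as G.
  destruct (red_norm_minima G (gI_red L) (gI_red L')) as [<- <-]; nia.
- destruct K' as [L' [y0 [zt ne]]]; pose proof (latI_latII_count L L' H) as G.
  destruct (red_norm_minima G (gI_red L) (gII_red L')) as [<- <-].
  unfold okII in L'; exfalso; apply ne.
  assert (E : s * (t - z') = t * y') by lia.
  assert (s = t) by nia; subst t; split; [auto | nia].
Qed.

Theorem same_count_normal_form P Q D : normal_form P D -> normal_form Q D ->
  same_count supn supn P Q -> D4eq P Q.
Proof.
intros NP NQ H.
destruct NP as [[s [t [x [K [d HP]]]]] | [[s [t [x [y [K [d HP]]]]]] | [s [t [y [z [K [d HP]]]]]]]].
  apply (@normal_form_I0_unique P Q D s t x); tauto.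
all: destruct NQ as [[s' [t' [x' [K' [d' HQ]]]]] |
  [[s' [t' [x' [y' [K' [d' HQ]]]]]] | [s' [t' [y' [z' [K' [d' HQ]]]]]]]].
- apply D4eq_sym, (@normal_form_I0_unique Q P D s' t' x'); try tauto.
    right; left; exists s, t, x, y; auto.
  apply same_count_sym; auto.
- apply (same_count_D4 HP), same_count_sym, (same_count_D4 HQ), same_count_sym in H.
  destruct K as [L [x0 y0]], K' as [L' [x0' y0']]; pose proof (latI_count L L' H) as G.
  destruct (red_norm_minima G (gI_red L) (gI_red L')) as [<- <-].
  apply (D4eq_trans HP), D4eq_sym, (D4eq_trans HQ), D4eq_sym.
  destruct (@gI_inj s t x y x' y') as [[-> ->] | [<- [-> ->]]]; auto; [lia | | ].
    apply D4_ext; tauto.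
  apply latI_flip.
- destruct K as [L [x0 y0]], K' as [L' [y0' [zt _]]].
  apply (latI_latII_D4 L x0 y0 L' y0' zt) with (2 := HP) (3 := HQ); auto; lia.
- apply D4eq_sym, (@normal_form_I0_unique Q P D s' t' x'); try tauto.
    right; right; exists s, t, y, z; auto.
  apply same_count_sym; auto.
- destruct K' as [L' [x0' y0']], K as [L [y0 [zt _]]].
  apply D4eq_sym, (latI_latII_D4 L' x0' y0' L y0 zt) with (2 := HQ) (3 := HP).
    lia.
  apply same_count_sym; auto.
- apply (same_count_D4 HP), same_count_sym, (same_count_D4 HQ), same_count_sym in H.
  destruct K as [L _], K' as [L' _]; pose proof (latII_count L L' H) as G.
  destruct (red_norm_minima G (gII_red L) (gII_red L')) as [<- <-].
  apply (D4eq_trans HP), D4eq_sym, (D4eq_trans HQ), D4eq_sym.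
  destruct (@gII_inj s t y z y' z') as [[-> ->] | [<- [-> ->]]]; auto; [lia | | ].
    apply D4_ext; tauto.
  apply latII_flip.
Qed.

Theorem plane_lattice_rigidity u1 u2 v1 v2 w1 w2 z1 z2 : u1 * v2 - u2 * v1 <> 0 ->
  Z.abs (u1 * v2 - u2 * v1) = Z.abs (w1 * z2 - w2 * z1) ->
  same_count supn supn (Lat u1 u2 v1 v2) (Lat w1 w2 z1 z2) ->
  D4eq (Lat u1 u2 v1 v2) (Lat w1 w2 z1 z2).
Proof.
intros d e H; apply same_count_normal_form with (D := Z.abs (u1 * v2 - u2 * v1)); auto.
  apply lattice_normal_form; auto.
rewrite e; apply lattice_normal_form; lia.
Qed.

End PlaneLattices.

(** * Smooth functions and homogeneity *)

Section Smooth.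
Variables (R : realType) (V : normedModType R) (U : set V).
Hypothesis openU : open U.
Implicit Types (f g : V -> R) (x v w : V).

Definition dir_C0 f :=
  forall x, U x -> {for x, continuous f} /\ forall v, derivable f x v.

(** Smoothness truncated at order [k], so that the Leibniz rule can be iterated by induction on the
    order. *)
Fixpoint Ck (k : nat) f : Prop :=
  dir_C0 f /\ if k is k'.+1 then forall v, Ck k' ('D_v f) else True.

Lemma Ck_C0 k f : Ck k f -> dir_C0 f. Proof. by case: k => [|k] /= [Cf _]. Qed.

Lemma Ck_derive k f v : Ck k.+1 f -> Ck k ('D_v f). Proof. by move=> /= [_]. Qed.

Lemma CkW k f : Ck k.+1 f -> Ck k f.
Proof. by elim: k f => [|k IH] f [f0 f1]; split=> // v; exact/IH/f1. Qed.

Lemma smooth_onP f : smooth_on U f <-> forall k, Ck k f.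
Proof.
split=> [sf k|Cf vs].
  elim: k f sf => [|k IH] f sf; split=> //; try by move=> x Ux; exact: (sf [::]).
  (* The last direction of the list is differentiated first. *)
  by move=> v; apply: IH => vs; have := sf (rcons vs v); rewrite /iter_derive foldr_rcons.
elim/last_ind: vs f Cf => [|vs v IH] f Cf; first exact: (Ck_C0 (Cf 0%N)).
rewrite /iter_derive foldr_rcons; apply: IH => k; exact: (Ck_derive _ (Cf k.+1)).
Qed.

Lemma smooth_derive f v : smooth_on U f -> smooth_on U ('D_v f).
Proof. by move=> /smooth_onP Cf; apply/smooth_onP => k; exact: (Ck_derive _ (Cf k.+1)). Qed.

Lemma smooth_C0 f : smooth_on U f -> dir_C0 f.
Proof. by move=> sf; exact: (sf [::]). Qed.

Lemma near_U x : U x -> \forall y \near x, U y.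
Proof. by move=> Ux; exact: open_nbhs_nbhs. Qed.

Lemma derive_congr f g x v : (forall y, U y -> f y = g y) -> U x -> 'D_v f x = 'D_v g x.
Proof.
move=> fg Ux; apply: near_eq_derive; near=> y; apply: fg; near: y; exact: near_U.
Unshelve. all: by end_near. Qed.

Lemma dir_C0_congr f g : (forall y, U y -> f y = g y) -> dir_C0 f -> dir_C0 g.
Proof.
move=> fg Cf x Ux; have nfg : {near x, f =1 g}.
  by near=> y; apply: fg; near: y; exact: near_U.
have [cf df] := Cf x Ux; split; last by move=> v; exact: (near_eq_derivable nfg).
suff : g @ x --> f x by rewrite fg.
by apply: cvg_trans cf; exact: near_eq_cvg.
Unshelve. all: by end_near. Qed.

Lemma Ck_congr k f g : (forall y, U y -> f y = g y) -> Ck k f -> Ck k g.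
Proof.
elim: k f g => [|k IH] f g fg [Cf df]; split; try exact: (dir_C0_congr fg Cf).
  exact: I.
by move=> v; apply: IH (df v) => y Uy; exact: derive_congr.
Qed.

Lemma Ck_cst k (c : R) : Ck k (cst c).
Proof.
elim: k c => [|k IH] c.
  by split=> // x _; split; [exact: cst_continuous|move=> v; exact: derivable_cst].
split; first by move=> x _; split; [exact: cst_continuous|move=> v; exact: derivable_cst].
by move=> v; apply: Ck_congr (IH 0) => y _; rewrite derive_cst.
Qed.

Lemma dir_C0D f g : dir_C0 f -> dir_C0 g -> dir_C0 (f \+ g).
Proof.
move=> Cf Cg x Ux; have [cf df] := Cf x Ux; have [cg dg] := Cg x Ux.
by split; [exact: continuousD|move=> v; exact: derivableD].
Qed.

Lemma CkD k f g : Ck k f -> Ck k g -> Ck k (f \+ g).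
Proof.
elim: k f g => [|k IH] f g [Cf df] [Cg dg]; split; try exact: (dir_C0D Cf Cg).
  exact: I.
move=> v; apply: Ck_congr (IH _ _ (df v) (dg v)) => y Uy.
by rewrite [RHS]deriveD //; [have [_] := Cf y Uy|have [_] := Cg y Uy].
Qed.

Lemma dir_C0M f g : dir_C0 f -> dir_C0 g -> dir_C0 (f \* g).
Proof.
move=> Cf Cg x Ux; have [cf df] := Cf x Ux; have [cg dg] := Cg x Ux.
by split; [exact: continuousM|move=> v; exact: derivableM].
Qed.

Lemma CkM k f g : Ck k f -> Ck k g -> Ck k (f \* g).
Proof.
elim: k f g => [|k IH] f g Hf Hg; have Cf := Ck_C0 Hf; have Cg := Ck_C0 Hg.
  by split; [exact: (dir_C0M Cf Cg)|exact: I].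
split; first exact: (dir_C0M Cf Cg).
move=> v; have := CkD (IH _ _ (CkW Hf) (Ck_derive v Hg)) (IH _ _ (CkW Hg) (Ck_derive v Hf)).
apply: Ck_congr => y Uy.
by rewrite [RHS]deriveM //; [have [_] := Cf y Uy|have [_] := Cg y Uy].
Qed.

Lemma smooth_congr f g : (forall y, U y -> f y = g y) -> smooth_on U f -> smooth_on U g.
Proof.
by move=> fg /smooth_onP Cf; apply/smooth_onP => k; exact: Ck_congr (Cf k).
Qed.

Lemma smooth_cst (c : R) : smooth_on U (cst c).
Proof. by apply/smooth_onP => k; exact: Ck_cst. Qed.

Lemma smoothD f g : smooth_on U f -> smooth_on U g -> smooth_on U (f \+ g).
Proof.
by move=> /smooth_onP Cf /smooth_onP Cg; apply/smooth_onP => k; exact: CkD.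
Qed.

Lemma smoothM f g : smooth_on U f -> smooth_on U g -> smooth_on U (f \* g).
Proof.
by move=> /smooth_onP Cf /smooth_onP Cg; apply/smooth_onP => k; exact: CkM.
Qed.

Lemma smooth_sum n (F : 'I_n -> V -> R) : (forall i, smooth_on U (F i)) ->
  smooth_on U (fun x => \sum_(i < n) F i x).
Proof.
elim: n F => [|n IH] F sF.
  by apply: smooth_congr (smooth_cst 0) => y _; rewrite big_ord0.
apply: smooth_congr (smoothD (sF ord0) (IH _ (fun i => sF (lift ord0 i)))) => y _ /=.
by rewrite big_ord_recl.
Qed.

Lemma smoothX f n : smooth_on U f -> smooth_on U (fun x => f x ^+ n).
Proof.
move=> sf; elim: n => [|n IH]; first by apply: smooth_congr (smooth_cst 1) => y _; rewrite expr0.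
by apply: smooth_congr (smoothM sf IH) => y _; rewrite exprS.
Qed.

Lemma derive_line f p v t : derivable f (p + t *: v) v ->
  is_derive t 1 (fun s : R => f (p + s *: v)) ('D_v f (p + t *: v)).
Proof.
move=> df; set g := fun s : R => _.
have E : (fun h : R => h^-1 *: ((g \o shift t) (h *: (1 : R)) - g t)) =
         (fun h : R => h^-1 *: ((f \o shift (p + t *: v)) (h *: v) - f (p + t *: v))).
  by apply/funext => h; rewrite /g /= [h%:A]mulr1 scalerDl addrCA.
by split; rewrite /derivable /derive E.
Qed.

Lemma derive_line_mvt f p v (c : R) :
  (forall t : R, `|t| <= `|c| -> derivable f (p + t *: v) v) ->
  exists2 t : R, `|t| <= `|c| & f (p + c *: v) - f p = c * 'D_v f (p + t *: v).
Proof.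
move=> df; pose g (s : R) := f (p + s *: v); pose dg s := 'D_v f (p + s *: v).
have dgP (s : R) : `|s| <= `|c| -> is_derive s 1 g (dg s) by move=> /df; exact: derive_line.
have E : f p = g 0 by rewrite /g scale0r addr0.
have cg (a b : R) : (forall s : R, s \in `[a, b] -> `|s| <= `|c|) -> {within `[a, b], continuous g}.
  move=> ab; apply: derivable_within_continuous => s /ab sc.
  by have [] := dgP s sc.
rewrite E -/(g c); case: (ltrgtP c 0) => c0.
- have B (s : R) : s \in `[c, 0] -> `|s| <= `|c|.
    rewrite in_itv /= => /andP[cs s0]; rewrite !ler0_norm ?(ltW c0) //; lra.
  have [t tc e] := MVT c0 (fun s sc => dgP s (B s (subset_itv_oo_cc sc))) (cg _ _ B).
  exists t; first by apply: B; exact: subset_itv_oo_cc.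
  by rewrite -[LHS]opprB e sub0r mulrN opprK mulrC.
- have B (s : R) : s \in `[0, c] -> `|s| <= `|c|.
    rewrite in_itv /= => /andP[cs s0]; rewrite !ger0_norm ?(ltW c0) //; lra.
  have [t tc e] := MVT c0 (fun s sc => dgP s (B s (subset_itv_oo_cc sc))) (cg _ _ B).
  exists t; first by apply: B; exact: subset_itv_oo_cc.
  by rewrite e subr0 mulrC.
by exists 0; rewrite ?normr0 // c0 subrr mul0r.
Qed.

(** The second difference of [f] over the parallelogram with sides [T v] and [T w] is, by two mean
    value steps, [T ^ 2] times a mixed derivative at a nearby point. Taking the sides in either
    order gives both mixed derivatives, which are continuous. *)
Lemma Schwarz f x v w : smooth_on U f -> U x -> 'D_v ('D_w f) x = 'D_w ('D_v f) x.
Proof.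
move=> sf Ux; apply/eqP; rewrite -subr_eq0 -normr_le0; apply/ler_addgt0Pr => e e0.
rewrite add0r.
have C2 a b : {for x, continuous ('D_a ('D_b f))}.
  by have [] := smooth_C0 (smooth_derive a (smooth_derive b sf)) Ux.
have [d d0 Hd] : exists2 d, 0 < d & forall y, `|y - x| < d -> U y /\
    `|'D_v ('D_w f) x - 'D_v ('D_w f) y| < e / 2 /\
    `|'D_w ('D_v f) x - 'D_w ('D_v f) y| < e / 2.
  have e20 : 0 < e / 2 by rewrite divr_gt0.
  have h1 : \forall y \near x, `|'D_v ('D_w f) x - 'D_v ('D_w f) y| < e / 2.
    by move/cvgrPdist_lt: (C2 v w); apply.
  have h2 : \forall y \near x, `|'D_w ('D_v f) x - 'D_w ('D_v f) y| < e / 2.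
    by move/cvgrPdist_lt: (C2 w v); apply.
  have HF : \forall y \near x, U y /\ (`|'D_v ('D_w f) x - 'D_v ('D_w f) y| < e / 2 /\
    `|'D_w ('D_v f) x - 'D_w ('D_v f) y| < e / 2).
    by apply: (filterI (near_U Ux)); exact: (filterI h1).
  move/nbhs_ballP: HF => [d d0 Hd].
  exists d => // y yx; apply: Hd.
  by rewrite -ball_normE /= distrC.
(* With this [T] all points [x + a v + b w] with [|a|, |b| <= T] stay within distance [d] of [x];
   the summand 1 covers [v = w = 0]. *)
pose T := d / (2 * (`|v| + `|w| + 1)); have N0 : 0 < `|v| + `|w| + 1.
  by rewrite ltr_wpDl // addr_ge0.
have T0 : 0 < T by rewrite divr_gt0 // mulr_gt0.
have small (a b : R) : `|a| <= `|T| -> `|b| <= `|T| -> `|x + a *: v + b *: w - x| < d.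
  move=> aT bT; rewrite (_ : _ - x = a *: v + b *: w); last by rewrite addrAC (addrC x) addrK.
  apply: (le_lt_trans (ler_normD _ _)); rewrite !normrZ.
  rewrite (gtr0_norm T0) in aT bT.
  have : T * (`|v| + `|w|) < d.
    rewrite /T -mulrA gtr_pMr // mulrC ltr_pdivrMr ?mulr_gt0 // mul1r.
    by have := normr_ge0 v; have := normr_ge0 w; nra.
  apply: le_lt_trans; rewrite mulrDr lerD // ler_wpM2r //.
clearbody T; have half (a b : V) (sm : forall s r : R, `|s| <= `|T| -> `|r| <= `|T| -> `|x + s *: a + r *: b - x| < d) :
    exists s r : R, [/\ `|s| <= `|T|, `|r| <= `|T| &
     f (x + T *: a + T *: b) - f (x + T *: a) - (f (x + T *: b) - f x)
       = T * (T * 'D_b ('D_a f) (x + s *: a + r *: b))].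
  have Usm (s r : R) : `|s| <= `|T| -> `|r| <= `|T| -> U (x + s *: a + r *: b).
    by move=> h1 h2; have [] := Hd _ (sm s r h1 h2).
  have D g (s r : R) : smooth_on U g -> `|s| <= `|T| -> `|r| <= `|T| ->
      forall u, derivable g (x + s *: a + r *: b) u.
    by move=> sg h1 h2; have [_] := smooth_C0 sg (Usm s r h1 h2).
  pose g y := f (y + T *: b) - f y.
  have z0 : `|0 : R| <= `|T| by rewrite normr0.
  have d1 (s : R) : `|s| <= `|T| -> derivable (fun y => f (y + T *: b)) (x + s *: a) a.
    move=> sT; have := D f s T sf sT (lexx _) a.
    rewrite /derivable; set q := fun h : R => _; set q' := fun h : R => _.
    suff -> : q = q' by [].
    by apply/funext => h; rewrite /q /q' /= !addrA.
  have d2 (s : R) : `|s| <= `|T| -> derivable f (x + s *: a) a.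
    by move=> sT; have := D f s 0 sf sT z0 a; rewrite scale0r addr0.
  have [s sT es] := @derive_line_mvt g x a T (fun s h => derivableB (d1 s h) (d2 s h)).
  have eD : 'D_a g (x + s *: a) = 'D_a f (x + s *: a + T *: b) - 'D_a f (x + s *: a).
    rewrite [LHS]deriveB; [|exact: d1|exact: d2].
    congr (_ - _); rewrite /derive; congr (lim _).
    by set q := fun h : R => _; set q' := fun h : R => _; suff -> : q = q' by [];
      apply/funext => h; rewrite /q /q' /= !addrA.
  have [r rT er] := @derive_line_mvt ('D_a f) (x + s *: a) b T
    (fun r h => D _ s r (smooth_derive a sf) sT h b).
  by exists s, r; split=> //; rewrite -er -eD -es /g.
have [s [r [sT rT e1]]] := half v w small.
have [s' [r' [sT' rT' e2]]] : exists s r : R, [/\ `|s| <= `|T|, `|r| <= `|T| &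
     f (x + T *: w + T *: v) - f (x + T *: w) - (f (x + T *: v) - f x)
       = T * (T * 'D_v ('D_w f) (x + s *: w + r *: v))].
  by apply: half => s' r' h1 h2; rewrite [x + _ + _]addrAC; exact: small.
have E : 'D_w ('D_v f) (x + s *: v + r *: w) = 'D_v ('D_w f) (x + s' *: w + r' *: v).
  move: e1 e2; rewrite [x + T *: w + T *: v]addrAC.
  move: ('D_w _ _) ('D_v _ _) (f _) (f _) (f _) (f _) => a b c1 c2 c3 c4 e1 e2.
  apply: (mulfI (lt0r_neq0 T0)); apply: (mulfI (lt0r_neq0 T0)).
  by rewrite -e1 -e2; lra.
have [_ [_ h1]] := Hd _ (small s r sT rT).
have [_ [h2 _]] : U (x + s' *: w + r' *: v) /\
    `|'D_v ('D_w f) x - 'D_v ('D_w f) (x + s' *: w + r' *: v)| < e / 2 /\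
    `|'D_w ('D_v f) x - 'D_w ('D_v f) (x + s' *: w + r' *: v)| < e / 2.
  by apply: Hd; rewrite [x + _ + _]addrAC; exact: small.
rewrite E in h1; move: h1 h2; clear.
move: ('D_v _ x) ('D_w _ x) ('D_v _ _) => A B C h1 h2; rewrite [e]splitr.
rewrite (_ : A - B = (A - C) - (B - C)); last by rewrite opprB addrA subrK.
by apply: (le_trans (ler_normB _ _)); apply: ltW; exact: ltrD h2 h1.
Qed.

End Smooth.

(** * Differentiability from continuous partial derivatives *)

Section ColumnVectors.
Variables (R : realType) (n : nat).
Local Notation V := 'cV[R]_n.
Implicit Types (h x v : V).

Definition basisv (i : 'I_n) : V := delta_mx i 0.

Lemma colE h : h = \sum_i h i 0 *: basisv i.
Proof.
rewrite [LHS]matrix_sum_delta; apply: eq_bigr => i _.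
by rewrite big_ord1.
Qed.

Lemma colv_norm_entry h i : `|h i 0| <= `|h|.
Proof. by rewrite [leRHS]/Num.norm /= mx_normrE; apply/bigmax_geP; right => /=; exists (i, 0). Qed.

Lemma colv_norm_le h (r : R) : 0 <= r -> (forall i, `|h i 0| <= r) -> `|h| <= r.
Proof.
move=> r0 hr; rewrite [leLHS]/Num.norm /= mx_normrE; apply/bigmax_leP; split=> // -[i j] _ /=.
by rewrite (ord1 j).
Qed.

Lemma derive_coord i x v : 'D_v (fun h : V => h i 0) x = v i 0.
Proof.
have @g : {linear V -> R}.
  by exists (fun h : V => h i 0); do 2![eexists]; do ?[constructor];
     rewrite ?mxE// => ? *; rewrite ?mxE//; move=> ?; rewrite !mxE.
rewrite deriveE; last exact: differentiable_coord.
rewrite (_ : (fun h : V => h i 0) = g) // diff_lin //; exact: coord_continuous.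
Qed.

Lemma smooth_coord (U : set V) i : open U -> smooth_on U (fun h : V => h i 0).
Proof.
move=> oU; have C0 : dir_C0 U (fun h : V => h i 0).
  move=> x _; split=> [|v]; first exact: coord_continuous.
  exact/diff_derivable/differentiable_coord.
apply/smooth_onP => -[|k]; split=> // v.
by apply: (Ck_congr oU) (Ck_cst oU k (v i 0)) => y _; rewrite derive_coord.
Qed.

(** The increment is split along a path that changes one coordinate at a time; each piece is a mean
    value on a line, and continuity of the partial derivatives bounds the error. *)
Lemma differentiable_colv (f : V -> R) x (U : set V) : open U -> smooth_on U f -> U x ->
  differentiable f x.
Proof.
move=> oU sf Ux; pose df h : R := \sum_i h i 0 * 'D_(basisv i) f x.
have dfL : linear df.
  move=> a u v; rewrite /df scaler_sumr -big_split /=; apply: eq_bigr => i _.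
  by rewrite !mxE mulrDl -mulrA.
pose dfm := GRing.isLinear.Build _ _ _ _ _ dfL.
pose dfl : {linear V -> R} := HB.pack df dfm.
have cdf : continuous dfl.
  have sdf : smooth_on [set: V] dfl.
    apply: smooth_sum => [|i]; first exact: openT.
    by apply: smoothM; [exact: openT|exact: smooth_coord openT|exact: smooth_cst openT _].
  by move=> y; have [] := smooth_C0 sdf (I : [set: V] y).
have E : f \o shift x = (cst (f x) + (dfl : V -> R)) +o_ (0 : V) id.
  apply/eqaddoP => _/posnumP[e]; rewrite /=.
  (* [n + 1] rather than [n] keeps the divisor positive when [n = 0]. *)
  pose N : R := n%:R + 1; have N0 : 0 < N by rewrite /N ltr_wpDl.
  have [d d0 Hd] : exists2 d, 0 < d & forall y, `|y - x| < d -> U y /\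
     forall i, `|'D_(basisv i) f y - 'D_(basisv i) f x| <= e%:num / N.
    have h1 : \forall y \near x, forall i, `|'D_(basisv i) f y - 'D_(basisv i) f x| <= e%:num / N.
      have nF : Filter (nbhs x) by exact: nbhs_filter.
      apply: (@filter_forall V 'I_n
        (fun i y => `|'D_(basisv i) f y - 'D_(basisv i) f x| <= e%:num / N) (nbhs x) nF) => i.
      have [+ _] := smooth_C0 (smooth_derive (basisv i) sf) Ux.
      move=> /cvgrPdist_le /(_ (e%:num / N)); rewrite divr_gt0 // => /(_ isT).
      by apply: filterS => y; rewrite distrC.
    have HF : \forall y \near x, U y /\
        forall i, `|'D_(basisv i) f y - 'D_(basisv i) f x| <= e%:num / N.
      by apply: (filterI (near_U oU Ux)).
    move/nbhs_ballP: HF => [d d0 Hd].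
    exists d => // y yx; apply: Hd.
    by rewrite -ball_normE /= distrC.
  near=> h; have hd : `|h| < d.
    by near: h; apply/nbhs_ballP; exists d => // y; rewrite -ball_normE /= sub0r normrN.
  (* The increment [h] truncated to its first [k] coordinates. *)
  pose hk (k : nat) : V := \sum_(i < n | (i < k)%N) h i 0 *: basisv i.
  have hkE k i : hk k i 0 = if (i < k)%N then h i 0 else 0.
    rewrite summxE; case: ifP => ik.
      rewrite (bigD1 i) //= big1 ?addr0 => [|j /andP[_ ji]]; rewrite !mxE /=.
        by rewrite eqxx mulr1.
      by rewrite eq_sym (negPf ji) mulr0.
    rewrite big1 // => j jk; rewrite !mxE; case: eqP => [ij|_]; last by rewrite mulr0.
    by rewrite ij jk in ik.
  have hkn : hk n = h by apply/colP => i; rewrite hkE ltn_ord.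
  have hk0 : hk 0%N = 0 by apply/colP => i; rewrite hkE mxE.
  have hkS (k : 'I_n) : hk k.+1 = hk k + h k 0 *: basisv k.
    apply/colP => i; rewrite !mxE !hkE eqxx andbT ltnS.
    have [->|ik] := eqVneq i k; first by rewrite leqnn ltnn add0r mulr1.
    by rewrite leq_eqVlt val_eqE (negPf ik) mulr0 addr0.
  have small (k : 'I_n) (t : R) : `|t| <= `|h k 0| -> `|hk k + t *: basisv k| <= `|h|.
    move=> th; apply: colv_norm_le => // i; rewrite !mxE hkE eqxx andbT.
    have [->|ik] := eqVneq i k.
      by rewrite ltnn add0r mulr1; apply: (le_trans th); exact: colv_norm_entry.
    rewrite mulr0 addr0; case: ifP => _; last by rewrite normr0.
    exact: colv_norm_entry.
  have tel : f (h + x) - f x = \sum_(k < n) (f (x + hk k.+1) - f (x + hk k)).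
    rewrite -(big_mkord xpredT (fun k => f (x + hk k.+1) - f (x + hk k))).
    by rewrite (telescope_sumr (fun k => f (x + hk k))) // hk0 hkn addr0 (addrC h).
  rewrite /= -[X in `|X|]/(f (h + x) - (f x + df h)) opprD addrA tel /df -sumrB.
  apply: (le_trans (ler_norm_sum _ _ _)).
  have -> : e%:num * `|h| = N * (e%:num / N * `|h|).
    by rewrite mulrA; congr (_ * _); rewrite mulrC divfK // gt_eqF.
  apply: (@le_trans _ _ (\sum_(k < n) (e%:num / N * `|h|))); last first.
    have c0 : 0 <= e%:num / N * `|h| by rewrite mulr_ge0 // divr_ge0 // ltW.
    by rewrite sumr_const card_ord -mulr_natl; apply: ler_wpM2r => //; rewrite /N lerDl.
  apply: ler_sum => k _.
  have der (t : R) : `|t| <= `|h k 0| -> derivable f (x + hk k + t *: basisv k) (basisv k).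
    move=> th; have [|Uy _] := Hd (x + hk k + t *: basisv k).
      by rewrite addrAC (addrAC x) subrr add0r; apply: le_lt_trans hd; exact: small.
    by have [] := smooth_C0 sf Uy.
  have [t th e1] := derive_line_mvt der.
  rewrite hkS addrA e1 -mulrBr normrM mulrC; apply: ler_pM => //.
    have [|_ ->//] := Hd (x + hk k + t *: basisv k).
    by rewrite addrAC (addrAC x) subrr add0r; apply: le_lt_trans hd; exact: small.
  exact: colv_norm_entry.
have D := diff_unique cdf E.
by apply/diff_locallyP; rewrite D.
Unshelve. all: by end_near. Qed.

End ColumnVectors.

Section LineDerivative.
Variables (R : realType) (V : normedModType R).
Implicit Types (f : V -> R) (x v : V).

Lemma is_derive_lineP f x v (d : R) :
  is_derive x v f d <-> is_derive (0 : R) 1 (fun s : R => f (x + s *: v)) d.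
Proof.
set g := fun s : R => _.
have E : (fun h : R => h^-1 *: ((g \o shift 0) (h *: (1 : R)) - g 0)) =
         (fun h : R => h^-1 *: ((f \o shift x) (h *: v) - f x)).
  by apply/funext => h; rewrite /g /= [h%:A]mulr1 scale0r !addr0 [x + _]addrC.
by split=> -[D1 D2]; split; move: D1 D2; rewrite /derivable /derive E.
Qed.

Lemma is_derive_compR f (g : R -> R) x v (df dg : R) :
  is_derive x v f df -> is_derive (f x) 1 g dg -> is_derive x v (g \o f) (dg * df).
Proof.
move=> /is_derive_lineP Df Dg; apply/is_derive_lineP.
apply: (@is_derive1_comp _ g (fun s : R => f (x + s *: v)) 0 dg df) => //.
by rewrite scale0r addr0.
Qed.

End LineDerivative.

(** * Inner product and Euclidean norm *)

Section Dot.
Variable R : realType.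
Local Notation V := 'cV[R]_4.
Implicit Types (x y v w : V).

Definition punctured : set V := [set y : V | y != 0].

Lemma dotvC x y : dotv x y = dotv y x.
Proof. by apply: eq_bigr => i _; rewrite mulrC. Qed.

Lemma dotvDl x y v : dotv (x + y) v = dotv x v + dotv y v.
Proof. by rewrite -big_split; apply: eq_bigr => i _; rewrite mxE mulrDl. Qed.

Lemma dotvZl (a : R) x v : dotv (a *: x) v = a * dotv x v.
Proof. by rewrite /dotv mulr_sumr; apply: eq_bigr => i _; rewrite mxE mulrA. Qed.

Lemma dotvDr x y v : dotv v (x + y) = dotv v x + dotv v y.
Proof. by rewrite dotvC dotvDl !(dotvC v). Qed.

Lemma dotvZr (a : R) x v : dotv v (a *: x) = a * dotv v x.
Proof. by rewrite dotvC dotvZl (dotvC v). Qed.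

Lemma dotv_ge0 x : 0 <= dotv x x.
Proof. by apply: sumr_ge0 => i _; rewrite -expr2 sqr_ge0. Qed.

Lemma dotv_eq0 x : (dotv x x == 0) = (x == 0).
Proof.
apply/eqP/eqP => [/eqP|->]; last by rewrite /dotv big1 // => i _; rewrite mxE mul0r.
rewrite psumr_eq0 => [/allP x0|i _]; last by rewrite -expr2 sqr_ge0.
apply/colP => i; rewrite mxE; apply/eqP.
by have := x0 i (mem_index_enum _); rewrite mulf_eq0 orbb.
Qed.

Lemma dotv_gt0 x : (0 < dotv x x) = (x != 0).
Proof. by rewrite lt_def dotv_ge0 andbT dotv_eq0. Qed.

Lemma smooth_dotv (U : set V) v : open U -> smooth_on U (fun y => dotv y v).
Proof.
move=> oU; apply: (smooth_sum oU) => i; apply: (smoothM oU (smooth_coord i oU)).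
exact: smooth_cst.
Qed.

Lemma smooth_dotvv (U : set V) : open U -> smooth_on U (fun y => dotv y y).
Proof.
by move=> oU; apply: (smooth_sum oU) => i; apply: (smoothM oU); exact: smooth_coord.
Qed.

Lemma derive_dotvv x v : 'D_v (fun y => dotv y y) x = 2 * dotv x v.
Proof.
have dc i y : derivable (fun h : V => h i 0) y v.
  exact/diff_derivable/differentiable_coord.
rewrite (_ : (fun y => dotv y y) = \sum_(i < 4) ((fun h : V => h i 0) \* (fun h : V => h i 0))).
  rewrite derive_sum => [|i]; last exact: derivableM.
  rewrite mulr_sumr; apply: eq_bigr => i _; rewrite deriveM // derive_coord.
  by rewrite /GRing.scale /=; lra.
by apply/funext => y; rewrite fct_sumE.
Qed.

Lemma open_punctured : open punctured.
Proof.
rewrite (_ : punctured = (fun y : V => dotv y y) @^-1` [set t : R | 0 < t]); last first.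
  by apply/seteqP; split=> y /=; rewrite /punctured /= dotv_gt0.
apply: open_comp; last exact: open_gt.
by move=> y _; have [] := smooth_C0 (smooth_dotvv openT) (I : [set: V] y).
Qed.

(** The Euclidean norm; the norm that column vectors carry as a normed module is the sup norm. *)
Definition enorm y : R := Num.sqrt (dotv y y).

Lemma enorm_gt0 y : (0 < enorm y) = (y != 0).
Proof. by rewrite sqrtr_gt0 dotv_gt0. Qed.

Lemma enorm_sqr y : enorm y ^+ 2 = dotv y y.
Proof. by rewrite sqr_sqrtr ?dotv_ge0. Qed.

Lemma enormZ (a : R) y : 0 <= a -> enorm (a *: y) = a * enorm y.
Proof.
move=> a0; rewrite /enorm dotvZl dotvZr mulrA -expr2 sqrtrM ?sqr_ge0 //.
by rewrite sqrtr_sqr ger0_norm.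
Qed.

Lemma is_derive_enormV x v : x != 0 ->
  is_derive x v (fun y => (enorm y)^-1) (- dotv x v * ((enorm x)^-1 ^+ 3)).
Proof.
move=> x0; have nx : 0 < dotv x x by rewrite dotv_gt0.
have ex0 : 0 < enorm x by rewrite enorm_gt0.
have D1 : is_derive x v (fun y => dotv y y) (2 * dotv x v).
  rewrite -derive_dotvv; apply: derivableP.
  by have [_] := smooth_C0 (smooth_dotvv openT) (I : [set: V] x).
have D2 := is_derive_compR D1 (is_derive1_sqrt nx).
have D3 : is_derive x v (fun y => (enorm y)^-1) (- (enorm x) ^- 2 *: ((2 * Num.sqrt (dotv x x))^-1 * (2 * dotv x v))).
  have ne : enorm x != 0 by rewrite gt_eqF.
  have dx : derivable enorm x v by have [] := D2.
  split; first exact: (derivableV ne dx).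
  by rewrite (deriveV ne dx); have [_ ->] := D2.
apply: is_derive_eq D3 _; rewrite -/(enorm x) /GRing.scale /=.
by field; rewrite gt_eqF.
Qed.

(** The derivative along [v] is [- dotv y v] times the cube of the function itself, so the order of
    smoothness can be raised by induction. *)
Lemma smooth_enormV : smooth_on punctured (fun y => (enorm y)^-1).
Proof.
have C0 : dir_C0 punctured (fun y => (enorm y)^-1).
  move=> x x0; split=> [|v]; last by have [] := is_derive_enormV v x0.
  apply: continuousV; first by rewrite gt_eqF // enorm_gt0.
  apply: continuous_comp; last exact: sqrt_continuous.
  by have [] := smooth_C0 (smooth_dotvv openT) (I : [set: V] x).
apply/smooth_onP; elim=> [|k IH]; first by split.
split=> // v.
have S : Ck punctured k (fun y => dotv y v * - 1).
  apply: (CkM open_punctured); last exact: (Ck_cst open_punctured).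
  by move/smooth_onP: (smooth_dotv v open_punctured).
have M := CkM open_punctured.
apply: (Ck_congr open_punctured) (M _ _ _ S (M _ _ _ IH (M _ _ _ IH IH))) => y y0.
have [_ ->] := is_derive_enormV v y0.
by rewrite /= mulrN1 !exprS expr0 mulr1.
Qed.

Lemma smooth_enorm : smooth_on punctured enorm.
Proof.
apply: (smooth_congr open_punctured) (smoothM open_punctured (smooth_dotvv open_punctured) smooth_enormV).
move=> y y0 /=; rewrite -enorm_sqr expr2 mulfK // gt_eqF // enorm_gt0 //.
Qed.

End Dot.

(** * Homogeneous functions, the Laplacian and great circles *)

Section Homogeneous.
Variable R : realType.
Local Notation V := 'cV[R]_4.
Local Notation U0 := (@punctured R).
Implicit Types (F : V -> R) (x y v w : V).

Local Notation oU := (@open_punctured R).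

Definition homog (m : int) F : Prop :=
  forall (t : R) y, 0 < t -> y != 0 -> F (t *: y) = t ^ m * F y.

Lemma punctured_scale (t : R) y : 0 < t -> y != 0 -> t *: y != 0.
Proof. by move=> t0 y0; rewrite scaler_eq0 negb_or gt_eqF. Qed.

Lemma smooth_diff F x : smooth_on U0 F -> x != 0 -> differentiable F x.
Proof. by move=> sF x0; exact: differentiable_colv oU sF x0. Qed.

Lemma derive_linear F x (a : R) v w : smooth_on U0 F -> x != 0 ->
  'D_(a *: v + w) F x = a * 'D_v F x + 'D_w F x.
Proof. by move=> sF x0; rewrite !deriveE ?linearP //; exact: smooth_diff. Qed.

Lemma derive_sum_dir F x n (c : 'I_n -> R) (v : 'I_n -> V) : smooth_on U0 F -> x != 0 ->
  'D_(\sum_i c i *: v i) F x = \sum_i c i * 'D_(v i) F x.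
Proof.
move=> sF x0; have dF := smooth_diff sF x0; rewrite deriveE // linear_sum.
by apply: eq_bigr => i _; rewrite linearZ deriveE.
Qed.

Lemma smooth_derivable F x v : smooth_on U0 F -> x != 0 -> derivable F x v.
Proof. by move=> sF x0; have [_] := smooth_C0 sF x0. Qed.

Lemma homog_derive m F v : smooth_on U0 F -> homog m F -> homog (m - 1) ('D_v F).
Proof.
move=> sF hF t y t0 y0; have ty0 := punctured_scale t0 y0.
have D1 : is_derive y v (fun z => F (t *: z)) (t * 'D_v F (t *: y)).
  apply/is_derive_lineP.
  have -> : (fun s : R => F (t *: (y + s *: v))) = (fun s : R => F (t *: y + s *: (t *: v))).
    by apply/funext => s; rewrite scalerDr !scalerA (mulrC t).
  apply: (is_derive_lineP F (t *: y) (t *: v) _).1; have -> : t * 'D_v F (t *: y) = 'D_(t *: v) F (t *: y).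
    by rewrite -[t *: v]addr0 derive_linear // derive0 addr0.
  exact/derivableP/smooth_derivable.
have D2 : 'D_v (fun z => F (t *: z)) y = 'D_v (fun z => t ^ m * F z) y.
  by apply: (derive_congr oU) => // z z0; exact: hF.
have [_ E] := D1; rewrite E in D2.
have D3 : 'D_v (fun z => t ^ m * F z) y = t ^ m * 'D_v F y.
  by rewrite (deriveZ (t ^ m)) //; exact: smooth_derivable.
rewrite D3 in D2; apply: (mulfI (lt0r_neq0 t0)).
rewrite D2 mulrA; congr (_ * _).
by rewrite expfzDr ?gt_eqF // exprN1 mulrCA divff ?mulr1 // gt_eqF.
Qed.

Lemma is_derive_onem_exprz (m : int) :
  is_derive (0 : R) 1 (fun s : R => (1 + s) ^ m) (m%:~R).
Proof.
have D1 : is_derive (0 : R) 1 (fun s : R => 1 + s) 1.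
  have := is_deriveD (is_derive_cst (1 : R) (0 : R) (1 : R)) (is_derive_id (0 : R) (1 : R)).
  by rewrite add0r.
have DX n : is_derive (0 : R) 1 (fun s : R => (1 + s) ^+ n) n%:R.
  have := is_deriveX n D1; rewrite exprfctE.
  by rewrite (_ : (n%:R * (1 + 0) ^+ n.-1) *: 1 = n%:R :> R) // addr0 expr1n mulr1 [LHS]mulr1.
case: m => n; first exact: DX.
have ne : (1 + 0 : R) ^+ n.+1 != 0 by rewrite addr0 expr1n oner_eq0.
have := @is_deriveV _ (fun s : R => (1 + s) ^+ n.+1) 0 _ _ ne (DX n.+1); rewrite (_ : - (1 + 0) ^+ n.+1 ^- 2 *: n.+1%:R = (Negz n)%:~R :> R) //.
by rewrite addr0 !expr1n invr1 scaleN1r NegzE mulrNz.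
Qed.

(** Differentiate [F ((1 + s) y) = (1 + s) ^ m F y] at [s = 0]. *)
Lemma Euler m F y : smooth_on U0 F -> homog m F -> y != 0 -> 'D_y F y = m%:~R * F y.
Proof.
move=> sF hF y0.
have D1 : is_derive (0 : R) 1 (fun s : R => F (y + s *: y)) ('D_y F y).
  by apply: (is_derive_lineP F y y _).1; exact/derivableP/smooth_derivable.
have D2 : is_derive (0 : R) 1 (fun s : R => (1 + s) ^ m * F y) (m%:~R * F y).
  have := is_deriveM (is_derive_onem_exprz m) (is_derive_cst (F y) (0 : R) (1 : R)).
  rewrite (_ : (1 + 0) ^ m *: 0 + F y *: m%:~R = m%:~R * F y) //.
  by rewrite scaler0 add0r [LHS]mulrC.
have [_ <-] := D1; have [_ <-] := D2; apply: near_eq_derive.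
near=> s; rewrite -{1}[y]scale1r -scalerDl; apply: hF => //.
near: s; exists 1 => //= s /=; rewrite sub0r normrN => s1.
by rewrite -ltrBlDl sub0r; move: s1; rewrite ltr_norml => /andP[].
Unshelve. all: by end_near. Qed.

Definition lap F y : R := \sum_(i < 4) 'D_(basisv R i) ('D_(basisv R i) F) y.

Lemma deriveC F x v w : smooth_on U0 F -> x != 0 ->
  'D_v ('D_w F) x = 'D_w ('D_v F) x.
Proof. exact: (@Schwarz R V U0 oU). Qed.

Lemma lap_derive F v y : smooth_on U0 F -> y != 0 -> lap ('D_v F) y = 'D_v (lap F) y.
Proof.
move=> sF y0; have -> : lap F = \sum_(i < 4) 'D_(basisv R i) ('D_(basisv R i) F).
  by apply/funext => z; rewrite fct_sumE.
rewrite derive_sum => [|i]; last first.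
  exact: smooth_derivable (smooth_derive _ (smooth_derive _ sF)) y0.
rewrite /lap; apply: eq_bigr => i _.
transitivity ('D_(basisv R i) ('D_v ('D_(basisv R i) F)) y); last first.
  exact: (deriveC _ _ (smooth_derive _ sF) y0).
by apply: (derive_congr oU) y0 => z z0; exact: (deriveC _ _ sF z0).
Qed.

Lemma hessian_bilinear F x n (c d : 'I_n -> R) (b : 'I_n -> V) : smooth_on U0 F -> x != 0 ->
  'D_(\sum_i c i *: b i) ('D_(\sum_j d j *: b j) F) x =
  \sum_i \sum_j c i * d j * 'D_(b i) ('D_(b j) F) x.
Proof.
move=> sF x0.
have E : forall y, y != 0 -> 'D_(\sum_j d j *: b j) F y = (\sum_j (d j *: 'D_(b j) F)) y.
  by move=> y y0; rewrite derive_sum_dir // fct_sumE.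
rewrite (derive_sum_dir _ _ (smooth_derive _ sF) x0).
apply: eq_bigr => i _; rewrite (derive_congr oU _ E) // derive_sum => [|j].
  rewrite mulr_sumr; apply: eq_bigr => j _; rewrite -mulrA; congr (_ * _).
  by rewrite deriveZ //; exact: smooth_derivable (smooth_derive _ sF) x0.
by apply: derivableZ; exact: smooth_derivable (smooth_derive _ sF) x0.
Qed.

(** The trace of the Hessian does not depend on the orthonormal frame: the matrix [B] of the frame
    satisfies [B B^T = 1], hence [B^T B = 1]. *)
Lemma lap_frame F x (b : 'I_4 -> V) : smooth_on U0 F -> x != 0 ->
  (forall i j, dotv (b i) (b j) = (i == j)%:R) ->
  \sum_i 'D_(b i) ('D_(b i) F) x = lap F x.
Proof.
move=> sF x0 ob; pose B : 'M[R]_4 := \matrix_(i, j) b i j 0.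
have BB : B *m B^T = 1%:M.
  apply/matrixP => i j; rewrite !mxE -ob; apply: eq_bigr => k _.
  by rewrite !mxE.
have BB' : B^T *m B = 1%:M by exact: mulmx1C.
transitivity (\sum_(i < 4) \sum_(j < 4) \sum_(k < 4)
    b i j 0 * b i k 0 * 'D_(basisv R j) ('D_(basisv R k) F) x).
  apply: eq_bigr => i _.
  rewrite -(hessian_bilinear (fun j => b i j 0) (fun k => b i k 0) (@basisv R 4) sF x0).
  by rewrite -(colE (b i)).
have E (j k : 'I_4) : \sum_(i < 4) b i j 0 * b i k 0 = (j == k)%:R.
  have := congr1 (fun M : 'M[R]_4 => M j k) BB'; rewrite !mxE => <-.
  by apply: eq_bigr => i _; rewrite !mxE.
rewrite exchange_big; apply: eq_bigr => j _.
rewrite exchange_big (bigD1 j) //= [X in _ + X]big1 ?addr0 => [|k kj].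
  by rewrite -mulr_suml E eqxx mul1r.
by rewrite -mulr_suml E eq_sym (negPf kj) mul0r.
Qed.

Definition geodesic x v (t : R) : V := cos t *: x + sin t *: v.

Lemma geodesic_unit x v t : dotv x x = 1 -> dotv v v = 1 -> dotv x v = 0 ->
  dotv (geodesic x v t) (geodesic x v t) = 1.
Proof.
move=> xx vv xv; rewrite /geodesic !(dotvDl, dotvDr, dotvZl, dotvZr) xx vv xv (dotvC v) xv.
by rewrite -[RHS](cos2Dsin2 t); ring.
Qed.

Lemma unit_neq0 x : dotv x x = 1 -> x != 0.
Proof. by rewrite -dotv_gt0 => ->. Qed.

Lemma is_derive_geodesic F x v (t : R) : smooth_on U0 F ->
  dotv x x = 1 -> dotv v v = 1 -> dotv x v = 0 ->
  is_derive t 1 (F \o geodesic x v)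
    (cos t * 'D_v F (geodesic x v t) - sin t * 'D_x F (geodesic x v t)).
Proof.
move=> sF xx vv xv; have g0 := unit_neq0 (geodesic_unit t xx vv xv).
have dF := smooth_diff sF g0.
have dcos : differentiable (@cos R) t.
  by apply/derivable1_diffP; have [] := is_derive_cos t.
have dsin : differentiable (@sin R) t.
  by apply/derivable1_diffP; have [] := is_derive_sin t.
have dc : differentiable (fun s : R => cos s *: x) t by exact: differentiableZl.
have ds : differentiable (fun s : R => sin s *: v) t by exact: differentiableZl.
have dg : differentiable (geodesic x v) t by exact: (differentiableD dc ds).
have e1 : 'd (fun s : R => cos s *: x) t 1 = - sin t *: x.
  rewrite (diffZl x dcos) -(deriveE (1 : R) dcos).
  by have [_ ->] := is_derive_cos t.
have e2 : 'd (fun s : R => sin s *: v) t 1 = cos t *: v.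
  rewrite (diffZl v dsin) -(deriveE (1 : R) dsin).
  by have [_ ->] := is_derive_sin t.
have eg : 'd (geodesic x v) t 1 = - sin t *: x + cos t *: v.
  have -> : geodesic x v = (fun s : R => cos s *: x) + (fun s : R => sin s *: v).
    by [].
  have E := congr1 (fun h : R -> V => h 1) (diffD dc ds).
  by apply: (etrans E); exact: (f_equal2 +%R e1 e2).
have dFg : differentiable (F \o geodesic x v) t by exact: (differentiable_comp dg dF).
split; first exact: diff_derivable.
rewrite (deriveE (1 : R) dFg) (diff_comp dg dF) /= eg linearD !linearZ /=.
rewrite -(deriveE x dF) -(deriveE v dF).
by rewrite [LHS]addrC; congr (_ + _); rewrite scaleNr scalerN.
Qed.

Lemma geodesic0 x v : geodesic x v 0 = x.
Proof. by rewrite /geodesic cos0 sin0 scale1r scale0r addr0. Qed.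

(** A great circle has acceleration [- x] at its starting point [x], whence the first order term. *)
Lemma geodesic_derive2 F x v : smooth_on U0 F ->
  dotv x x = 1 -> dotv v v = 1 -> dotv x v = 0 ->
  derive1n 2 (F \o geodesic x v) 0 = 'D_v ('D_v F) x - 'D_x F x.
Proof.
move=> sF xx vv xv; rewrite /derive1n /=.
have -> : derive1 (F \o geodesic x v) = fun t : R =>
    cos t * ('D_v F \o geodesic x v) t - sin t * ('D_x F \o geodesic x v) t.
  apply/funext => t; rewrite derive1E.
  by have [_ ->] := is_derive_geodesic t sF xx vv xv.
rewrite derive1E.
have D1 := is_derive_geodesic 0 (smooth_derive v sF) xx vv xv.
have D2 := is_derive_geodesic 0 (smooth_derive x sF) xx vv xv.
have := is_deriveB (is_deriveM (is_derive_cos 0) D1) (is_deriveM (is_derive_sin 0) D2).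
move=> [_]; rewrite /= => E; rewrite [LHS]E !geodesic0 cos0 sin0 !scale1r !scale0r.
by rewrite mul1r mul0r subr0 oppr0 scaler0 addr0 add0r; congr (_ - _); exact: mulr1.
Qed.

End Homogeneous.

(** * The maximum principle *)

Section MaximumPrinciple.
Variable R : realType.
Local Notation V := 'cV[R]_4.
Local Notation U0 := (@punctured R).
Implicit Types (F D : V -> R) (x y v w : V).

(** If the second derivative were positive, the first one, which is 0 at a maximum, would be
    positive just to the right of 0, and [phi] would increase there. *)
Lemma second_derivative_max (phi : R -> R) : (forall t, derivable phi t 1) ->
  derivable (derive1 phi) 0 1 -> (forall t, phi t <= phi 0) -> derive1n 2 phi 0 <= 0.
Proof.
move=> dphi dd mx; rewrite leNgt; apply/negP => pos.
have d0 : derive1 phi 0 = 0.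
  rewrite derive1E; have N11 : (- 1 : R) <= 1 by lra.
  have i0 : (0 : R) \in `]-1, 1[ by rewrite in_itv /= ltrN10 ltr01.
  by have [_] := derive1_at_max N11 (fun t _ => dphi t) i0 (fun t _ => mx t).
have E : derive1n 2 phi 0 = 'D_1 (derive1 phi) 0 by rewrite /derive1n /= derive1E.
rewrite E in pos; have := dd; rewrite /derivable => /cvg_ex[l hl].
have el : 'D_1 (derive1 phi) 0 = l by apply: cvg_lim hl.
rewrite el in pos.
move/cvgrPdist_lt: hl => /(_ l pos) [e /= e0 he].
have small h : 0 < h -> h < e -> 0 < derive1 phi h.
  move=> h0 hes; have := he h; rewrite /= sub0r normrN (gtr0_norm h0).
  move=> /(_ hes (lt0r_neq0 h0)); rewrite addr0 d0 subr0 [h%:A]mulr1.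
  move: (derive1 phi h) => a; rewrite ltr_norml => /andP[_]; rewrite ltrBlDr ltrDl.
  by rewrite pmulr_rgt0 ?invr_gt0.
have h0 : 0 < e / 2 by rewrite divr_gt0.
have dphi' (z : R) : z \in `]0, (e / 2)[ -> is_derive z 1 phi (derive1 phi z).
  by move=> _; rewrite derive1E; exact: derivableP.
have cphi : {within `[0, e / 2], continuous phi}.
  by apply: derivable_within_continuous => z _; exact: dphi.
have [c] := MVT h0 dphi' cphi.
move: (mx (e / 2)); rewrite in_itv /= => m /andP[c0 ce].
have he2 : e / 2 < e by rewrite (ltr_pdivrMr _ _ (ltr0Sn _ 1)) (ltr_pMr _ e0) (ltr_nat R 1 2).
have dc := small c c0 (lt_trans ce he2).
move=> Ec; have : 0 < derive1 phi c * (e / 2 - 0) by rewrite subr0 mulr_gt0.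
by rewrite -Ec subr_gt0 ltNge m.
Qed.

Lemma trmx_continuous m n : continuous (@trmx R m n).
Proof.
move=> M s /nbhs_ballP[e e0 es]; apply/nbhs_ballP; exists e => //= N [_ MN].
by apply: es; split=> // i j; rewrite !mxE; exact: MN.
Qed.

Lemma sphere_max D : smooth_on U0 D ->
  exists2 x, dotv x x = 1 & forall y, dotv y y = 1 -> D y <= D x.
Proof.
(* The sphere is transposed, as the compactness argument is carried out on row vectors. *)
move=> sD; pose A : set 'rV[R]_4 := [set u | dotv u^T u^T = 1].
have ct : continuous (fun u : 'rV[R]_4 => u^T) by exact: trmx_continuous.
have cA : closed A.
  apply: (@closed_comp _ _ (fun u : 'rV[R]_4 => dotv u^T u^T) [set 1]).
    move=> u _; apply: (@continuous_comp _ _ _ (fun u : 'rV[R]_4 => u^T) (fun y : V => dotv y y)); first exact: ct.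
    by have [] := smooth_C0 (smooth_dotvv openT) (I : [set: V] u^T).
  exact: closed_eq.
have bA : bounded_set A.
  exists 1; split; first exact: num_real.
  move=> M M1 u Au; apply: le_trans (ltW M1).
  rewrite [leLHS]/Num.norm /= mx_normrE; apply/bigmax_leP; split=> // -[i j] _ /=.
  have sq : (u i j) ^+ 2 <= 1.
    rewrite -Au /dotv (bigD1 j) //= (ord1 i) !mxE -expr2 lerDl sumr_ge0 // => k _.
    by rewrite -expr2 sqr_ge0.
  by rewrite -ler_sqr ?nnegrE // expr1n real_normK ?num_real.
have A0 : A !=set0.
  by exists (val (base_point R))^T; rewrite /A /= trmxK; exact/eqP/(valP (base_point R)).
have [||u uA mx] := @EVT_max_rV R 4 (fun u : 'rV[R]_4 => D u^T) A A0.
- exact: bounded_closed_compact.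
- apply: continuous_in_subspaceT => u /set_mem uA.
  apply: (@continuous_comp _ _ _ (fun u : 'rV[R]_4 => u^T) D); first exact: ct.
  by have [] := smooth_C0 sD (unit_neq0 uA).
exists u^T; first by move/set_mem: uA.
by move=> y yy; have := mx y^T; rewrite trmxK; apply; rewrite inE /A /= trmxK.
Qed.

(** The quaternion products [i x], [j x], [k x], which frame the tangent spaces of the sphere by one
    formula. *)
Definition quat_frame x (k : 'I_3) : V :=
  \col_(i < 4) nth 0 (nth [::]
    [:: [:: - x 1 0; x 0 0; - x 3%:R 0; x 2%:R 0];
        [:: - x 2%:R 0; x 3%:R 0; x 0 0; - x 1 0];
        [:: - x 3%:R 0; - x 2%:R 0; x 1 0; x 0 0]] k) i.

Lemma quat_frameE x :
  (forall i, dotv x (quat_frame x i) = 0) /\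
  (forall i j, dotv (quat_frame x i) (quat_frame x j) = (i == j)%:R * dotv x x).
Proof.
rewrite /dotv.
have E1 : lift ord0 ord0 = 1 :> 'I_4 by exact/val_inj.
have E2 : lift ord0 (lift ord0 ord0) = 2%:R :> 'I_4 by exact/val_inj.
have E3 : lift ord0 (lift ord0 (lift ord0 ord0)) = 3%:R :> 'I_4 by exact/val_inj.
split=> [i|i j]; rewrite !big_ord_recl !big_ord0 !mxE; case: i => [[|[|[|//]]] Hi] /=;
  try (case: j => [[|[|[|//]]] Hj] /=); rewrite ?E3 ?E2 ?E1 ?eqE /=; ring.
Qed.

Lemma quat_frameP x : dotv x x = 1 ->
  (forall i, dotv x (quat_frame x i) = 0) /\
  (forall i j, dotv (quat_frame x i) (quat_frame x j) = (i == j)%:R).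
Proof.
move=> xx; have [xe ee] := quat_frameE x.
by split=> // i j; rewrite ee xx mulr1.
Qed.

(** The radial vector [x] completes the tangent frame, and the tangential second derivatives are
    read off the great circles. *)
Lemma lap_geodesic F x (e : 'I_3 -> V) : smooth_on U0 F -> dotv x x = 1 ->
  (forall i, dotv x (e i) = 0) -> (forall i j, dotv (e i) (e j) = (i == j)%:R) ->
  lap F x = 'D_x ('D_x F) x +
    \sum_i (derive1n 2 (F \o geodesic x (e i)) 0 + 'D_x F x).
Proof.
move=> sF xx xe ee; pose b (i : 'I_4) := oapp e x (unlift ord0 i).
have x0 := unit_neq0 xx; have ob i j : dotv (b i) (b j) = (i == j)%:R.
  rewrite /b; case: (unliftP ord0 i) => [i' ->|->]; case: (unliftP ord0 j) => [j' ->|->] /=.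
  - by rewrite ee (inj_eq (@lift_inj _ _)).
  - by rewrite dotvC xe.
  - by rewrite xe.
  - by rewrite xx.
have b0 : b ord0 = x by rewrite /b unlift_none.
have bS i : b (lift ord0 i) = e i by rewrite /b liftK.
rewrite -(lap_frame sF x0 ob) big_ord_recl b0; congr (_ + _).
by apply: eq_bigr => i _; rewrite bS geodesic_derive2 ?subrK // ee eqxx.
Qed.

(* At a maximum x on the unit sphere the three geodesic second derivatives are
   nonpositive. The Laplacian is their sum plus D_x D_x D + 3 D_x D, which
   equals 2 D - 3 D by homogeneity, so D x is that sum. *)
Lemma harmonic_le0 D : smooth_on U0 D -> homog (- 1) D -> (forall y, y != 0 -> lap D y = 0) ->
  forall y, y != 0 -> D y <= 0.
Proof.
move=> sD hD lD; have [x xx mx] := sphere_max sD.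
have x0 := unit_neq0 xx; have [xe ee] := quat_frameP xx.
have E1 : 'D_x D x = - D x by rewrite (Euler sD hD x0) mulN1r.
have E2 : 'D_x ('D_x D) x = 2 * D x.
  rewrite (Euler (smooth_derive x sD) (homog_derive x sD hD) x0) E1.
  have -> : (- 1 - 1)%:~R = - 2 :> R by rewrite -[(- 1 - 1 : int)]/(- 2%:Z) mulrNz.
  by rewrite mulrNN.
have le i : derive1n 2 (D \o geodesic x (quat_frame x i)) 0 <= 0.
  have uni : dotv (quat_frame x i) (quat_frame x i) = 1 by rewrite ee eqxx.
  apply: second_derivative_max.
  - by move=> t; have [] := is_derive_geodesic t sD xx uni (xe i).
  - have -> : derive1 (D \o geodesic x (quat_frame x i)) = fun t : R =>
        cos t * ('D_(quat_frame x i) D \o geodesic x (quat_frame x i)) t -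
        sin t * ('D_x D \o geodesic x (quat_frame x i)) t.
      apply/funext => t; rewrite derive1E.
      by have [_ ->] := is_derive_geodesic t sD xx uni (xe i).
    apply: derivableB; apply: derivableM.
    + by have [] := is_derive_cos (0 : R).
    + by have [] := is_derive_geodesic 0 (smooth_derive (quat_frame x i) sD) xx uni (xe i).
    + by have [] := is_derive_sin (0 : R).
    + by have [] := is_derive_geodesic 0 (smooth_derive x sD) xx uni (xe i).
  - by move=> t; rewrite /= geodesic0; apply: mx; exact: geodesic_unit.
have Dx : D x <= 0.
  have := lap_geodesic sD xx xe ee; rewrite lD // E2 !big_ord_recl big_ord0 E1.
  have := le ord0; have := le (lift ord0 ord0); have := le (lift ord0 (lift ord0 ord0)).
  move: (D x) (derive1n _ _ _) (derive1n _ _ _) (derive1n _ _ _) => a b c d; lra.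
move=> y y0; have ny : 0 < enorm y by rewrite enorm_gt0.
have -> : y = enorm y *: ((enorm y)^-1 *: y) by rewrite scalerA divff ?scale1r // gt_eqF.
rewrite hD ?scaler_eq0 ?negb_or ?invr_eq0 ?gt_eqF //.
rewrite pmulr_rle0 ?exprz_gt0 //; apply: le_trans Dx; apply: mx.
rewrite dotvZl dotvZr -enorm_sqr; field; by rewrite gt_eqF.
Qed.

Lemma lapN D y : smooth_on U0 D -> y != 0 -> lap (fun z => - D z) y = - lap D y.
Proof.
move=> sD y0; rewrite /lap -sumrN; apply: eq_bigr => i _.
rewrite -(deriveN (smooth_derivable (smooth_derive _ sD) y0)).
apply: (derive_congr (@open_punctured R)) y0 => z z0.
exact: (deriveN (smooth_derivable sD z0)).
Qed.

Lemma harmonic_neg1_eq0 D : smooth_on U0 D -> homog (- 1) D ->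
  (forall y, y != 0 -> lap D y = 0) -> forall y, y != 0 -> D y = 0.
Proof.
move=> sD hD lD y y0; apply/eqP; rewrite eq_le; apply/andP; split.
  exact: (harmonic_le0 sD hD lD).
rewrite -oppr_le0.
apply: (@harmonic_le0 (fun z => - D z)) y0.
- apply: (smooth_congr (@open_punctured R)) (smoothM (@open_punctured R) sD (smooth_cst (@open_punctured R) (- 1))) => z _ /=.
  by rewrite mulrN1.
- by move=> t z t0 z0; rewrite hD // mulrN.
- by move=> z z0; rewrite lapN // lD // oppr0.
Qed.

End MaximumPrinciple.

(** * Eigenfunctions on the sphere are harmonic polynomials *)

Section HomogeneousPolynomials.
Variable R : realType.
Local Notation V := 'cV[R]_4.
Local Notation U0 := (@punctured R).
Local Notation oU := (@open_punctured R).
Implicit Types (F f g : V -> R) (x y v w : V).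

(** Homogeneous polynomials as functions, without a choice of monomials. The recursion has the shape
    of the Euler relation [k F = sum y_i D_i F], by which such functions are recognized. *)
Fixpoint hpoly (k : nat) f : Prop :=
  if k is k'.+1 then
    exists g : 'I_4 -> V -> R, (forall i, hpoly k' (g i)) /\
      forall y, f y = \sum_i y i 0 * g i y
  else exists c : R, forall y, f y = c.

Lemma hpoly_ext k f g : (forall y, f y = g y) -> hpoly k f -> hpoly k g.
Proof. by move=> /funext ->. Qed.

Lemma hpolyD k f g : hpoly k f -> hpoly k g -> hpoly k (fun y => f y + g y).
Proof.
elim: k f g => [|k IH] f g /=.
  by move=> [a fa] [b gb]; exists (a + b) => y; rewrite fa gb.
move=> [a [fa ea]] [b [fb eb]]; exists (fun i y => a i y + b i y); split=> [i|y].
  exact: IH.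
by rewrite ea eb -big_split; apply: eq_bigr => i _; rewrite mulrDr.
Qed.

Lemma hpolyZ k (c : R) f : hpoly k f -> hpoly k (fun y => c * f y).
Proof.
elim: k f => [|k IH] f /=; first by move=> [a fa]; exists (c * a) => y; rewrite fa.
move=> [a [fa ea]]; exists (fun i y => c * a i y); split=> [i|y]; first exact: IH.
by rewrite ea mulr_sumr; apply: eq_bigr => i _; rewrite mulrCA.
Qed.

Lemma hpoly0 k : hpoly k (fun=> 0).
Proof.
elim: k => [|k IH] /=; first by exists 0.
by exists (fun _ _ => 0); split=> // y; rewrite big1 // => i _; rewrite mulr0.
Qed.

Lemma hpoly_coordM k i f : hpoly k f -> hpoly k.+1 (fun y => y i 0 * f y).
Proof.
move=> pf; exists (fun j y => if j == i then f y else 0); split=> [j|y].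
  by case: (j == i); [exact: hpoly_ext pf|exact: hpoly0].
rewrite (bigD1 i) //= eqxx big1 ?addr0 // => j /negPf ->; exact: mulr0.
Qed.

Lemma hpoly_sum k n (f : 'I_n -> V -> R) : (forall i, hpoly k (f i)) ->
  hpoly k (fun y => \sum_i f i y).
Proof.
elim: n f => [|n IH] f pf.
  by apply: hpoly_ext (hpoly0 k) => y; rewrite big_ord0.
apply: hpoly_ext (hpolyD (pf ord0) (IH _ (fun i => pf (lift ord0 i)))) => y.
by rewrite big_ord_recl.
Qed.

Lemma hpoly_scale k f (t : R) y : hpoly k f -> f (t *: y) = t ^+ k * f y.
Proof.
elim: k f => [|k IH] f /=; first by move=> [c fc]; rewrite !fc mul1r.
move=> [g [pg eg]]; rewrite !eg mulr_sumr; apply: eq_bigr => i _.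
by rewrite mxE (IH _ (pg i)) exprS; ring.
Qed.

Lemma hpoly_smooth k f (U : set V) : open U -> hpoly k f -> smooth_on U f.
Proof.
move=> oW; elim: k f => [|k IH] f /=.
  by move=> [c fc]; apply: (smooth_congr oW) (smooth_cst oW c) => y _; rewrite fc.
move=> [g [pg eg]].
have S : smooth_on U (fun y => \sum_i y i 0 * g i y).
  by apply: (smooth_sum oW) => i; apply: (smoothM oW (smooth_coord i oW) (IH _ (pg i))).
by apply: (smooth_congr oW) S => y _; rewrite eg.
Qed.

Lemma hpoly_derivable k f y v : hpoly k f -> derivable f y v.
Proof.
by move=> pf; have [_] := smooth_C0 (hpoly_smooth openT pf) (I : [set: V] y).
Qed.

Lemma hpoly0_derive f v y : hpoly 0 f -> 'D_v f y = 0.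
Proof. by move=> [c /funext ->]; exact: derive_cst. Qed.

Lemma derive_sum_coordM (g : 'I_4 -> V -> R) y v : (forall i, derivable (g i) y v) ->
  'D_v (fun z : V => \sum_i z i 0 * g i z) y = \sum_i (y i 0 * 'D_v (g i) y + g i y * v i 0).
Proof.
move=> dg; have dc i : derivable (fun h : V => h i 0) y v.
  exact/diff_derivable/differentiable_coord.
have -> : (fun z : V => \sum_i z i 0 * g i z) = \sum_i ((fun h : V => h i 0) * g i).
  by apply/funext => z; rewrite fct_sumE.
rewrite derive_sum => [|i]; last exact: derivableM (dc i) (dg i).
by apply: eq_bigr => i _; rewrite (deriveM (dc i) (dg i)) derive_coord.
Qed.

Lemma hpoly_derive k f v : hpoly k.+1 f -> hpoly k ('D_v f).
Proof.
have E k' (g : 'I_4 -> V -> R) : (forall i, hpoly k' (g i)) ->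
    'D_v (fun z : V => \sum_i z i 0 * g i z) =
    fun y => \sum_i (y i 0 * 'D_v (g i) y + g i y * v i 0).
  move=> pg; apply/funext => y; apply: derive_sum_coordM => i.
  exact: (hpoly_derivable (pg i)).
elim: k f => [|k IH] f [g [pg /funext eg]]; rewrite eg.
  rewrite (E 0%N _ pg); have c i : exists c : R, forall y, g i y = c by exact: pg.
  (* The constant values of the [g i] are only known to exist, so [xget] selects them. *)
  exists (\sum_i xget 0 [set c | forall y, g i y = c] * v i 0) => y.
  apply: eq_bigr => i _; rewrite (@hpoly0_derive (g i)) // mulr0 add0r.
  by have /= -> := @xgetPex _ 0 _ (c i).
rewrite (E k.+1 _ pg); have H : hpoly k.+1 (fun y => \sum_i (y i 0 * 'D_v (g i) y + v i 0 * g i y)).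
  apply: hpoly_sum => i; apply: hpolyD; first exact/hpoly_coordM/IH/pg.
  exact: (@hpolyZ k.+1 (v i 0) (g i) (pg i)).
apply: hpoly_ext H => y; apply: eq_bigr => i _.
by rewrite [g i y * _]mulrC.
Qed.

Lemma hpoly_lap k f : hpoly k.+2 f -> hpoly k (lap f).
Proof. by move=> pf; apply: hpoly_sum => i; do 2!apply: hpoly_derive. Qed.

Lemma lap_hpoly_low k f y : (k < 2)%N -> hpoly k f -> lap f y = 0.
Proof.
case: k => [|[|//]] _ pf; rewrite /lap big1 // => i _.
  rewrite (_ : 'D__ f = cst 0) ?derive_cst //.
  by apply/funext => z; rewrite (hpoly0_derive _ _ pf).
exact/hpoly0_derive/hpoly_derive.
Qed.

(** A segment between nonzero vectors with nonnegative inner product avoids 0. Otherwise the path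
    goes through [z] or [- z], with [z] orthogonal to [x]; one of the two has nonnegative product
    with [y]. *)
Lemma locally_cst F : smooth_on U0 F -> (forall v y, y != 0 -> 'D_v F y = 0) ->
  forall x y, x != 0 -> y != 0 -> F x = F y.
Proof.
move=> sF dF.
have seg x y : x != 0 -> y != 0 -> 0 <= dotv x y -> F x = F y.
  move=> x0 y0 xy; pose p := 2^-1 *: (x + y); pose v := 2^-1 *: (y - x).
  have ne (t : R) : `|t| <= 1 -> p + t *: v != 0.
    move=> t1; have -> : p + t *: v = ((1 - t) / 2) *: x + ((1 + t) / 2) *: y.
      by apply/colP => i; rewrite !mxE; field.
    suff : 0 < dotv (((1 - t) / 2) *: x + ((1 + t) / 2) *: y) (((1 - t) / 2) *: x + ((1 + t) / 2) *: y).
      by rewrite dotv_gt0.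
    rewrite !(dotvDl, dotvDr, dotvZl, dotvZr) (dotvC y x).
    have := t1; rewrite ler_norml => /andP[ta tb].
    have a0 : 0 <= (1 - t) / 2 by lra.
    have b0 : 0 <= (1 + t) / 2 by lra.
    have ab : (1 - t) / 2 + (1 + t) / 2 = 1 by field.
    move: (_ / 2) (_ / 2) a0 b0 ab => b a a0 b0 ab.
    rewrite -dotv_gt0 in x0; rewrite -dotv_gt0 in y0.
    have : 0 < a * (a * dotv x x) + b * (b * dotv y y).
      have [z|na] := eqVneq a 0.
        have b1 : b = 1 by lra.
        by rewrite b1 z !mul0r add0r !mul1r.
      have pa : 0 < a by rewrite lt_def na.
      by rewrite ltr_pwDl // ?mulr_gt0 // !mulr_ge0 // ltW.
    have : 0 <= a * (b * dotv x y) by rewrite !mulr_ge0.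
    by lra.
  have E (c : R) : `|c| = 1 -> F (p + c *: v) = F p.
    move=> c1; have [t|t t1 e] := @derive_line_mvt R V F p v c.
      by rewrite c1 => t1; exact: smooth_derivable sF (ne t t1).
    rewrite c1 in t1; apply/eqP; rewrite -subr_eq0 e dF ?mulr0 //; exact: ne.
  have e1 : p + 1 *: v = y by apply/colP => i; rewrite !mxE; field.
  have e2 : p + (-1) *: v = x by apply/colP => i; rewrite !mxE; field.
  by rewrite -e1 -{1}e2 !E ?normrN ?normr1.
move=> x y x0 y0.
have [xz zz] : dotv x (quat_frame x 0) = 0 /\ quat_frame x 0 != 0.
  have [xe ee] := quat_frameE x; split; first exact: xe.
  by rewrite -dotv_gt0 ee eqxx mul1r dotv_gt0.
pose z := quat_frame x 0.
have [zy|zy] := leP 0 (dotv z y).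
  by rewrite (seg x z) ?xz // (seg z y).
have nz : - z != 0 by rewrite oppr_eq0.
have s1 : F x = F (- z).
  by apply: (seg _ _ x0 nz); rewrite -scaleN1r dotvZr xz mulr0.
have s2 : F (- z) = F y.
  by apply: (seg _ _ nz y0); rewrite -scaleN1r dotvZl mulN1r oppr_ge0; exact: ltW.
by rewrite s1 s2.
Qed.

(* A derivative of order k + 1 is harmonic and homogeneous of degree -1. *)
Lemma harmonic_derivatives_vanish (k : nat) F : smooth_on U0 F -> homog k F ->
  (forall y, y != 0 -> lap F y = 0) ->
  forall vs : seq V, size vs = k.+1 -> forall y, y != 0 -> iter_derive vs F y = 0.
Proof.
move=> sF hF lF vs svs.
have [sI [hI lI]] : smooth_on U0 (iter_derive vs F) /\
   homog (k%:Z - (size vs)%:Z) (iter_derive vs F) /\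
   forall y, y != 0 -> lap (iter_derive vs F) y = 0.
  elim: vs {svs} => [|v vs [sI [hI lI]]]; first by rewrite subr0.
  split; first exact: smooth_derive.
  split.
    rewrite (_ : k%:Z - (size (v :: vs))%:Z = (k%:Z - (size vs)%:Z) - 1); last by rewrite /=; lia.
    exact: homog_derive.
  move=> y y0; rewrite /= lap_derive //.
  rewrite (@derive_congr _ _ U0 oU (lap (iter_derive vs F)) (cst 0)) ?derive_cst //.
apply: harmonic_neg1_eq0 => //.
by rewrite svs (_ : k%:Z - k.+1%:Z = -1) in hI; last lia.
Qed.

(** By induction the partial derivatives are polynomials, and the Euler relation recovers [F] from
    them. In degree 0 the first derivatives vanish and [F] is constant. *)
Lemma homog_hpoly (k : nat) F : smooth_on U0 F -> homog k F ->
  (forall vs : seq V, size vs = k.+1 -> forall y, y != 0 -> iter_derive vs F y = 0) ->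
  exists2 f, hpoly k f & forall y, y != 0 -> F y = f y.
Proof.
elim: k F => [|k IH] F sF hF dF.
  have b0 : delta_mx 0 0 != 0 :> V.
    by rewrite -dotv_eq0 (eqP (base_point_subproof R)) oner_eq0.
  exists (fun=> F (delta_mx 0 0)); first by exists (F (delta_mx 0 0)).
  by move=> y y0; apply: locally_cst => // v z z0; exact: (dF [:: v]).
have H (i : 'I_4) : exists2 f, hpoly k f & forall y, y != 0 -> 'D_(basisv R i) F y = f y.
  apply: IH; first exact: smooth_derive.
    by have := homog_derive (basisv R i) sF hF; rewrite (_ : k.+1%:Z - 1 = k) //; lia.
  move=> vs svs y y0; have := dF (rcons vs (basisv R i)).
  by rewrite size_rcons svs /iter_derive foldr_rcons => /(_ erefl _ y0).
have [g gP] := choice (fun i => let: ex_intro2 f pf ef := H i in ex_intro (fun f => hpoly k f /\ forall y, y != 0 -> 'D_(basisv R i) F y = f y) f (conj pf ef)).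
exists (fun y => (k.+1%:R)^-1 * \sum_i y i 0 * g i y).
  by apply: (@hpolyZ k.+1); exists g; split=> // i; have [] := gP i.
move=> y y0; have := derive_sum_dir (fun i => y i 0) (@basisv R 4) sF y0.
rewrite -(colE y) (Euler sF hF y0) => E.
rewrite -[LHS](mulKf (_ : k.+1%:R != 0 :> R)) ?pnatr_eq0 //; congr (_ * _).
rewrite [LHS]E; apply: eq_bigr => i _; congr (_ * _).
by have [_] := gP i; apply.
Qed.

End HomogeneousPolynomials.

(** * Functions on the sphere and their homogeneous extensions *)

Section SphereFunctions.
Variable R : realType.
Local Notation V := 'cV[R]_4.
Local Notation U0 := (@punctured R).
Local Notation oU := (@open_punctured R).
Local Notation S3 := (sphere3 R).
Implicit Types (f h : S3 -> R) (x : S3) (y v : V).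

Lemma valS x : dotv (val x) (val x) = 1. Proof. exact/eqP/(valP x). Qed.

Lemma valS_neq0 x : val x != 0. Proof. exact/unit_neq0/valS. Qed.

Definition radial y : S3 := insubd (base_point R) ((enorm y)^-1 *: y).

Lemma val_radial y : y != 0 -> val (radial y) = (enorm y)^-1 *: y.
Proof.
move=> y0; apply: insubdK; rewrite unfold_in /=; apply/eqP.
have e0 : enorm y != 0 by rewrite gt_eqF // enorm_gt0.
by rewrite dotvZl dotvZr -enorm_sqr; field.
Qed.

Lemma hextE f y : hext f y = f (radial y). Proof. by []. Qed.

Lemma enorm1 y : dotv y y = 1 -> enorm y = 1.
Proof. by rewrite /enorm => ->; exact: sqrtr1. Qed.

Lemma radial_val x : radial (val x) = x.
Proof. by apply/val_inj; rewrite val_radial ?valS_neq0 // enorm1 ?valS // invr1 scale1r. Qed.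

Lemma hext_val f x : hext f (val x) = f x. Proof. by rewrite hextE radial_val. Qed.

Lemma hext_homog f : homog 0 (hext f).
Proof.
move=> t y t0 y0; rewrite mul1r !hextE; congr (f _); apply/val_inj.
rewrite !val_radial ?scaler_eq0 ?negb_or ?gt_eqF // enormZ ?ltW // scalerA.
by rewrite invfM -mulrA mulrCA mulVf ?mulr1 // gt_eqF.
Qed.

Lemma sphereP y : dotv y y = 1 -> exists x, val x = y.
Proof. by move=> /eqP yy; exists (exist _ y yy). Qed.

Lemma frame_of x : tangent_frame x (quat_frame (val x)).
Proof. by have [] := quat_frameP (valS x). Qed.

(** The extension has degree 0, so its radial derivatives vanish on the sphere and the great circles
    account for the whole Euclidean Laplacian. *)
Lemma sphere_laplacianP f h : sphere_smooth f ->
  is_sphere_laplacian f h <-> forall x, h x = - lap (hext f) (val x).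
Proof.
move=> sf; have H x (e : 'I_3 -> V) : tangent_frame x e ->
    \sum_(i < 3) derive1n 2 (along_geodesic f x (e i)) 0 = lap (hext f) (val x).
  move=> [xe ee]; rewrite (lap_geodesic sf (valS x) xe ee).
  rewrite (Euler (smooth_derive _ sf) (homog_derive _ sf (@hext_homog f)) (valS_neq0 x)).
  rewrite (Euler sf (@hext_homog f) (valS_neq0 x)) !mul0r mulr0 add0r.
  by apply: eq_bigr => i _; rewrite addr0.
split=> [L x|E x e fr]; last by rewrite E (H x e fr).
by rewrite (L x _ (frame_of x)) (H x _ (frame_of x)).
Qed.

Lemma lapD F G y : smooth_on U0 F -> smooth_on U0 G -> y != 0 ->
  lap (fun z => F z + G z) y = lap F y + lap G y.
Proof.
move=> sF sG y0; rewrite /lap -big_split; apply: eq_bigr => i _ /=.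
rewrite -(deriveD (smooth_derivable (smooth_derive _ sF) y0) (smooth_derivable (smooth_derive _ sG) y0)).
by apply: (derive_congr oU) y0 => z z0; exact: (deriveD (smooth_derivable sF z0) (smooth_derivable sG z0)).
Qed.

Lemma lapZ (c : R) F y : smooth_on U0 F -> y != 0 ->
  lap (fun z => c * F z) y = c * lap F y.
Proof.
move=> sF y0; rewrite /lap mulr_sumr; apply: eq_bigr => i _ /=.
rewrite -[RHS](deriveZ c (smooth_derivable (smooth_derive _ sF) y0)).
by apply: (derive_congr oU) y0 => z z0; exact: (deriveZ c (smooth_derivable sF z0)).
Qed.

Lemma sphere_smoothD f h : sphere_smooth f -> sphere_smooth h ->
  sphere_smooth (fun x => f x + h x).
Proof. exact: (smoothD oU). Qed.

Lemma sphere_smoothZ (c : R) f : sphere_smooth f -> sphere_smooth (fun x => c * f x).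
Proof. exact: (smoothM oU (smooth_cst oU c)). Qed.

Definition eigval (k : nat) : R := k%:R * (k%:R + 2).

Lemma eigval_inj : injective eigval.
Proof.
move=> k l; rewrite /eigval => E; apply/eqP; rewrite -(eqr_nat R).
have : (k%:R - l%:R) * (k%:R + l%:R + 2) = 0 :> R.
  by rewrite -(subrr (l%:R * (l%:R + 2) : R)) -{1}E; ring.
by move=> /eqP; rewrite mulf_eq0 subr_eq0 => /orP[//|]; rewrite -!natrD pnatr_eq0 addnS.
Qed.

Definition hpart k f y : R := enorm y ^+ k * hext f y.

Lemma hpart_smooth k f : sphere_smooth f -> smooth_on U0 (hpart k f).
Proof. by move=> sf; apply: (smoothM oU) sf; exact: (smoothX oU k (@smooth_enorm R)). Qed.

Lemma hpart_homog (k : nat) f : homog k (hpart k f).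
Proof.
move=> t y t0 y0; rewrite /hpart enormZ ?ltW // hext_homog // mul1r exprMn.
by rewrite -mulrA.
Qed.

(** The extensions of degree 0 and [k] agree along great circles; the radial terms of the latter
    contribute [k (k - 1) + 3 k = k (k + 2)]. *)
Lemma lap_hpart (k : nat) f x : sphere_smooth f ->
  lap (hpart k f) (val x) = eigval k * f x + lap (hext f) (val x).
Proof.
move=> sf; have sF := hpart_smooth k sf; have hF := @hpart_homog k f.
have [xe ee] := quat_frameP (valS x); have x0 := valS_neq0 x.
have Fx : hpart k f (val x) = f x by rewrite /hpart hext_val enorm1 ?valS // expr1n mul1r.
rewrite (lap_geodesic sF (valS x) xe ee) (lap_geodesic sf (valS x) xe ee).
rewrite !(Euler (smooth_derive _ sF) (homog_derive _ sF hF) x0) !(Euler sF hF x0).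
rewrite (Euler (smooth_derive _ sf) (homog_derive _ sf (@hext_homog f)) x0).
rewrite (Euler sf (@hext_homog f) x0) Fx mul0r mulr0 add0r.
have E i : derive1n 2 (hpart k f \o geodesic (val x) (quat_frame (val x) i)) 0 =
   derive1n 2 (hext f \o geodesic (val x) (quat_frame (val x) i)) 0.
  congr (derive1n 2 _ 0); apply/funext => t /=.
  rewrite /hpart enorm1 ?expr1n ?mul1r //; apply: geodesic_unit; rewrite ?valS //.
  by rewrite ee eqxx.
under eq_bigr do rewrite E.
rewrite !big_split /= !sumr_const !card_ord /eigval.
by rewrite intrD /= mulrN1z; move: (\sum_i _) => a; ring.
Qed.

Lemma eigenfunction_hpoly (k : nat) f : sphere_smooth f ->
  is_sphere_laplacian f (fun x => eigval k * f x) ->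
  exists2 p, hpoly k p & forall x, f x = p (val x).
Proof.
move=> sf /(sphere_laplacianP _ sf) L; have sF := hpart_smooth k sf.
have hF := @hpart_homog k f.
have L0 y : y != 0 -> lap (hpart k f) y = 0.
  move=> y0; have ey : 0 < enorm y by rewrite enorm_gt0.
  (* Vanishing on the sphere spreads to all [y != 0], since [lap] of the extension is homogeneous of
     degree [k - 2]. *)
  have hl : homog (k%:Z - 1 - 1) (lap (hpart k f)).
    move=> t z t0 z0; rewrite /lap mulr_sumr; apply: eq_bigr => i _.
    exact: (homog_derive _ (smooth_derive _ sF) (homog_derive _ sF hF)).
  have -> : y = enorm y *: val (radial y).
    by rewrite val_radial // scalerA divff ?scale1r // gt_eqF.
  by rewrite hl ?valS_neq0 // lap_hpart // L addNr mulr0.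
have [p pp pE] := homog_hpoly sF hF (harmonic_derivatives_vanish sF hF L0).
exists p => // x; rewrite -pE ?valS_neq0 //.
by rewrite /hpart hext_val enorm1 ?valS // expr1n mul1r.
Qed.

Lemma hpoly_sphere_smooth k p : hpoly k p -> sphere_smooth (fun x => p (val x)).
Proof.
move=> pp; apply: (smooth_congr oU) (smoothM oU (smoothX oU k (@smooth_enormV R)) (hpoly_smooth oU pp)).
by move=> y y0 /=; rewrite hextE val_radial // (hpoly_scale _ _ pp).
Qed.

Lemma hpart_hpoly (k : nat) p y : hpoly k p -> y != 0 -> hpart k (fun x => p (val x)) y = p y.
Proof.
move=> pp y0; rewrite /hpart hextE val_radial // (hpoly_scale _ _ pp) mulrA -exprMn divff.
  by rewrite expr1n mul1r.
by rewrite gt_eqF // enorm_gt0.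
Qed.

Lemma lap_congr F G y : (forall z, z != 0 -> F z = G z) -> y != 0 -> lap F y = lap G y.
Proof.
move=> FG y0; apply: eq_bigr => i _; apply: (derive_congr oU) y0 => z z0.
exact: (derive_congr oU).
Qed.

Lemma hpoly_laplacian k p h : hpoly k p ->
  is_sphere_laplacian (fun x => p (val x)) h <->
  forall x, h x = eigval k * p (val x) - lap p (val x).
Proof.
move=> pp; have sp := hpoly_sphere_smooth pp.
have E x : - lap (hext (fun x => p (val x))) (val x) = eigval k * p (val x) - lap p (val x).
  have := lap_hpart k x sp; rewrite (lap_congr (fun z => @hpart_hpoly k p z pp)) ?valS_neq0 // => ->.
  by rewrite opprD addrA subrr sub0r.
split=> [/(sphere_laplacianP _ sp) L x|L]; first exact: (etrans (L x) (E x)).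
by apply/(sphere_laplacianP _ sp) => x; exact: (etrans (L x) (esym (E x))).
Qed.

End SphereFunctions.

(** * The spectrum of a quotient *)

Section QuotientSpectrum.
Variables (R : realType) (G : set 'M[R]_4).
Local Notation V := 'cV[R]_4.
Local Notation U0 := (@punctured R).
Local Notation oU := (@open_punctured R).
Local Notation S3 := (sphere3 R).
Local Notation Q := (quotient3 G).
Hypotheses (G1 : G 1%:M) (GM : forall g h, G g -> G h -> G (g *m h))
  (GV : forall g, G g -> exists2 h, G h & h *m g = 1%:M)
  (GO : forall g, G g -> forall y z : V, dotv (g *m y) (g *m z) = dotv y z).

Lemma proj3_surj (a : Q) : exists x, proj3 G x = a.
Proof.
by case: a => A [x Ax]; exists x; apply: eq_exist; rewrite Ax.
Qed.

Lemma proj3_eq (x x' : S3) g : G g -> val x' = g *m val x -> proj3 G x = proj3 G x'.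
Proof.
move=> Gg E; apply: eq_exist; apply/seteqP; split=> z [h Gh hz].
  have [g' Gg' gg] := GV Gg; exists (h *m g'); first exact: GM.
  by rewrite E -mulmxA (mulmxA g') gg mul1mx.
by exists (h *m g); [exact: GM|rewrite -mulmxA -E].
Qed.

Definition invariant_fun (p : V -> R) : Prop := forall g y, G g -> p (g *m y) = p y.

Lemma push_fun (p : V -> R) : invariant_fun p -> exists f : Q -> R, forall x, f (proj3 G x) = p (val x).
Proof.
move=> ip; have /choice[s sP] := proj3_surj.
exists (fun a => p (val (s a))) => x.
have : orbit3 G x (s (proj3 G x)).
  have /(congr1 (fun a : Q => sval a)) /= <- := sP (proj3 G x).
  by exists 1%:M => //; rewrite mul1mx.
by case=> g Gg ->; exact: ip.
Qed.

Lemma act_sphere g (x : S3) : G g -> exists x' : S3, val x' = g *m val x.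
Proof. by move=> Gg; apply: sphereP; rewrite GO // valS. Qed.

(** Invariance holds on the sphere because [f] lives on the orbits, and extends to R^4 by
    homogeneity. *)
Lemma hpoly_invariant (k : nat) p (f : Q -> R) : hpoly k p ->
  (forall x, f (proj3 G x) = p (val x)) -> invariant_fun p.
Proof.
move=> pp fp g y Gg; have [->|y0] := eqVneq y 0; first by rewrite mulmx0.
have ey : 0 < enorm y by rewrite enorm_gt0.
have -> : y = enorm y *: val (radial y).
  by rewrite val_radial // scalerA divff ?scale1r // gt_eqF.
rewrite -scalemxAr !(hpoly_scale _ _ pp); congr (_ * _).
by have [x' E] := act_sphere (radial y) Gg; rewrite -E -!fp (proj3_eq Gg E).
Qed.

Lemma eigenspaceP (k : nat) (f : Q -> R) : eigenspace3 G (eigval R k) f <->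
  exists p, [/\ hpoly k p, invariant_fun p, forall x : S3, lap p (val x) = 0 &
    forall x, f (proj3 G x) = p (val x)].
Proof.
split=> [[sf Lf]|[p [pp ip lp fp]]].
  have [p pp fp'] := eigenfunction_hpoly sf Lf.
  have fp x : f (proj3 G x) = p (val x) by exact: fp'.
  have E : f \o proj3 G = (fun x => p (val x)) by apply/funext.
  exists p; split=> // [|x]; first exact: hpoly_invariant pp fp.
  move: Lf; rewrite /is_laplacian E => /(hpoly_laplacian _ pp) /(_ x) /= L.
  have := L; rewrite fp => /esym/eqP; rewrite subr_eq addrC -subr_eq subrr => /eqP ->.
  by [].
have E : f \o proj3 G = (fun x => p (val x)) by apply/funext.
split; rewrite /quotient_smooth /is_laplacian ?E; first exact: hpoly_sphere_smooth pp.
by apply/(hpoly_laplacian _ pp) => x /=; rewrite fp lp subr0.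
Qed.

Lemma eigenspaceZ k (c : R) f : eigenspace3 G (eigval R k) f ->
  eigenspace3 G (eigval R k) (fun a => c * f a).
Proof.
move=> /eigenspaceP[p [pp ip lp fp]]; apply/eigenspaceP; exists (fun y => c * p y); split.
- exact: hpolyZ.
- by move=> g y Gg; rewrite ip.
- by move=> x; rewrite lapZ ?lp ?mulr0 ?valS_neq0 //; exact: hpoly_smooth oU pp.
- by move=> x; rewrite fp.
Qed.

Lemma eigenspaceD k f h : eigenspace3 G (eigval R k) f -> eigenspace3 G (eigval R k) h ->
  eigenspace3 G (eigval R k) (fun a => f a + h a).
Proof.
move=> /eigenspaceP[p [pp ip lp fp]] /eigenspaceP[r [pr ir lr fr]].
apply/eigenspaceP; exists (fun y => p y + r y); split.
- exact: hpolyD.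
- by move=> g y Gg; rewrite ip // ir.
- by move=> x; rewrite lapD ?lp ?lr ?addr0 ?valS_neq0 //; [exact: hpoly_smooth oU pp|exact: hpoly_smooth oU pr].
- by move=> x; rewrite fp fr.
Qed.

Lemma eigenspace0 k : eigenspace3 G (eigval R k) (fun=> 0).
Proof.
apply/eigenspaceP; exists (fun=> 0); split=> // [|x]; first exact: hpoly0.
rewrite /lap big1 // => i _; rewrite (_ : 'D__ (fun=> 0) = cst 0) ?derive_cst //.
by apply/funext => z; exact: derive_cst.
Qed.

Lemma eigenspace_sum k n (f : 'I_n -> Q -> R) (c : 'I_n -> R) :
  (forall i, eigenspace3 G (eigval R k) (f i)) ->
  eigenspace3 G (eigval R k) (fun a => \sum_i c i * f i a).
Proof.
elim: n f c => [|n IH] f c Ef.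
  have := eigenspace0 k; congr (eigenspace3 _ _ _).
  by apply/funext => a; rewrite big_ord0.
have := eigenspaceD (eigenspaceZ (c ord0) (Ef ord0))
  (IH _ (fun i => c (lift ord0 i)) (fun i => Ef (lift ord0 i))).
congr (eigenspace3 _ _ _); apply/funext => a; by rewrite big_ord_recl.
Qed.

Lemma lap_sum n (F : 'I_n -> V -> R) y : (forall i, smooth_on U0 (F i)) -> y != 0 ->
  lap (fun z => \sum_i F i z) y = \sum_i lap (F i) y.
Proof.
move=> sF y0; elim: n F sF => [|n IH] F sF.
  rewrite big_ord0 /lap big1 // => i _.
  rewrite (_ : (fun z => _) = cst 0); last by apply/funext => z; rewrite big_ord0.
  by rewrite (_ : 'D__ (cst 0) = cst 0) ?derive_cst //; apply/funext => z; exact: derive_cst.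
rewrite (_ : (fun z => _) = fun z => F ord0 z + \sum_i F (lift ord0 i) z); last first.
  by apply/funext => z; rewrite big_ord_recl.
rewrite lapD //; last exact: (smooth_sum oU).
by rewrite big_ord_recl IH.
Qed.

Lemma eigenspace_laplacian_sum n (ka : 'I_n -> nat) (f : 'I_n -> Q -> R) :
  (forall j, eigenspace3 G (eigval R (ka j)) (f j)) ->
  (forall a, \sum_j f j a = 0) -> forall a, \sum_j eigval R (ka j) * f j a = 0.
Proof.
move=> Ef f0 a; have [x <-] := proj3_surj a.
have S j : smooth_on U0 (hext (f j \o proj3 G)) by have [] := Ef j.
have L j : eigval R (ka j) * f j (proj3 G x) = - lap (hext (f j \o proj3 G)) (val x).
  have [sf Lf] := Ef j; by move/(sphere_laplacianP _ sf): Lf => /(_ x).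
under eq_bigr do rewrite L.
rewrite sumrN -(lap_sum S (valS_neq0 x)).
rewrite (_ : (fun z => _) = fun=> 0); last by apply/funext => z; exact: f0.
rewrite /lap big1 ?oppr0 // => i _; rewrite (_ : 'D__ (fun=> 0) = cst 0) ?derive_cst //.
by apply/funext => z; exact: derive_cst.
Qed.

(** Applying the Laplacian to the relation and subtracting [eigval (ka 0)] times it removes the
    first term and multiplies the others by the nonzero [c j]. *)
Lemma eigenspace_indep n (ka : 'I_n -> nat) (f : 'I_n -> Q -> R) : injective ka ->
  (forall j, eigenspace3 G (eigval R (ka j)) (f j)) ->
  (forall a, \sum_j f j a = 0) -> forall j a, f j a = 0.
Proof.
elim: n ka f => [|n IH] ka f kaI Ef f0; first by case.
pose c j := eigval R (ka (lift ord0 j)) - eigval R (ka ord0).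
have c0 j : c j != 0.
  rewrite subr_eq0; apply/eqP => /eigval_inj /kaI /eqP.
  by rewrite eq_sym (negPf (neq_lift _ _)).
have fl j a : f (lift ord0 j) a = 0.
  have : c j * f (lift ord0 j) a = 0.
    apply: (IH (ka \o lift ord0) (fun j a => c j * f (lift ord0 j) a)).
    - by move=> i i' /kaI /lift_inj.
    - by move=> i; exact: eigenspaceZ (Ef _).
    - move=> b; have := eigenspace_laplacian_sum Ef f0 b.
      rewrite big_ord_recl => E; have := f0 b; rewrite big_ord_recl => E'.
      under eq_bigr do rewrite mulrBl.
      rewrite sumrB -mulr_sumr /=; move: E' E.
      set T := \sum_i f (lift ord0 i) b; set S := \sum_(i < n) _ => E' E.
      have eT : T = - f ord0 b by lra.
      by rewrite eT; lra.
  by move/eqP; rewrite mulf_eq0 (negPf (c0 j)) => /eqP.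
move=> j a; case: (unliftP ord0 j) => [j' ->//|->].
by have := f0 a; rewrite big_ord_recl big1 ?addr0.
Qed.

Lemma derive_lin_comp (p : V -> R) (g : 'M[R]_4) y v :
  'D_v (fun z => p (g *m z)) y = 'D_(g *m v) p (g *m y).
Proof.
rewrite /derive; congr (lim _); set q := fun h : R => _; set q' := fun h : R => _.
suff -> : q = q' by [].
by apply/funext => h; rewrite /q /q' /= mulmxDr scalemxAr.
Qed.

(** An orthogonal matrix carries the coordinate frame to an orthonormal frame, which computes the
    same trace. *)
Lemma lap_orthogonal (p : V -> R) g y : smooth_on U0 p -> G g -> y != 0 ->
  lap (fun z => p (g *m z)) y = lap p (g *m y).
Proof.
move=> sp Gg y0; have gy0 : g *m y != 0 by rewrite -dotv_gt0 GO // dotv_gt0.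
rewrite -(lap_frame (b := fun i => g *m basisv R i) sp gy0); last first.
  move=> i j; rewrite GO // /dotv (bigD1 i) //= big1 ?addr0 => [|k ki].
    by rewrite !mxE !eqxx !andbT mul1r.
  by rewrite !mxE (negPf ki) mul0r.
rewrite /lap; apply: eq_bigr => i _.
rewrite (_ : 'D__ (fun z => p (g *m z)) = fun z => 'D_(g *m basisv R i) p (g *m z)).
  exact: (derive_lin_comp ('D_(g *m basisv R i) p)).
by apply/funext => z; exact: derive_lin_comp.
Qed.

Lemma lap_invariant (k : nat) p : hpoly k p -> invariant_fun p -> invariant_fun (lap p).
Proof.
move=> pp ip g y Gg; have [->|y0] := eqVneq y 0; first by rewrite mulmx0.
rewrite -(lap_orthogonal (hpoly_smooth oU pp) Gg y0); congr (lap _ y).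
by apply/funext => z; rewrite ip.
Qed.

(** [lap p] has degree [k - 2] and splits into eigenfunctions [h j] by induction. The sphere
    Laplacian of [p] is [eigval k p - lap p], so subtracting each [h j], divided by the difference
    [c j] of the eigenvalues, from [p] leaves an eigenfunction for [eigval k]. *)
Lemma hpoly_decomposition (k : nat) p : hpoly k p -> invariant_fun p ->
  exists f : nat -> Q -> R,
    (forall j, (j < k./2.+1)%N -> eigenspace3 G (eigval R (k - j.*2)) (f j)) /\
    forall x, p (val x) = \sum_(j < k./2.+1) f j (proj3 G x).
Proof.
elim/ltn_ind: k p => k IH p pp ip.
have [k2|k2] := ltnP k 2.
  have [f fp] := push_fun ip; exists (fun=> f).
  have -> : k./2 = 0%N by case: k k2 {IH pp} => [|[|]].
  split=> [j|x]; last by rewrite big_ord1 fp.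
  rewrite ltnS leqn0 => /eqP ->; rewrite subn0; apply/eigenspaceP; exists p; split=> // x.
  exact: lap_hpoly_low pp.
case: k k2 IH pp => [|[|k]] // _ IH pp.
have pl := hpoly_lap pp; have il := lap_invariant pp ip.
have [h [Eh hE]] := IH k (ltnW (ltnSn k.+1)) _ pl il.
pose c j := eigval R k.+2 - eigval R (k - j.*2).
have c0 j : c j != 0.
  by rewrite subr_eq0; apply/eqP => /eigval_inj E; move: (leq_subr j.*2 k); rewrite -E; lia.
have [f0 f0p] := push_fun ip.
pose f j := if j is j'.+1 then fun a => (c j')^-1 * h j' a
  else fun a => f0 a - \sum_(j < k./2.+1) (c j)^-1 * h j a.
have Es (j : 'I_(k./2.+1)) : sphere_smooth (h j \o proj3 G) by have [] := Eh j (ltn_ord j).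
exists f; split=> [[|j] jk|x]; last first.
- rewrite /= big_ord_recl /= -f0p.
  under [X in _ = _ + X]eq_bigr do rewrite /bump /=.
  by rewrite subrK.
- by rewrite /= doubleS subSS subSS; apply: eigenspaceZ; apply: Eh.
pose s := fun x : S3 => \sum_(j < k./2.+1) (- (c j)^-1) * h j (proj3 G x).
have ss : sphere_smooth s.
  by apply: (smooth_sum oU) => j; exact: (sphere_smoothZ _ (Es j)).
have sp := hpoly_sphere_smooth pp.
have E : f 0%N \o proj3 G = fun x => p (val x) + s x.
  apply/funext => x; rewrite /= f0p /s; congr (_ + _); rewrite -sumrN.
  by apply: eq_bigr => j _; rewrite mulNr.
split; rewrite /quotient_smooth /is_laplacian E.
  exact: sphere_smoothD.
apply/(sphere_laplacianP _ (sphere_smoothD sp ss)) => x /=.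
have x0 := valS_neq0 x.
rewrite (lapD sp ss x0) opprD.
have /(hpoly_laplacian _ pp) : forall x : S3, eigval R k.+2 * p (val x) - lap p (val x) =
   eigval R k.+2 * p (val x) - lap p (val x) by [].
move=> /(sphere_laplacianP _ sp) /(_ x) <-.
have -> : lap (hext s) (val x) = \sum_(j < k./2.+1) (c j)^-1 * (eigval R (k - j.*2) * h j (proj3 G x)).
  have Ss (j : 'I_(k./2.+1)) : smooth_on U0 (fun z => - (c j)^-1 * hext (h j \o proj3 G) z).
    exact: (sphere_smoothZ _ (Es j)).
  rewrite (lap_sum Ss x0); apply: eq_bigr => j _.
  rewrite lapZ //; last exact: Es.
  have [_ Lh] := Eh j (ltn_ord j); have := (sphere_laplacianP _ (Es j)).1 Lh x.
  by rewrite /= => ->; rewrite mulNr mulrN.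
rewrite hE /= f0p -/(s x) -addrA -opprD -big_split /= mulrBr; congr (_ - _).
rewrite mulr_sumr; apply: eq_bigr => j _.
have cj := c0 j; rewrite [in LHS](_ : eigval R k.+2 = c j + eigval R (k - j.*2)); last by rewrite subrK.
by field.
Qed.

End QuotientSpectrum.

(** * Linear independence of families of functions *)

Section FunctionFamilies.
Variables (K : fieldType) (T : Type).

Definition ffree (I : finType) (b : I -> T -> K) : Prop :=
  forall c : I -> K, (forall t, \sum_i c i * b i t = 0) -> forall i, c i = 0.

Definition fspan (I : finType) (b : I -> T -> K) (f : T -> K) : Prop :=
  exists c : I -> K, forall t, f t = \sum_i c i * b i t.

(** With more functions [b i] than [h j], the coefficient matrix has a nonzero left kernel vector,
    which is a relation among the [b i]. *)
Lemma ffree_le_span (I J : finType) (b : I -> T -> K) (h : J -> T -> K) :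
  ffree b -> (forall i, fspan h (b i)) -> (#|I| <= #|J|)%N.
Proof.
move=> fb /choice[A AE]; rewrite leqNgt; apply/negP => lt.
pose M : 'M[K]_(#|I|, #|J|) := \matrix_(i, j) A (enum_val i) (enum_val j).
have : kermx M != 0.
  rewrite kermx_eq0 /row_free ltn_eqF //.
  exact: leq_ltn_trans (rank_leq_col M) lt.
case/matrix0Pn => r [s rs].
have vM (j : 'I_#|J|) : \sum_i kermx M r i * M i j = 0.
  by have /matrixP/(_ r j) := mulmx_ker M; rewrite !mxE.
move/negP: rs; apply; rewrite -(enum_valK s); apply/eqP.
apply: (fb (fun i => kermx M r (enum_rank i))) => t.
under eq_bigr do rewrite AE mulr_sumr.
rewrite exchange_big big1 //= => j _.
under eq_bigr do rewrite mulrA.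
rewrite -mulr_suml (reindex _ (onW_bij _ (@enum_val_bij I))) /=.
rewrite (eq_bigr (fun i => kermx M r i * M i (enum_rank j))) ?vM ?mul0r // => i _.
by rewrite [M _ _]mxE enum_valK enum_rankK.
Qed.

Lemma ffree_span_card (I J : finType) (b : I -> T -> K) (h : J -> T -> K) :
  ffree b -> ffree h -> (forall i, fspan h (b i)) -> (forall j, fspan b (h j)) ->
  #|I| = #|J|.
Proof.
move=> fb fh bh hb; apply/eqP; rewrite eqn_leq.
by rewrite (ffree_le_span fb bh) (ffree_le_span fh hb).
Qed.

End FunctionFamilies.

(** A free family of maximal size spans, since a missing [f] could be adjoined to it. *)
Lemma has_dim_exists (R : realType) (T : Type) (E : set (T -> R)) (N : nat) :
  (forall n (b : 'I_n -> T -> R), (forall i, E (b i)) -> ffree b -> (n <= N)%N) ->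
  exists n, has_dim E n.
Proof.
move=> bound; pose P n := `[< exists b : 'I_n -> T -> R, (forall i, E (b i)) /\ ffree b >].
have P0 : exists n, P n.
  by exists 0%N; apply/asboolP; exists (fun _ _ => 0); split=> [[]//|c _ []].
have PN n : P n -> (n <= N)%N by move=> /asboolP[b [bE bf]]; exact: bound bE bf.
case: (ex_maxnP P0 PN) => n /asboolP[b [bE bf]] mx; exists n, b; split=> // f Ef.
apply: contrapT => nsp.
suff : P n.+1 by move=> /mx; rewrite ltnn.
apply/asboolP; exists (fun i => oapp b f (unlift ord0 i)); split=> [i|c c0].
  by case: (unlift ord0 i) => [j|] /=.
have E0 t : c ord0 * f t + \sum_i c (lift ord0 i) * b i t = 0.
  rewrite -[RHS](c0 t) big_ord_recl unlift_none /=; congr (_ + _).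
  by apply: eq_bigr => i _; rewrite liftK.
have z0 : c ord0 = 0.
  apply/eqP/negPn/negP => n0; apply: nsp.
  exists (fun i => - (c ord0)^-1 * c (lift ord0 i)) => t.
  under eq_bigr do rewrite -mulrA.
  rewrite -mulr_sumr; apply: (mulfI n0); rewrite mulrA mulrN divff // mulN1r.
  by apply/eqP; rewrite -addr_eq0 E0.
move=> i; case: (unliftP ord0 i) => [j ->|-> //].
apply: (bf (fun i => c (lift ord0 i))) => t.
by rewrite -[RHS](E0 t) z0 mul0r add0r.
Qed.

(** * Monomials in the complex coordinates *)

Section ComplexMonomials.
Variable R : realType.
Local Notation C := (R[i]).
Local Notation V := 'cV[R]_4.

Lemma ffree_tensor (K : fieldType) (X Y : Type) (I J : finType) (f : I -> X -> K) (g : J -> Y -> K) :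
  ffree f -> ffree g -> ffree (fun (ij : I * J) (xy : X * Y) => f ij.1 xy.1 * g ij.2 xy.2).
Proof.
move=> ff fg c c0 [i j]; apply: (fg (fun j => c (i, j))) => y.
apply: (ff (fun i => \sum_j c (i, j) * g j y)) => x.
under eq_bigr do rewrite mulr_suml.
rewrite pair_big /= -[RHS](c0 (x, y)); apply: eq_bigr => -[i' j'] _ /=.
by rewrite -mulrA (mulrC (g j' y)).
Qed.

Lemma ffree_comp_inj (K : fieldType) (X : Type) (I J : finType) (f : I -> X -> K) (s : J -> I) :
  injective s -> ffree f -> ffree (f \o s).
Proof.
move=> sI ff c c0 j.
pose d i := \sum_(j | s j == i) c j.
have : d (s j) = 0.
  apply: ff => x; rewrite -[RHS](c0 x) /d.
  under eq_bigr do rewrite mulr_suml.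
  rewrite (exchange_big_dep xpredT) //=; apply: eq_bigr => j' _.
  by rewrite (eq_bigl (pred1 (s j'))) ?big_pred1_eq // => i /=; rewrite eq_sym.
by rewrite /d (eq_bigl (pred1 j)) ?big_pred1_eq // => j' /=; rewrite (inj_eq sI).
Qed.

Lemma ffree_surj (K : fieldType) (X Y : Type) (I : finType) (f : I -> X -> K) (h : I -> Y -> K) (u : X -> Y) :
  (forall i x, f i x = h i (u x)) -> ffree f -> ffree h.
Proof.
by move=> fh ff c c0; apply: ff => x; under eq_bigr do rewrite fh; exact: c0.
Qed.

Lemma poly_nat_eq0 (p : {poly C}) : (forall n : nat, p.[n%:R] = 0) -> p = 0.
Proof.
move=> pn; apply/eqP/negPn/negP => p0.
have := @max_poly_roots _ p [seq n%:R | n <- iota 0 (size p)] p0.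
rewrite map_inj_uniq ?iota_uniq; last by move=> a b /eqP; rewrite eqr_nat => /eqP.
rewrite size_map size_iota ltnn => H.
have : false by apply: H => //; apply/allP => x /mapP[n _ ->]; rewrite /root pn.
by [].
Qed.

Lemma ffree_power K : ffree (fun (a : 'I_K) (u : C) => u ^+ a).
Proof.
move=> c c0 i; pose p := \poly_(a < K) (if insub a is Some a' then c a' else 0).
have p0 : p = 0.
  apply: poly_nat_eq0 => n; rewrite horner_poly -[RHS](c0 n%:R).
  by apply: eq_bigr => a _; rewrite valK.
by have := coef_poly K (fun a => if insub a is Some a' then c a' else 0) i;
  rewrite -/p p0 coef0 ltn_ord valK.
Qed.

Local Notation I := (Complex 0 1 : C).

Definition zc (x y : R) : C := Complex x y.

Lemma zcE x y : zc x y = real_complex R x + I * real_complex R y.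
Proof. by apply/eqP; rewrite eq_complex /=; apply/andP; split; apply/eqP; ring. Qed.

Lemma I_neq0 : I != 0.
Proof. by rewrite eq_complex /= oner_eq0 andbF. Qed.

(** A relation between the products of powers of [z] and its conjugate is a polynomial identity in
    the real and imaginary parts [X] and [Y]. It persists for complex [X] and [Y], where [X + I Y]
    and [X - I Y] are independent variables. *)
Lemma ffree_zzb K : ffree (fun (m : 'I_K * 'I_K) (xy : R * R) =>
  zc xy.1 xy.2 ^+ m.1 * zc xy.1 (- xy.2) ^+ m.2).
Proof.
move=> c c0; have ft := ffree_tensor (@ffree_power K) (@ffree_power K).
apply: ft => -[u v] /=.
pose P (X Y : C) := \sum_(m : 'I_K * 'I_K) c m * ((X + I * Y) ^+ m.1 * (X - I * Y) ^+ m.2).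
(* The identity at natural numbers extends to complex numbers in one variable at a time, by
   [poly_nat_eq0]. *)
have P0 (n n' : nat) : P n%:R n'%:R = 0.
  rewrite /P -[RHS](c0 (n%:R, n'%:R)); apply: eq_bigr => m _ /=.
  by rewrite !zcE rmorphN /= !rmorph_nat mulrN.
have P1 (X : C) (n' : nat) : P X n'%:R = 0.
  pose p := \sum_(m : 'I_K * 'I_K) (c m)%:P * (('X + (I * n'%:R)%:P) ^+ m.1 * ('X - (I * n'%:R)%:P) ^+ m.2).
  have pE Z : p.[Z] = P Z n'%:R.
    by rewrite /p horner_sum; apply: eq_bigr => m _; rewrite !hornerE.
  by rewrite -pE (_ : p = 0) ?horner0 //; apply: poly_nat_eq0 => n; rewrite pE.
have P2 (X Y : C) : P X Y = 0.
  pose p := \sum_(m : 'I_K * 'I_K) (c m)%:P * ((X%:P + I%:P * 'X) ^+ m.1 * (X%:P - I%:P * 'X) ^+ m.2).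
  have pE Z : p.[Z] = P X Z.
    by rewrite /p horner_sum; apply: eq_bigr => m _; rewrite !hornerE.
  by rewrite -pE (_ : p = 0) ?horner0 //; apply: poly_nat_eq0 => n; rewrite pE.
rewrite -[RHS](P2 ((u + v) / 2) ((u - v) / (2 * I))); apply: eq_bigr => m _.
have I0 := I_neq0; have two : 2 != 0 :> C by rewrite pnatr_eq0.
have -> : (u + v) / 2 + I * ((u - v) / (2 * I)) = u by field; rewrite ?I0.
by have -> : (u + v) / 2 - I * ((u - v) / (2 * I)) = v by field; rewrite ?I0.
Qed.

Definition z1 (y : V) : C := zc (y 0 0) (y 1 0).
Definition z1b (y : V) : C := zc (y 0 0) (- y 1 0).
Definition z2 (y : V) : C := zc (y 2%:R 0) (y 3%:R 0).
Definition z2b (y : V) : C := zc (y 2%:R 0) (- y 3%:R 0).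

Definition mono (a b c d : nat) (y : V) : C := z1 y ^+ a * z1b y ^+ b * (z2 y ^+ c * z2b y ^+ d).

Lemma ffree_mono4 K : ffree (fun (m : 'I_K * 'I_K * ('I_K * 'I_K)) (y : V) =>
  mono m.1.1 m.1.2 m.2.1 m.2.2 y).
Proof.
pose u (p : (R * R) * (R * R)) : V :=
  \col_(i < 4) nth 0 [:: p.1.1; p.1.2; p.2.1; p.2.2] i.
apply: (ffree_surj (u := u)) (ffree_tensor (@ffree_zzb K) (@ffree_zzb K)) => m p.
by rewrite /mono /z1 /z1b /z2 /z2b !mxE /=.
Qed.

Definition mexp := (nat * nat * (nat * nat))%type.
Definition mdeg (m : mexp) : nat := m.1.1 + m.1.2 + (m.2.1 + m.2.2).
Definition monom (m : mexp) (y : V) : C := mono m.1.1 m.1.2 m.2.1 m.2.2 y.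

Definition mspan (k : nat) (F : V -> C) : Prop :=
  exists s : seq (C * mexp), all (fun cm => mdeg cm.2 == k) s /\
    forall y, F y = \sum_(cm <- s) cm.1 * monom cm.2 y.

Lemma mspanD k F G : mspan k F -> mspan k G -> mspan k (fun y => F y + G y).
Proof.
move=> [s [sk sF]] [t [tk tG]]; exists (s ++ t); split; first by rewrite all_cat sk.
by move=> y; rewrite big_cat sF tG.
Qed.

Lemma mspanZ k (c : C) F : mspan k F -> mspan k (fun y => c * F y).
Proof.
move=> [s [sk sF]]; exists [seq (c * cm.1, cm.2) | cm <- s]; split.
  by rewrite all_map.
by move=> y; rewrite big_map sF mulr_sumr; apply: eq_bigr => cm _; rewrite mulrA.
Qed.

Lemma mspan_shift k (sh : mexp -> mexp) (z : V -> C) F :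
  (forall m, mdeg (sh m) = (mdeg m).+1) -> (forall m y, monom (sh m) y = z y * monom m y) ->
  mspan k F -> mspan k.+1 (fun y => z y * F y).
Proof.
move=> shk shz [s [sk sF]]; exists [seq (cm.1, sh cm.2) | cm <- s]; split.
  rewrite all_map; apply: sub_all sk => cm /=; by rewrite shk eqSS.
move=> y; rewrite big_map sF mulr_sumr; apply: eq_bigr => cm _ /=.
by rewrite shz mulrCA.
Qed.

Lemma mspan_z1 k F : mspan k F -> mspan k.+1 (fun y => z1 y * F y).
Proof.
apply: (@mspan_shift _ (fun m => (m.1.1.+1, m.1.2, m.2))) => m //=.
by move=> y; rewrite /monom /mono exprS !mulrA.
Qed.

Lemma mspan_z1b k F : mspan k F -> mspan k.+1 (fun y => z1b y * F y).
Proof.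
apply: (@mspan_shift _ (fun m => (m.1.1, m.1.2.+1, m.2))) => m; first by rewrite /mdeg /=; lia.
by move=> y; rewrite /monom /mono exprS; ring.
Qed.

Lemma mspan_z2 k F : mspan k F -> mspan k.+1 (fun y => z2 y * F y).
Proof.
apply: (@mspan_shift _ (fun m => (m.1, (m.2.1.+1, m.2.2)))) => m; first by rewrite /mdeg /=; lia.
by move=> y; rewrite /monom /mono exprS; ring.
Qed.

Lemma mspan_z2b k F : mspan k F -> mspan k.+1 (fun y => z2b y * F y).
Proof.
apply: (@mspan_shift _ (fun m => (m.1, (m.2.1, m.2.2.+1)))) => m; first by rewrite /mdeg /=; lia.
by move=> y; rewrite /monom /mono exprS; ring.
Qed.

Lemma mspan_ext k F G : (forall y, F y = G y) -> mspan k F -> mspan k G.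
Proof. by move=> /funext ->. Qed.

Lemma mspan_coord k F (i : 'I_4) : mspan k F ->
  mspan k.+1 (fun y : V => real_complex R (y i 0) * F y).
Proof.
move=> sF; have I0 := I_neq0.
have e1 (x y : R) : real_complex R x = 2^-1 * zc x y + 2^-1 * zc x (- y).
  by rewrite !zcE rmorphN; field.
have e2 (x y : R) : real_complex R y = (2 * I)^-1 * zc x y + - (2 * I)^-1 * zc x (- y).
  by rewrite !zcE rmorphN; field; rewrite ?I0.
case: i => [[|[|[|[|//]]]] Hi].
- apply: mspan_ext (mspanD (mspanZ 2^-1 (mspan_z1 sF)) (mspanZ 2^-1 (mspan_z1b sF))) => y.
  rewrite (_ : Ordinal Hi = 0); last exact/val_inj.
  by rewrite (e1 _ (y 1 0)) /z1 /z1b; ring.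
- apply: mspan_ext (mspanD (mspanZ (2 * I)^-1 (mspan_z1 sF)) (mspanZ (- (2 * I)^-1) (mspan_z1b sF))) => y.
  rewrite (_ : Ordinal Hi = 1); last exact/val_inj.
  by rewrite (e2 (y 0 0)) /z1 /z1b; ring.
- apply: mspan_ext (mspanD (mspanZ 2^-1 (mspan_z2 sF)) (mspanZ 2^-1 (mspan_z2b sF))) => y.
  rewrite (_ : Ordinal Hi = 2%:R); last exact/val_inj.
  by rewrite (e1 _ (y 3%:R 0)) /z2 /z2b; ring.
- apply: mspan_ext (mspanD (mspanZ (2 * I)^-1 (mspan_z2 sF)) (mspanZ (- (2 * I)^-1) (mspan_z2b sF))) => y.
  rewrite (_ : Ordinal Hi = 3%:R); last exact/val_inj.
  by rewrite (e2 (y 2%:R 0)) /z2 /z2b; ring.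
Qed.

Lemma mspan_sum k n (F : 'I_n -> V -> C) : (forall i, mspan k (F i)) ->
  mspan k (fun y => \sum_i F i y).
Proof.
elim: n F => [|n IH] F sF.
  by exists [::]; split=> // y; rewrite big_ord0 big_nil.
apply: mspan_ext (mspanD (sF ord0) (IH _ (fun i => sF (lift ord0 i)))) => y.
by rewrite big_ord_recl.
Qed.

Lemma hpoly_mspan (k : nat) p : hpoly k p -> mspan k (fun y => real_complex R (p y)).
Proof.
elim: k p => [|k IH] p /=.
  move=> [c pc]; exists [:: (real_complex R c, (0, 0, (0, 0))%N)]; split=> // y.
  by rewrite big_seq1 pc /monom /mono !expr0 !mulr1.
move=> [g [pg pE]].
apply: mspan_ext (mspan_sum (fun i => mspan_coord i (IH _ (pg i)))) => y.
by rewrite pE rmorph_sum; apply: eq_bigr => i _; rewrite rmorphM.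
Qed.

Definition chpoly (k : nat) (F : V -> C) : Prop :=
  hpoly k (fun y => complex.Re (F y)) /\ hpoly k (fun y => complex.Im (F y)).

(** The sign [s] treats a complex coordinate and its conjugate together. *)
Lemma chpoly_zc (k : nat) (i j : 'I_4) (s : R) F : chpoly k F ->
  chpoly k.+1 (fun y : V => zc (y i 0) (s * y j 0) * F y).
Proof.
move=> [pr pi]; split.
  apply: hpoly_ext (hpolyD (hpoly_coordM i pr) (hpolyZ (- s) (hpoly_coordM j pi))) => y.
  by rewrite /zc; case: (F y) => a b /=; ring.
apply: hpoly_ext (hpolyD (hpoly_coordM i pi) (hpolyZ s (hpoly_coordM j pr))) => y.
by rewrite /zc; case: (F y) => a b /=; ring.
Qed.

Lemma chpoly_ext k F G : (forall y, F y = G y) -> chpoly k F -> chpoly k G.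
Proof. by move=> /funext ->. Qed.

Lemma chpoly_zcX (k n : nat) (i j : 'I_4) (s : R) F : chpoly k F ->
  chpoly (n + k) (fun y : V => zc (y i 0) (s * y j 0) ^+ n * F y).
Proof.
move=> pF; elim: n => [|n IH]; first by apply: chpoly_ext pF => y; rewrite mul1r.
by apply: chpoly_ext (chpoly_zc i j s IH) => y; rewrite exprS mulrA.
Qed.

Lemma chpoly_monom m : chpoly (mdeg m) (monom m).
Proof.
have p0 : chpoly 0 (fun=> 1) by split; [exists 1|exists 0].
have H := chpoly_zcX m.1.1 0 1 1 (chpoly_zcX m.1.2 0 1 (-1)
  (chpoly_zcX m.2.1 2%:R 3%:R 1 (chpoly_zcX m.2.2 2%:R 3%:R (-1) p0))).
have -> : mdeg m = (m.1.1 + (m.1.2 + (m.2.1 + (m.2.2 + 0))))%N by rewrite addn0 addnA.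
apply: chpoly_ext H => y.
by rewrite /monom /mono /z1 /z1b /z2 /z2b !mul1r !mulN1r mulr1 !mulrA.
Qed.

End ComplexMonomials.

(** * The action of the lens group on monomials *)

Section LensAction.
Variable R : realType.
Local Notation C := (R[i]).
Local Notation V := 'cV[R]_4.

(* [rot2] turns clockwise, so it multiplies y_0 + i y_1 by exp (- 2 pi i theta). *)
Definition cexp (t : R) : C := Complex (cos t) (- sin t).

Lemma cexpD s t : cexp (s + t) = cexp s * cexp t.
Proof.
by apply/eqP; rewrite eq_complex /= cosD sinD; apply/andP; split; apply/eqP; ring.
Qed.

Lemma cexp0 : cexp 0 = 1.
Proof. by rewrite /cexp cos0 sin0 oppr0. Qed.

Variables (q : nat) (q_gt0 : (0 < q)%N).

Definition turn (n : int) : C := cexp (2 * pi * (n%:~R / q%:R)).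

Lemma turnD a b : turn (a + b) = turn a * turn b.
Proof. by rewrite /turn -cexpD; congr cexp; rewrite intrD; ring. Qed.

Lemma turn0 : turn 0 = 1.
Proof. by rewrite /turn mul0r mulr0 cexp0. Qed.

Lemma turnX a n : turn a ^+ n = turn (a * n%:Z).
Proof.
elim: n => [|n IH]; first by rewrite mulr0 turn0.
by rewrite exprS IH -turnD intS mulrDr mulr1.
Qed.

Lemma turn_q : turn q%:Z = 1.
Proof.
rewrite /turn (_ : q%:~R / q%:R = 1); last by rewrite divff // pnatr_eq0 -lt0n.
by rewrite mulr1 /cexp mulrC mulr_natr cos2pi sin2pi oppr0.
Qed.

Lemma turn_modz a : turn a = turn (a %% q%:Z)%Z.
Proof.
have pos n : turn (q%:Z * n%:Z) = 1 by rewrite -turnX turn_q expr1n.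
have all1 b : turn (q%:Z * b) = 1.
  case: b => n; first exact: pos.
  have := turnD (q%:Z * n.+1%:Z) (q%:Z * Negz n); rewrite pos mul1r => <-.
  by rewrite -turn0; congr turn; lia.
by rewrite {1}(divz_eq a q%:Z) turnD mulrC (mulrC _ q%:Z) all1 mulr1.
Qed.

(** After reduction modulo [q] the angle [t] lies in [[0, 2 pi)]. If it is positive, [cos t = 1]
    gives [sin t = 0], hence [t = pi], where the cosine is -1. *)
Lemma turn_eq1 a : (turn a == 1) = (q%:Z %| a)%Z.
Proof.
apply/eqP/idP => [|/dvdzP[b ->]]; last by rewrite turn_modz modzMl turn0.
rewrite turn_modz; have q0 : q%:Z != 0 by rewrite eqz_nat -lt0n.
have r0 := modz_ge0 a q0; have rq := ltz_pmod a (_ : 0 < q%:Z).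
move: rq => /(_ q_gt0); case Er: (a %% q%:Z)%Z r0 => [r|r] // _ rq.
move/(congr1 (@complex.Re R)); rewrite /= => c1.
have [r1|r0] := posnP r; first by apply/dvdz_mod0P; rewrite Er r1.
exfalso; set t := 2 * pi * _ in c1.
have qR : 0 < q%:R :> R by rewrite ltr0n.
have t0 : 0 < t by rewrite /t !mulr_gt0 ?pi_gt0 ?invr_gt0 // ltr0n.
have t2 : t < 2 * pi.
  by rewrite /t gtr_pMr ?mulr_gt0 ?pi_gt0 // ltr_pdivrMr // mul1r ltr_nat.
have s0 : sin t = 0.
  have := cos2Dsin2 t; rewrite c1 expr1n => /(congr1 (fun x => x - 1)).
  by rewrite subrr addrC addKr => /eqP; rewrite sqrf_eq0 => /eqP.
have [tp|tp|tp] := ltgtP t pi.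
- by have := @sin_gt0_pi R t; rewrite t0 tp s0 ltxx => /(_ isT).
- have := @sin_gt0_pi R (t - pi); rewrite subr_gt0 tp ltrBlDr -mulr2n -mulr_natl t2.
  by rewrite sinB cospi sinpi s0 mul0r mulr0 subr0 ltxx => /(_ isT).
- by move: c1; rewrite tp cospi => /eqP; rewrite eq_sym -subr_eq0 opprK (_ : 1 + 1 = 2%:R) ?pnatr_eq0.
Qed.

Local Notation lg := (lens_gen R q).

Lemma rot2D (s t : R) : rot2 s *m rot2 t = rot2 (s + t).
Proof.
apply/matrixP => i j; rewrite !mxE !big_ord_recl big_ord0 !mxE (mulrDr (2 * pi)) cosD sinD.
by case: i => [[|[|//]] Hi]; case: j => [[|[|//]] Hj] /=; ring.
Qed.

Lemma rot2_0 : rot2 0 = 1%:M :> 'M[R]_2.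
Proof.
apply/matrixP => i j; rewrite !mxE mulr0 cos0 sin0 oppr0.
by case: eqP => // _; case: ifP.
Qed.

Lemma lens_genM p1 p2 r1 r2 : lg p1 p2 *m lg r1 r2 = lg (p1 + r1) (p2 + r2).
Proof.
have E (A B A' B' : 'M[R]_2) :
    block_mx A 0 0 B *m block_mx A' 0 0 B' = block_mx (A *m A') 0 0 (B *m B').
  by rewrite mulmx_block !mulmx0 !mul0mx !addr0 !add0r.
by have := E (rot2 (p1%:~R / q%:R)) (rot2 (p2%:~R / q%:R)) (rot2 (r1%:~R / q%:R))
  (rot2 (r2%:~R / q%:R)); rewrite !rot2D -!mulrDl -!intrD.
Qed.

Lemma lens_gen0 : lg 0 0 = 1%:M.
Proof. by rewrite /lens_gen !mul0r rot2_0 -scalar_mx_block. Qed.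

Lemma lens_genX p1 p2 (k : int) : lg p1 p2 ^ k = lg (k * p1) (k * p2).
Proof.
have pos (n : nat) : lg p1 p2 ^+ n = lg (n%:Z * p1) (n%:Z * p2).
  elim: n => [|n IH]; first by rewrite !mul0r lens_gen0.
  by rewrite exprS IH -[LHS]/(_ *m _) lens_genM intS !mulrDl !mul1r.
case: k => n; first exact: pos.
rewrite /exprz pos; set A := lg _ _; set B := lg _ _.
have AB : A *m B = 1%:M.
  by rewrite lens_genM NegzE !mulNr !subrr lens_gen0.
have [uA _] := mulmx1_unit AB.
by rewrite -[RHS](mulKr uA) [X in _ * X]AB mulr1.
Qed.

Lemma lens_groupP p1 p2 g : lens_group R q p1 p2 g <->
  exists k : int, g = lg (k * p1) (k * p2).
Proof.
split=> [[k _ <-]|[k ->]]; first by exists k; rewrite lens_genX.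
by exists k => //; rewrite lens_genX.
Qed.

Definition angle (p : int) : R := 2 * pi * (p%:~R / q%:R).

Lemma lens_genE p1 p2 (y : V) :
  [/\ (lg p1 p2 *m y) 0 0 = cos (angle p1) * y 0 0 + sin (angle p1) * y 1 0,
      (lg p1 p2 *m y) 1 0 = - sin (angle p1) * y 0 0 + cos (angle p1) * y 1 0,
      (lg p1 p2 *m y) 2%:R 0 = cos (angle p2) * y 2%:R 0 + sin (angle p2) * y 3%:R 0 &
      (lg p1 p2 *m y) 3%:R 0 = - sin (angle p2) * y 2%:R 0 + cos (angle p2) * y 3%:R 0].
Proof.
have blk (A B : 'M[R]_2) (z : 'cV[R]_(2 + 2)) :
    block_mx A 0 0 B *m z = col_mx (A *m usubmx z) (B *m dsubmx z).
  by rewrite -[z in LHS]vsubmxK mul_block_col !mul0mx addr0 add0r.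
have E : lg p1 p2 *m y = col_mx (rot2 (p1%:~R / q%:R) *m usubmx (y : 'cV_(2 + 2)))
   (rot2 (p2%:~R / q%:R) *m dsubmx (y : 'cV_(2 + 2))) := blk _ _ y.
have row0 th (z : 'cV[R]_2) : (rot2 th *m z) 0 0 =
    cos (2 * pi * th) * z 0 0 + sin (2 * pi * th) * z 1 0.
  rewrite !mxE !big_ord_recl big_ord0 !mxE /= addr0.
  by rewrite (_ : lift ord0 ord0 = 1) //; exact/val_inj.
have row1 th (z : 'cV[R]_2) : (rot2 th *m z) 1 0 =
    - sin (2 * pi * th) * z 0 0 + cos (2 * pi * th) * z 1 0.
  rewrite !mxE !big_ord_recl big_ord0 !mxE /= addr0.
  by rewrite (_ : lift ord0 ord0 = 1) //; exact/val_inj.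
have up (z : V) (i : 'I_4) (i' : 'I_2) : val i = val i' -> usubmx (z : 'cV_(2 + 2)) i' 0 = z i 0.
  by move=> ii; rewrite mxE; congr (z _ 0); exact/val_inj.
have dn (z : V) (i : 'I_4) (i' : 'I_2) : val i = (2 + val i')%N ->
    dsubmx (z : 'cV_(2 + 2)) i' 0 = z i 0.
  by move=> ii; rewrite mxE; congr (z _ 0); exact/val_inj.
have Eu : usubmx (lg p1 p2 *m y : 'cV_(2 + 2)) = rot2 (p1%:~R / q%:R) *m usubmx (y : 'cV_(2 + 2)).
  by rewrite E col_mxKu.
have Ed : dsubmx (lg p1 p2 *m y : 'cV_(2 + 2)) = rot2 (p2%:~R / q%:R) *m dsubmx (y : 'cV_(2 + 2)).
  by rewrite E col_mxKd.
split.
- by rewrite -(up (lg p1 p2 *m y) 0 0 erefl) Eu row0 (up _ 0 0 erefl) (up _ 1 1 erefl).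
- by rewrite -(up (lg p1 p2 *m y) 1 1 erefl) Eu row1 (up _ 0 0 erefl) (up _ 1 1 erefl).
- by rewrite -(dn (lg p1 p2 *m y) 2%:R 0 erefl) Ed row0 (dn _ 2%:R 0 erefl) (dn _ 3%:R 1 erefl).
- by rewrite -(dn (lg p1 p2 *m y) 3%:R 1 erefl) Ed row1 (dn _ 2%:R 0 erefl) (dn _ 3%:R 1 erefl).
Qed.

End LensAction.

Section LensInvariants.
Variable R : realType.
Local Notation C := (R[i]).
Local Notation V := 'cV[R]_4.
Variables (q : nat) (p1 p2 : int).
Local Notation lg := (lens_gen R q).
Local Notation turn := (turn R q).
Local Notation G := (lens_group R q p1 p2).

Lemma turnN p : turn (- p) = Complex (cos (angle R q p)) (sin (angle R q p)).
Proof. by rewrite /turn /cexp /angle intrN mulNr mulrN cosN sinN opprK. Qed.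

Lemma z1_lens a b y : z1 (lg a b *m y) = turn a * z1 y.
Proof.
rewrite /z1; case: (lens_genE q a b y) => -> -> _ _; rewrite /turn /cexp -/(angle R q a).
by apply/eqP; rewrite eq_complex /=; apply/andP; split; apply/eqP; ring.
Qed.

Lemma z1b_lens a b y : z1b (lg a b *m y) = turn (- a) * z1b y.
Proof.
rewrite /z1b; case: (lens_genE q a b y) => -> -> _ _; rewrite turnN.
by apply/eqP; rewrite eq_complex /=; apply/andP; split; apply/eqP; ring.
Qed.

Lemma z2_lens a b y : z2 (lg a b *m y) = turn b * z2 y.
Proof.
rewrite /z2; case: (lens_genE q a b y) => _ _ -> ->; rewrite /turn /cexp -/(angle R q b).
by apply/eqP; rewrite eq_complex /=; apply/andP; split; apply/eqP; ring.
Qed.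

Lemma z2b_lens a b y : z2b (lg a b *m y) = turn (- b) * z2b y.
Proof.
rewrite /z2b; case: (lens_genE q a b y) => _ _ -> ->; rewrite turnN.
by apply/eqP; rewrite eq_complex /=; apply/andP; split; apply/eqP; ring.
Qed.

(** The rotation with parameters [a] and [b] multiplies the monomial by [turn] of this integer. *)
Definition weight (a b : int) (m : mexp) : int :=
  (m.1.1%:Z - m.1.2%:Z) * a + (m.2.1%:Z - m.2.2%:Z) * b.

Lemma weight_scale k a b m : weight (k * a) (k * b) m = k * weight a b m.
Proof. by rewrite /weight; ring. Qed.

Lemma monom_lens a b m y : monom m (lg a b *m y) = turn (weight a b m) * monom m y.
Proof.
rewrite /monom /mono z1_lens z1b_lens z2_lens z2b_lens !exprMn !turnX.
rewrite (_ : weight a b m = a * m.1.1%:Z + - a * m.1.2%:Z + (b * m.2.1%:Z + - b * m.2.2%:Z)).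
  by rewrite !turnD; ring.
by rewrite /weight; ring.
Qed.

Lemma monom_scale m (t : R) (y : V) : monom m (t *: y) = real_complex R t ^+ mdeg m * monom m y.
Proof.
have zt (u v : R) : zc (t * u) (t * v) = real_complex R t * zc u v.
  by apply/eqP; rewrite eq_complex /=; apply/andP; split; apply/eqP; ring.
rewrite /monom /mono /z1 /z1b /z2 /z2b !mxE -!mulrN !zt !exprMn /mdeg !exprD; ring.
Qed.

Lemma lens_group1 : G 1%:M.
Proof. by apply/lens_groupP; exists 0; rewrite !mul0r lens_gen0. Qed.

Lemma lens_groupM g h : G g -> G h -> G (g *m h).
Proof.
move=> /lens_groupP[k ->] /lens_groupP[k' ->].
by apply/lens_groupP; exists (k + k'); rewrite lens_genM !mulrDl.
Qed.

Lemma lens_groupV g : G g -> exists2 h, G h & h *m g = 1%:M.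
Proof.
move=> /lens_groupP[k ->]; exists (lg (- k * p1) (- k * p2)).
  by apply/lens_groupP; exists (- k).
by rewrite lens_genM !mulNr !addNr lens_gen0.
Qed.

Lemma dotv4 (y z : V) : dotv y z =
  y 0 0 * z 0 0 + y 1 0 * z 1 0 + (y 2%:R 0 * z 2%:R 0 + y 3%:R 0 * z 3%:R 0).
Proof.
rewrite /dotv !big_ord_recl big_ord0 addr0 !addrA.
by congr (_ + _ + _ + _); congr (_ * _); congr (_ _ _); exact/val_inj.
Qed.

Lemma lens_gen_dotv a b (y z : V) : dotv (lg a b *m y) (lg a b *m z) = dotv y z.
Proof.
rewrite !dotv4; case: (lens_genE q a b y) => -> -> -> ->.
case: (lens_genE q a b z) => -> -> -> ->.
have A := cos2Dsin2 (angle R q a); have B := cos2Dsin2 (angle R q b).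
have -> : y 0 0 * z 0 0 + y 1 0 * z 1 0 + (y 2%:R 0 * z 2%:R 0 + y 3%:R 0 * z 3%:R 0) =
  (cos (angle R q a) ^+ 2 + sin (angle R q a) ^+ 2) * (y 0 0 * z 0 0 + y 1 0 * z 1 0) +
  (cos (angle R q b) ^+ 2 + sin (angle R q b) ^+ 2) * (y 2%:R 0 * z 2%:R 0 + y 3%:R 0 * z 3%:R 0).
  by rewrite A B !mul1r.
by ring.
Qed.

Lemma lens_group_dotv g : G g -> forall y z : V, dotv (g *m y) (g *m z) = dotv y z.
Proof. by move=> /lens_groupP[k ->] y z; exact: lens_gen_dotv. Qed.

End LensInvariants.

(** * Eigenfunctions counted by invariant monomials *)

Section SpectrumCount.
Variable R : realType.
Local Notation C := (R[i]).
Local Notation V := 'cV[R]_4.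
Local Notation S3 := (sphere3 R).

Lemma ffree_complex (T : Type) (I : finType) (b : I -> T -> R) :
  ffree b -> ffree (fun i t => real_complex R (b i t)).
Proof.
move=> fb c c0 i.
have ReE t : complex.Re (\sum_j c j * real_complex R (b j t)) = \sum_j complex.Re (c j) * b j t.
  rewrite raddf_sum; apply: eq_bigr => j _.
  by case: (c j) => u v /=; rewrite mulr0 subr0.
have ImE t : complex.Im (\sum_j c j * real_complex R (b j t)) = \sum_j complex.Im (c j) * b j t.
  rewrite raddf_sum; apply: eq_bigr => j _.
  by case: (c j) => u v /=; rewrite mulr0 add0r.
apply/eqP; rewrite eq_complex /=; apply/andP; split; apply/eqP.
  by apply: (fb (fun j => complex.Re (c j))) => t; rewrite -ReE c0.
by apply: (fb (fun j => complex.Im (c j))) => t; rewrite -ImE c0.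
Qed.

(** Exponents below [K] as a finite type; in degree [k] the bound [k + 1] suffices. *)
Definition box (K : nat) := ('I_K * 'I_K * ('I_K * 'I_K))%type.

Definition box_mexp K (m : box K) : mexp := (m.1.1 : nat, m.1.2 : nat, (m.2.1 : nat, m.2.2 : nat)).

Lemma box_surj (m : mexp) k : mdeg m = k -> exists m' : box k.+1, box_mexp m' = m.
Proof.
case: m => -[a b] [c d]; rewrite /mdeg /= => E.
exists (inord a, inord b, (inord c, inord d)); rewrite /box_mexp /=.
by rewrite !inordK // ltnS -E; lia.
Qed.

Lemma box_mexp_inj K : injective (@box_mexp K).
Proof.
by move=> [[a b] [c d]] [[a' b'] [c' d']] [] /val_inj -> /val_inj -> /val_inj -> /val_inj ->.
Qed.

Lemma ffree_box K : ffree (fun (m : box K) (y : V) => monom (box_mexp m) y).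
Proof. exact: ffree_mono4. Qed.

Lemma mspan_box k F : mspan k F -> exists c : box k.+1 -> C,
  (forall m, mdeg (box_mexp m) != k -> c m = 0) /\
  forall y, F y = \sum_m c m * monom (box_mexp m) y :> C.
Proof.
move=> [s [/allP sk sF]].
exists (fun m => \sum_(cm <- s | cm.2 == box_mexp m) cm.1); split=> [m mk|y].
  rewrite big_seq_cond big1 // => cm /andP[/sk /eqP cmk /eqP E].
  by move: mk; rewrite -E cmk eqxx.
rewrite sF; under [RHS]eq_bigr do rewrite mulr_suml.
rewrite (exchange_big_dep xpredT) //= big_seq [RHS]big_seq; apply: eq_bigr => cm /sk /eqP cmk.
have [m mE] := box_surj cmk.
rewrite (eq_bigl (pred1 m)) ?big_pred1_eq ?mE // => m' /=.
by rewrite -mE (inj_eq (@box_mexp_inj _)) eq_sym.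
Qed.

Lemma polar (y : V) : exists t (x : S3), y = t *: val x.
Proof.
have [->|y0] := eqVneq y 0; first by exists 0, (base_point R); rewrite scale0r.
exists (enorm y), (radial y); rewrite val_radial // scalerA divff ?scale1r //.
by rewrite gt_eqF // enorm_gt0.
Qed.

Variables (q : nat) (q_gt0 : (0 < q)%N) (p1 p2 : int).
Local Notation G := (lens_group R q p1 p2).
Local Notation Q := (quotient3 G).

Definition invariant_exps k := [pred m : box k.+1 |
  (mdeg (box_mexp m) == k) && (q%:Z %| weight p1 p2 (box_mexp m))%Z].

Local Notation W k := {m : box k.+1 | m \in invariant_exps k}.

Definition wmonom k (m : W k) (x : S3) : C := monom (box_mexp (val m)) (val x).

(** All these monomials have degree [k], so a relation on the sphere extends to R^4. *)
Lemma ffree_wmonom k : ffree (@wmonom k).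
Proof.
have F := ffree_comp_inj (@val_inj _ _ (W k)) (@ffree_box k.+1).
move=> c c0; apply: F => y; have [t [x ->]] := polar y.
have := congr1 (fun z => real_complex R t ^+ k * z) (c0 x).
rewrite mulr0 mulr_sumr => E; rewrite -[RHS]E; apply: eq_bigr => m _.
have := valP m; rewrite inE => /andP[/eqP mk _].
by rewrite /= monom_scale mk mulrCA.
Qed.

Lemma hpoly_wmonom k p : hpoly k p -> invariant_fun G p ->
  fspan (@wmonom k) (fun x => real_complex R (p (val x))).
Proof.
move=> /hpoly_mspan /mspan_box [c [ck cE]] ip.
have c0 m : m \notin invariant_exps k -> c m = 0.
  rewrite inE negb_and => /orP[/ck //|wm].
  (* Subtracting [p] from its translate by the generator multiplies each coefficient by [turn] of
     the weight minus 1, which is nonzero for a monomial that is not invariant. *)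
  have : c m * (turn R q (weight p1 p2 (box_mexp m)) - 1) = 0.
    apply: (@ffree_box k.+1 (fun m => c m * (turn R q (weight p1 p2 (box_mexp m)) - 1))) => y.
    have Gg : G (lens_gen R q p1 p2).
      by apply/lens_groupP; exists 1; rewrite !mul1r.
    have := ip _ y Gg => /(congr1 (real_complex R)); rewrite !cE => /eqP.
    rewrite -subr_eq0 -sumrB => /eqP E; rewrite -[RHS]E; apply: eq_bigr => m' _.
    by rewrite monom_lens; ring.
  by move/eqP; rewrite mulf_eq0 subr_eq0 turn_eq1 // (negPf wm) orbF => /eqP.
exists (fun m => c (val m)) => x; rewrite cE.
rewrite (bigID (mem (invariant_exps k))) /= [X in _ + X]big1 ?addr0; last first.
  by move=> m /c0 ->; rewrite mul0r.
exact: big_sub.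
Qed.

Let G1 : G 1%:M := lens_group1 R q p1 p2.
Let GM := @lens_groupM R q p1 p2.
Let GV := @lens_groupV R q p1 p2.
Let GO := @lens_group_dotv R q p1 p2.

(** Eigenfunctions lift to invariant polynomials, which finitely many invariant monomials span over
    the complex numbers. *)
Lemma eigenspace_dim k : exists n, has_dim (eigenspace3 G (eigval R k)) n.
Proof.
apply: (@has_dim_exists _ _ _ #|{: W k}|) => n b bE bf; rewrite -{1}(card_ord n).
have fb : ffree (fun (i : 'I_n) (x : S3) => real_complex R (b i (proj3 G x))).
  apply: ffree_complex => c c0; apply: bf => a.
  by have [x <-] := proj3_surj a; exact: c0.
apply: (ffree_le_span fb) => i.
have /(eigenspaceP GM GV GO)[p [pp ip _ bp]] := bE i.
have [c cE] := hpoly_wmonom pp ip; exists c => x; by rewrite bp cE.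
Qed.

Variables (e : nat -> nat) (b : forall k, 'I_(e k) -> Q -> R).
Hypotheses (bE : forall k i, eigenspace3 G (eigval R k) (b (k := k) i))
  (bfree : forall k, ffree (@b k))
  (bspan : forall k f, eigenspace3 G (eigval R k) f -> fspan (@b k) f).

Local Notation T k := {j : 'I_(k./2.+1) & 'I_(e (k - j.*2))}.

Local Notation fibre k j i := (existT (fun j : 'I_(k./2.+1) => 'I_(e (k - j.*2)) : Type) j i).

Definition eigenfun k (t : T k) (x : S3) : R := b (tagged t) (proj3 G x).

Lemma sum_tagged k (d : T k -> R) x : \sum_t d t * eigenfun t x =
  \sum_(j < k./2.+1) \sum_i d (fibre k j i) * b i (proj3 G x).
Proof.
rewrite (sig_big_dep xpredT (fun _ => xpredT) (fun j i => d (fibre k j i) * b i (proj3 G x))) /=.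
by apply: eq_bigr => -[j i] _.
Qed.

Lemma ffree_eigenfun k : ffree (@eigenfun k).
Proof.
move=> d d0 [j i]; apply: (@bfree _ (fun i => d (fibre k j i))) => a.
have kaI : injective (fun j : 'I_(k./2.+1) => k - j.*2)%N.
  by move=> j1 j2 /= E; apply: val_inj => /=; have := ltn_ord j1; have := ltn_ord j2; lia.
apply: (eigenspace_indep GM GV GO (f := fun j a => \sum_i d (fibre k j i) * b i a) kaI) => [j'|a'].
  by apply: (eigenspace_sum GM GV GO) => i'; exact: bE.
by have [x <-] := proj3_surj a'; rewrite -sum_tagged.
Qed.

Lemma invariant_eigenfun k p : hpoly k p -> invariant_fun G p -> fspan (@eigenfun k) (fun x => p (val x)).
Proof.
move=> pp ip; have [f [fE fp]] := hpoly_decomposition G1 GM GV GO pp ip.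
have fs (j : 'I_(k./2.+1)) : fspan (@b (k - j.*2)%N) (f j) := bspan (fE j (ltn_ord j)).
have [c cE] : exists c : forall j : 'I_(k./2.+1), 'I_(e (k - j.*2)) -> R,
    forall (j : 'I_(k./2.+1)) a, f j a = \sum_i c j i * b i a.
  by have /all_sig[c cE] j := cid (fs j); exists c.
exists (fun t => c (tag t) (tagged t)) => x; rewrite sum_tagged fp.
by apply: eq_bigr => j _; rewrite cE.
Qed.

Lemma eigenfun_wmonom k (t : T k) : fspan (@wmonom k) (fun x => real_complex R (eigenfun t x)).
Proof.
case: t => j i; have jk : (j.*2 <= k)%N by have := ltn_ord j; lia.
have /(eigenspaceP GM GV GO)[p [pp ip _ bp]] := bE i.
(* A power of [dotv y y], which is 1 on the sphere, raises the degree [k - 2 j] to [k]. *)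
pose P n y := dotv y y ^+ n * p y.
have P1 n : P n.+1 = fun y => dotv y y * P n y.
  by apply/funext => y; rewrite /P exprS mulrA.
have PP n : hpoly (n.*2 + (k - j.*2)) (P n).
  elim: n => [|n IH]; first by apply: hpoly_ext pp => y; rewrite /P mul1r.
  rewrite P1 doubleS !addSn; apply: hpoly_ext (hpoly_sum (fun i => hpoly_coordM i (hpoly_coordM i IH))) => y.
  by rewrite /dotv mulr_suml; apply: eq_bigr => i' _; rewrite mulrA.
have iP : invariant_fun G (P j) by move=> g y Gg; rewrite /P GO // ip.
have Pk := PP j; rewrite subnKC // in Pk.
have [c cE] := hpoly_wmonom Pk iP; exists c => x.
by rewrite -cE /P valS expr1n mul1r /eigenfun bp.
Qed.

Lemma monom_invariant k (m : W k) g y : G g -> monom (box_mexp (val m)) (g *m y) = monom (box_mexp (val m)) y.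
Proof.
move=> /lens_groupP[n ->]; have := valP m; rewrite inE => /andP[_ wm].
rewrite monom_lens weight_scale (_ : turn R q _ = 1) ?mul1r //.
by apply/eqP; rewrite turn_eq1 // dvdz_mull.
Qed.

Lemma wmonom_eigenfun k (m : W k) : fspan (fun t x => real_complex R (@eigenfun k t x)) (wmonom m).
Proof.
have [pr pi] := chpoly_monom R (box_mexp (val m)).
have mk : mdeg (box_mexp (val m)) = k by have := valP m; rewrite inE => /andP[/eqP].
rewrite mk in pr pi.
have [|c cE] := invariant_eigenfun pr; first by move=> g y Gg; rewrite monom_invariant.
have [|d dE] := invariant_eigenfun pi; first by move=> g y Gg; rewrite monom_invariant.
exists (fun t => zc (c t) (d t)) => x; apply/eqP; rewrite eq_complex raddf_sum (raddf_sum (@complex.Im R)).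
apply/andP; split; apply/eqP; [rewrite /wmonom cE|rewrite /wmonom dE]; apply: eq_bigr => t _ /=.
  by rewrite mulr0 subr0.
by rewrite mulr0 add0r.
Qed.

(* Both sides are the dimension of the space of restrictions to the sphere of
   the complex invariant homogeneous polynomials of degree k. *)
Lemma spectrum_count k : (\sum_(j < k./2.+1) e (k - j.*2) = #|invariant_exps k|)%N.
Proof.
have := ffree_span_card (ffree_complex (@ffree_eigenfun k)) (@ffree_wmonom k) (@eigenfun_wmonom k) (@wmonom_eigenfun k).
rewrite card_tagged card_sig => E; transitivity #|invariant_exps k|; last by [].
rewrite -[RHS]E sumnE big_map big_enum /=; apply: eq_bigr => j _; exact/esym/card_ord.
Qed.
End SpectrumCount.

Lemma isospectral_count (R : realType) (q : nat) (q_gt0 : (0 < q)%N) (p1 p2 s1 s2 : int) :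
  isospectral (lens_group R q p1 p2) (lens_group R q s1 s2) ->
  forall k, #|invariant_exps q p1 p2 k| = #|invariant_exps q s1 s2 k|.
Proof.
move=> iso k.
have /all_sig[e eE] j := cid (eigenspace_dim R q_gt0 p1 p2 j).
have eE' j : has_dim (eigenspace3 (lens_group R q s1 s2) (eigval R j)) (e j).
  exact: (iso _ _).1 (eE j).
have /all_sig[b bP] j := cid (eE j); have /all_sig[b' bP'] j := cid (eE' j).
transitivity (\sum_(j < k./2.+1) e (k - j.*2)%N)%N; [apply/esym|].
  apply: (@spectrum_count R q q_gt0 p1 p2 e b) => [j i|j|j f].
  - by case: (bP j) => h _ _; exact: h.
  - by case: (bP j) => _ h _; exact: h.
  - by case: (bP j) => _ _ h; exact: h.
apply: (@spectrum_count R q q_gt0 s1 s2 e b') => [j i|j|j f].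
- by case: (bP' j) => h _ _; exact: h.
- by case: (bP' j) => _ h _; exact: h.
- by case: (bP' j) => _ _ h; exact: h.
Qed.

(** * From multiplicities to counts of lattice points *)

Section LatticeCounts.
Variables (q : nat) (p1 p2 : int).

Definition exps k : seq mexp := [seq box_mexp m | m <- enum (invariant_exps q p1 p2 k)].

Lemma uniq_exps k : uniq (exps k).
Proof. by rewrite map_inj_uniq ?enum_uniq //; exact: box_mexp_inj. Qed.

Lemma mem_exps k m : (m \in exps k) = (mdeg m == k) && (q%:Z %| weight p1 p2 m)%Z.
Proof.
apply/mapP/andP => [[m' m'E ->]|[/eqP mk wm]].
  by move: m'E; rewrite mem_enum inE => /andP.
have [m' E] := box_surj mk; exists m' => //.
by rewrite mem_enum inE E mk eqxx.
Qed.

Lemma size_exps k : size (exps k) = #|invariant_exps q p1 p2 k|.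
Proof. by rewrite size_map -cardE. Qed.

(** [sh] is a bijection from the invariant exponents of degree [k] onto those of degree [k + 2] that
    satisfy [Pos]. *)
Lemma count_exps_shift (Pos P : pred mexp) (sh : mexp -> mexp) k : injective sh ->
  (forall m, mdeg (sh m) = (mdeg m).+2) ->
  (forall m, weight p1 p2 (sh m) = weight p1 p2 m) ->
  (forall m, Pos (sh m)) -> (forall m, Pos m -> exists m', m = sh m') ->
  count (predI P Pos) (exps k.+2) = count (P \o sh) (exps k).
Proof.
move=> shI shk shw pos surj; rewrite -count_filter -(count_map sh P).
suff /seq.permP : perm_eq [seq m <- exps k.+2 | Pos m] [seq sh m | m <- exps k] by apply.
apply: uniq_perm; first exact/filter_uniq/uniq_exps.
  by rewrite map_inj_uniq ?uniq_exps.
move=> m; rewrite mem_filter mem_exps; apply/andP/mapP => [[/surj[m' ->]]|[m' m'E ->]].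
  by rewrite shk shw !eqSS -mem_exps => m'E; exists m'.
by rewrite pos shk shw !eqSS -mem_exps.
Qed.

End LatticeCounts.

Definition pos1 : pred mexp := fun m => (0 < m.1.1)%N && (0 < m.1.2)%N.
Definition pos2 : pred mexp := fun m => (0 < m.2.1)%N && (0 < m.2.2)%N.

(* Multiplication by z1 conj(z1), or by z2 conj(z2), preserves the weight and
   raises the degree by two. Cancelling its image leaves the monomials without
   such factors, which are the points of the lattice. *)
Section CountTransfer.
Variables (q : nat) (p1 p2 s1 s2 : int).
Hypothesis cardE : forall k, #|invariant_exps q p1 p2 k| = #|invariant_exps q s1 s2 k|.

Let sh1 (m : mexp) : mexp := ((m.1.1.+1, m.1.2.+1), m.2).
Let sh2 (m : mexp) : mexp := (m.1, (m.2.1.+1, m.2.2.+1)).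

Let shift1 r1 r2 P k :
  count (predI P pos1) (exps q r1 r2 k.+2) = count (P \o sh1) (exps q r1 r2 k).
Proof.
apply: count_exps_shift => //.
- by move=> [[a b] cd] [[a' b'] cd'] [-> -> ->].
- by move=> [[a b] [c d]]; rewrite /mdeg /=; lia.
- by move=> [[a b] [c d]]; rewrite /weight /=; congr (_ * _ + _); lia.
- by move=> [[[|a] [|b]] cd] //= _; exists ((a, b), cd).
Qed.

Let shift2 r1 r2 P k :
  count (predI P pos2) (exps q r1 r2 k.+2) = count (P \o sh2) (exps q r1 r2 k).
Proof.
apply: count_exps_shift => //.
- by move=> [ab [c d]] [ab' [c' d']] [-> -> ->].
- by move=> [[a b] [c d]]; rewrite /mdeg /=; lia.
- by move=> [[a b] [c d]]; rewrite /weight /=; congr (_ + _ * _); lia.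
- by move=> [ab [[|c] [|d]]] //= _; exists (ab, (c, d)).
Qed.

Let low r1 r2 P k (Pos : pred mexp) : (k < 2)%N -> (forall m, Pos m -> (2 <= mdeg m)%N) ->
  count (predI P Pos) (exps q r1 r2 k) = 0%N.
Proof.
move=> k2 Pk; apply/eqP; rewrite -leqn0 leqNgt -has_count -all_predC.
apply/allP => m; rewrite mem_exps => /andP[/eqP mk _] /=.
by apply/negP => /andP[_ /Pk]; rewrite mk leqNgt k2.
Qed.

Let pos1_deg m : pos1 m -> (2 <= mdeg m)%N. Proof. by rewrite /pos1 /mdeg; lia. Qed.
Let pos2_deg m : pos2 m -> (2 <= mdeg m)%N. Proof. by rewrite /pos2 /mdeg; lia. Qed.

Let count1 k : count (predC pos1) (exps q p1 p2 k) = count (predC pos1) (exps q s1 s2 k).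
Proof.
have E : count (predI predT pos1) (exps q p1 p2 k) = count (predI predT pos1) (exps q s1 s2 k).
  case: k => [|[|k]]; last by rewrite !shift1 !count_predT !size_exps.
    by rewrite !low //; exact: pos1_deg.
  by rewrite !low //; exact: pos1_deg.
have := count_predC pos1 (exps q p1 p2 k); have := count_predC pos1 (exps q s1 s2 k).
rewrite !size_exps cardE => <- /eqP.
by rewrite [count pos1 _]E eqn_add2l => /eqP.
Qed.

(** Exponents in [pos1] are removed by [count1]; among the others, those in [pos2] correspond to
    exponents outside [pos1] two degrees lower. *)
Lemma count_reduced k :
  count (predI (predC pos1) (predC pos2)) (exps q p1 p2 k) =
  count (predI (predC pos1) (predC pos2)) (exps q s1 s2 k).
Proof.
have E : count (predI (predC pos1) pos2) (exps q p1 p2 k) =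
    count (predI (predC pos1) pos2) (exps q s1 s2 k).
  case: k => [|[|k]]; last by rewrite !shift2; exact: count1.
    by rewrite !low //; exact: pos2_deg.
  by rewrite !low //; exact: pos2_deg.
have split r1 r2 : count (predC pos1) (exps q r1 r2 k) =
    (count (predI (predC pos1) pos2) (exps q r1 r2 k) +
     count (predI (predC pos1) (predC pos2)) (exps q r1 r2 k))%N.
  rewrite -!count_filter -[LHS]size_filter -(count_predC pos2).
  by rewrite !count_filter; congr (_ + _)%N; apply: eq_count => m /=; rewrite andbC.
by have := split p1 p2; rewrite count1 split E => /addnI.
Qed.

End CountTransfer.

(** * The lattice of invariant reduced monomials *)

Section LensLattice.
Variable q : nat.

(* The coordinates a + b and a - b turn the 1-norm |a| + |b|, which is the degree
   of a reduced monomial, into the sup norm. *)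
Definition lens_lattice (p1 p2 : int) (X Y : Z) : Prop := exists a b : int,
  [/\ X = Z_of_int (a + b), Y = Z_of_int (a - b) & (q%:Z %| a * p1 + b * p2)%Z].

Definition lattice_point (m : mexp) : Z * Z :=
  let a := m.1.1%:Z - m.1.2%:Z in let b := m.2.1%:Z - m.2.2%:Z in
  (Z_of_int (a + b), Z_of_int (a - b)).

Definition reduced (m : mexp) : bool := ~~ pos1 m && ~~ pos2 m.

(** The larger of [|a + b|] and [|a - b|] is [|a| + |b|], and no cancellation occurs in the
    exponents of a reduced monomial. *)
Lemma supn_lattice_point m : reduced m ->
  supn (lattice_point m).1 (lattice_point m).2 = Z.of_nat (mdeg m).
Proof. by case: m => [[a b] [c d]]; rewrite /reduced /pos1 /pos2 /mdeg /supn /=; lia. Qed.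

Lemma lattice_point_inj m m' : reduced m -> reduced m' -> lattice_point m = lattice_point m' -> m = m'.
Proof.
case: m m' => [[a b] [c d]] [[a' b'] [c' d']]; rewrite /reduced /pos1 /pos2 /= => r r' [E1 E2].
by congr (_, _, (_, _)); lia.
Qed.

Lemma lattice_point_surj (a b : int) : exists m : mexp, [/\ reduced m,
  m.1.1%:Z - m.1.2%:Z = a, m.2.1%:Z - m.2.2%:Z = b &
  lattice_point m = (Z_of_int (a + b), Z_of_int (a - b))].
Proof.
pose pa (a : int) := if a is Posz n then n else 0%N.
pose na (a : int) := if a is Negz n then n.+1 else 0%N.
have paE c : (pa c)%:Z - (na c)%:Z = c by rewrite /pa /na; case: c; lia.
exists ((pa a, na a), (pa b, na b)); split; rewrite /= ?paE //.
  by rewrite /reduced /pos1 /pos2 /pa /na /=; case: (a) => ?; case: (b) => ?; rewrite /= ?andbF.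
by rewrite /lattice_point /= !paE.
Qed.

Lemma In_map_mem (T : eqType) (S : Type) (f : T -> S) (s : seq T) y :
  In y (map f s) <-> exists2 x, x \in s & f x = y.
Proof.
elim: s => [|x s IH]; first by split=> // -[].
split=> [[<-|/IH[z zs <-]]|[z]]; first by exists x => //; rewrite mem_head.
  by exists z => //; rewrite in_cons zs orbT.
by rewrite in_cons => /orP[/eqP -> <-|zs fz]; [left|right; apply/IH; exists z].
Qed.

Lemma NoDup_map_uniq (T : eqType) (S : Type) (f : T -> S) (s : seq T) :
  uniq s -> {in s &, injective f} -> NoDup (map f s).
Proof.
elim: s => [|x s IH] /= => [_ _|/andP[xs us] fI]; first exact: NoDup_nil.
apply: NoDup_cons; last first.
  by apply: IH => // y z ys zs; apply: fI; rewrite in_cons ?ys ?zs orbT.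
move=> /In_map_mem[y ys /fI E]; move/negP: xs; apply.
by rewrite -E ?mem_head // in_cons ys orbT.
Qed.

Lemma lens_lattice_count (p1 p2 : int) (s : seq mexp) (r : nat) :
  uniq s -> (forall m, (m \in s) = [&& reduced m, (mdeg m <= r)%N & (q%:Z %| weight p1 p2 m)%Z]) ->
  NoDup (map lattice_point s) /\
  forall X Y, In (X, Y) (map lattice_point s) <-> lens_lattice p1 p2 X Y /\ Z.le (supn X Y) (Z.of_nat r).
Proof.
move=> us sE; split=> [|X Y].
  apply: NoDup_map_uniq => // m m'; rewrite !sE => /andP[rm _] /andP[rm' _].
  exact: lattice_point_inj.
rewrite In_map_mem; split=> [[m]|[[a [b [-> -> ab]]] XYr]].
  rewrite sE => /and3P[rm mr wm] E; split.
    by exists (m.1.1%:Z - m.1.2%:Z), (m.2.1%:Z - m.2.2%:Z); case: E => <- <-.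
  have := supn_lattice_point rm; rewrite E /= => ->; lia.
have [m [rm am bm mE]] := lattice_point_surj a b; exists m; rewrite // sE rm /=.
have := supn_lattice_point rm; rewrite mE /= => Er.
by rewrite /weight am bm ab andbT; lia.
Qed.

Lemma same_count_lens (p1 p2 s1 s2 : int) :
  (forall k, #|invariant_exps q p1 p2 k| = #|invariant_exps q s1 s2 k|) ->
  same_count supn supn (lens_lattice p1 p2) (lens_lattice s1 s2).
Proof.
move=> cardE r.
have [r0|r0] := Z.neg_nonneg_cases r.
  exists nil, nil; split; [|split] => //; split; try exact: NoDup_nil.
    by move=> X Y; split=> // -[_]; rewrite /supn; lia.
  by move=> X Y; split=> // -[_]; rewrite /supn; lia.
rewrite -(Z2Nat.id r r0); move: (Z.to_nat r) => {r r0} r.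
pose ok r t1 t2 (s : seq mexp) := uniq s /\ forall m,
  (m \in s) = [&& reduced m, (mdeg m <= r)%N & (q%:Z %| weight t1 t2 m)%Z].
suff [s [s' [sP s'P ss]]] : exists s s', [/\ ok r p1 p2 s, ok r s1 s2 s' & size s = size s'].
  have [us sE] := sP; have [us' s'E] := s'P.
  exists (map lattice_point s), (map lattice_point s'); split; [|split].
  - exact: lens_lattice_count us sE.
  - exact: lens_lattice_count us' s'E.
  - by have := ss; rewrite -[LHS](size_map lattice_point) -[RHS](size_map lattice_point).
(* The list for the ball of radius [r + 1] is that of radius [r] followed by the reduced monomials
   of degree [r + 1]. *)
pose layer t1 t2 k := [seq m <- exps q t1 t2 k | reduced m].
have layer_size k : size (layer p1 p2 k) = size (layer s1 s2 k).
  by rewrite !size_filter; exact: count_reduced.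
have mem_layer t1 t2 k m : (m \in layer t1 t2 k) =
    [&& reduced m, mdeg m == k & (q%:Z %| weight t1 t2 m)%Z].
  by rewrite mem_filter mem_exps.
have layer_uniq t1 t2 k : uniq (layer t1 t2 k) by exact/filter_uniq/uniq_exps.
have ok0 t1 t2 : ok 0%N t1 t2 (layer t1 t2 0%N).
  by split=> // m; rewrite mem_layer leqn0.
have okS k t1 t2 s : ok k t1 t2 s -> ok k.+1 t1 t2 (s ++ layer t1 t2 k.+1).
  move=> [us sE]; split=> [|m].
    rewrite cat_uniq us layer_uniq andbT /=; apply/hasPn => m.
    rewrite mem_layer sE => /and3P[_ /eqP -> _]; by rewrite ltnn andbF.
  rewrite mem_cat sE mem_layer (leq_eqVlt _ k.+1) ltnS.
  by case: reduced; case: (_ <= _)%N; case: (_ == _); case: (_ %| _)%Z.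
elim: r => [|r [s [s' [sP s'P ss]]]].
  by exists (layer p1 p2 0%N), (layer s1 s2 0%N); split; rewrite ?layer_size //; exact: ok0.
exists (s ++ layer p1 p2 r.+1), (s' ++ layer s1 s2 r.+1).
by split; [exact: okS|exact: okS|rewrite !size_cat ss layer_size].
Qed.

End LensLattice.

(** * A basis of the lattice *)

Section LatticeRigidity.
Variables (q : nat) (q_gt0 : (0 < q)%N).
Local Notation L := (lens_lattice q).

(** In the coordinates [(a, b)] a basis is [(q', 0)], [(- p2 u, g)]: as [g] divides [p1] and [q] and
    is coprime to [p2], it divides every [b]. The determinant [q' g = q] is doubled by passing to
    [a + b], [a - b]. *)
Lemma lens_lattice_basis (p1 p2 : int) : gcdz (gcdz p1 p2) q%:Z = 1 ->
  exists u1 u2 v1 v2 : Z,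
    Z.abs (Z.sub (Z.mul u1 v2) (Z.mul u2 v1)) = Z.mul (Zpos 2) (Z.of_nat q) /\
    forall X Y, L p1 p2 X Y <-> Lat u1 u2 v1 v2 X Y.
Proof.
move=> cop; set g := gcdz p1 q%:Z.
have [p1' p1E] : exists p1', p1 = p1' * g by apply/dvdzP/dvdz_gcdl.
have [q' qE] : exists q', q%:Z = q' * g by apply/dvdzP/dvdz_gcdr.
have g0 : g != 0 by apply/eqP => g0; move: qE; rewrite g0; lia.
have [u [v uv]] : exists u v, u * p1' + v * q' = 1.
  have [u [v E]] := Bezoutz p1 q%:Z; exists u, v; apply: (mulIf g0).
  by rewrite mul1r mulrDl -!mulrA -p1E -qE.
have gp2 : coprimez g p2 by rewrite /coprimez /g -gcdzA (gcdzC q%:Z) gcdzA cop.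
move: g p1E qE g0 gp2 => {}g p1E qE g0 gp2.
exists (Z_of_int q'), (Z_of_int q'), (Z_of_int (- p2 * u + g)), (Z_of_int (- p2 * u - g)).
split.
  have -> : Z.of_nat q = Z_of_int (q' * g) by rewrite -qE.
  have q'g : 0 < q' * g by rewrite -qE.
  lia.
move=> X Y; split=> [[a [b [-> -> /dvdzP[k kE]]]]|[n [m [XE YE]]]].
  have [n nE] : exists n, b = n * g.
    apply/dvdzP; rewrite -(Gauss_dvdzr _ gp2) mulrC; apply/dvdzP.
    by exists (k * q' - a * p1'); rewrite mulrBl -mulrA -qE -kE -mulrA -p1E; ring.
  have kE' : a * p1' + n * p2 = k * q'.
    by apply: (mulIf g0); rewrite -(mulrA k) -qE -kE nE p1E; ring.
  have aE : a = (a * v + u * k) * q' + n * (- p2 * u).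
    have -> : (a * v + u * k) * q' = a * (v * q') + u * (k * q') by ring.
    rewrite -kE' (_ : v * q' = 1 - u * p1'); first by ring.
    by rewrite -uv; ring.
  exists (Z_of_int (a * v + u * k)), (Z_of_int n); move: (a * v + u * k) aE => t ->.
  by rewrite nE; split; lia.
exists (int_of_Z n * q' + int_of_Z m * (- p2 * u)), (int_of_Z m * g); split; [lia|lia|].
apply/dvdzP; exists (int_of_Z n * p1' + int_of_Z m * p2 * v).
rewrite qE p1E; apply/eqP; rewrite -subr_eq0; set d := (X in X == 0).
have -> : d = int_of_Z m * p2 * g * (1 - (u * p1' + v * q')) by rewrite /d; ring.
by rewrite uv subrr mulr0.
Qed.

Lemma lens_lattice_rigidity (p1 p2 s1 s2 : int) :
  gcdz (gcdz p1 p2) q%:Z = 1 -> gcdz (gcdz s1 s2) q%:Z = 1 ->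
  same_count supn supn (L p1 p2) (L s1 s2) -> D4eq (L p1 p2) (L s1 s2).
Proof.
move=> /lens_lattice_basis[u1 [u2 [v1 [v2 [du uE]]]]].
move=> /lens_lattice_basis[w1 [w2 [z1 [z2 [dw wE]]]]] sc.
apply: D4eq_trans (D4_ext uE) _; apply: D4eq_trans (_ : D4eq (Lat w1 w2 z1 z2) _); last first.
  by apply: D4_ext => X Y; apply: iff_sym; exact: wE.
apply: plane_lattice_rigidity; [lia|by rewrite du dw|].
move=> r; have [l [l' [[dl lE] [[dl' l'E] ll]]]] := sc r.
exists l, l'; split; [|split] => //; split=> // X Y; first by rewrite lE uE.
by rewrite l'E wE.
Qed.

End LatticeRigidity.

(** * Conjugate groups *)

Section OrthogonalConjugation.
Variable R : realType.
Local Notation V := 'cV[R]_4.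
Local Notation S3 := (sphere3 R).
Implicit Types G : set 'M[R]_4.

Definition ortho_conj G G' : Prop := exists A : 'M[R]_4,
  [/\ A^T *m A = 1%:M, forall g, G g -> G' (A *m g *m A^T) &
      forall g, G' g -> G (A^T *m g *m A)].

Lemma ortho_conj_refl G : ortho_conj G G.
Proof. by exists 1%:M; split=> [|g|g]; rewrite trmx1 ?mulmx1 ?mul1mx. Qed.

Lemma ortho_conj_trans G1 G2 G3 : ortho_conj G1 G2 -> ortho_conj G2 G3 -> ortho_conj G1 G3.
Proof.
move=> [A [A1 Ag gA]] [B [B1 Bg gB]]; exists (B *m A); split=> [|g /Ag/Bg|g /gB/gA].
- by rewrite trmx_mul mulmxA -(mulmxA A^T) B1 mulmx1.
- by rewrite trmx_mul !mulmxA.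
- by rewrite trmx_mul !mulmxA.
Qed.

Lemma dotv_trmx (y z : V) : dotv y z = (y^T *m z) 0 0.
Proof. by rewrite mxE; apply: eq_bigr => i _; rewrite mxE. Qed.

Lemma dotv_ortho (A : 'M[R]_4) (y z : V) : A^T *m A = 1%:M ->
  dotv (A *m y) (A *m z) = dotv y z.
Proof. by move=> AA; rewrite !dotv_trmx trmx_mul mulmxA -(mulmxA y^T) AA mulmx1. Qed.

Lemma induced_map G G' (A : 'M[R]_4) : G 1%:M ->
  (forall g h, G' g -> G' h -> G' (g *m h)) ->
  (forall g, G' g -> exists2 h, G' h & h *m g = 1%:M) ->
  A^T *m A = 1%:M -> (forall g, G g -> G' (A *m g *m A^T)) ->
  exists (F : S3 -> S3) (phi : quotient3 G -> quotient3 G'),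
    (forall y, val (F y) = A *m val y) /\ forall y, phi (proj3 G y) = proj3 G' (F y).
Proof.
move=> G1 GM GV AA AG.
have /choice[F FE] (y : S3) : exists y' : S3, val y' = A *m val y.
  by apply: sphereP; rewrite dotv_ortho // valS.
have [s sE] := choice (@proj3_surj R G).
exists F, (fun a => proj3 G' (F (s a))); split=> // y.
have : orbit3 G y (s (proj3 G y)).
  have /(congr1 (fun a : quotient3 G => sval a)) /= <- := sE (proj3 G y).
  by exists 1%:M; rewrite ?mul1mx.
move=> [g Gg gE]; apply/esym; apply: (proj3_eq GM GV (AG _ Gg)).
by rewrite !FE gE -!mulmxA (mulmxA A^T) AA mul1mx.
Qed.

Lemma ortho_conj_isometric G G' : G 1%:M -> G' 1%:M ->
  (forall g h, G g -> G h -> G (g *m h)) ->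
  (forall g h, G' g -> G' h -> G' (g *m h)) ->
  (forall g, G g -> exists2 h, G h & h *m g = 1%:M) ->
  (forall g, G' g -> exists2 h, G' h & h *m g = 1%:M) ->
  ortho_conj G G' -> isometric G G'.
Proof.
move=> G1 G1' GM GM' GV GV' [A [AA AG GA]].
have AA' : A^T^T *m A^T = 1%:M by rewrite trmxK; exact: mulmx1C.
have [F [phi [FE phiE]]] := induced_map G1 GM' GV' AA AG.
have [F' [psi [FE' psiE]]] : exists (F : S3 -> S3) (phi : quotient3 G' -> quotient3 G),
    (forall y, val (F y) = A^T *m val y) /\ forall y, phi (proj3 G' y) = proj3 G (F y).
  by apply: induced_map => // g; rewrite trmxK; exact: GA.
have FK y : F' (F y) = y by apply: val_inj; rewrite FE' FE mulmxA AA mul1mx.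
have FK' y : F (F' y) = y.
  by apply: val_inj; rewrite FE FE' mulmxA; move: AA'; rewrite trmxK => ->; rewrite mul1mx.
have dE y z : sphere_dist (F y) (F z) = sphere_dist y z.
  by rewrite /sphere_dist !FE dotv_ortho.
exists phi; split.
  exists psi => a; have [y <-] := proj3_surj a; first by rewrite phiE psiE FK.
  by rewrite psiE phiE FK'.
(* [F] is a global isometry, so any positive radius serves. *)
move=> x; exists 1, (F x), F; split; [by []| |by move=> y z _ _|by move=> y _; rewrite phiE].
split=> [y|y z _ _ /(congr1 F')|y yx].
- by rewrite /sphere_ball /= dE.
- by rewrite !FK.
- by exists (F' y); rewrite ?FK' //; move: yx; rewrite /sphere_ball /= -(dE x) FK'.
Qed.

Variable q : nat.
Local Notation lg := (lens_gen R q).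
Local Notation LG := (lens_group R q).

Lemma lens_conj_ortho p1 p2 s1 s2 (A : 'M[R]_4) : A^T = A -> A *m A = 1%:M ->
  (forall k, A *m lg (k * p1) (k * p2) *m A = lg (k * s1) (k * s2)) ->
  ortho_conj (LG p1 p2) (LG s1 s2).
Proof.
move=> AT AA AE; exists A; rewrite AT; split=> // g /lens_groupP[k ->].
  by apply/lens_groupP; exists k.
by apply/lens_groupP; exists k; rewrite -AE !mulmxA AA mul1mx -mulmxA AA mulmx1.
Qed.

Lemma lens_conj_swap p1 p2 : ortho_conj (LG p1 p2) (LG p2 p1).
Proof.
apply: (@lens_conj_ortho _ _ _ _ (block_mx 0 1%:M 1%:M 0 : 'M[R]_(2 + 2))).
- have E : (block_mx 0 1%:M 1%:M 0)^T = block_mx 0 1%:M 1%:M 0 :> 'M[R]_(2 + 2).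
    by rewrite tr_block_mx !trmx0 !trmx1.
  exact: E.
- have E : block_mx 0 1%:M 1%:M 0 *m block_mx 0 1%:M 1%:M 0 = 1%:M :> 'M[R]_(2 + 2).
    by rewrite mulmx_block !mulmx1 !mulmx0 !addr0 !add0r -scalar_mx_block.
  exact: E.
move=> k; have E (A B : 'M[R]_2) : block_mx 0 1%:M 1%:M 0 *m block_mx A 0 0 B *m
    block_mx 0 1%:M 1%:M 0 = block_mx B 0 0 A.
  by rewrite !mulmx_block !(mulmx1, mulmx0, mul1mx, mul0mx, addr0, add0r).
exact: E.
Qed.

(** A reflection of the second plane reverses its rotations. *)
Lemma lens_conj_flip p1 p2 : ortho_conj (LG p1 p2) (LG p1 (- p2)).
Proof.
pose F : 'M[R]_2 := \matrix_(i, j) if i == j then (if i == 0 then 1 else -1) else 0.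
have FT : F^T = F by apply/matrixP => i j; rewrite !mxE eq_sym; case: eqP => // ->.
have FF : F *m F = 1%:M.
  apply/matrixP => i j; rewrite !mxE !big_ord_recl big_ord0 !mxE.
  by case: i => [[|[|//]] Hi]; case: j => [[|[|//]] Hj] /=; ring.
have FrF t : F *m rot2 t *m F = rot2 (- t).
  apply/matrixP => i j; rewrite !mxE !big_ord_recl big_ord0 !mxE !big_ord_recl !big_ord0 !mxE.
  rewrite (mulrN (2 * pi)) cosN sinN.
  by case: i => [[|[|//]] Hi]; case: j => [[|[|//]] Hj] /=; ring.
apply: (@lens_conj_ortho _ _ _ _ (block_mx 1%:M 0 0 F : 'M[R]_(2 + 2))).
- have E : (block_mx 1%:M 0 0 F)^T = block_mx 1%:M 0 0 F :> 'M[R]_(2 + 2).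
    by rewrite tr_block_mx !trmx0 trmx1 FT.
  exact: E.
- have E : block_mx 1%:M 0 0 F *m block_mx 1%:M 0 0 F = 1%:M :> 'M[R]_(2 + 2).
    by rewrite mulmx_block !mulmx1 !mulmx0 !mul0mx !addr0 !add0r FF -scalar_mx_block.
  exact: E.
move=> k; have E (A B : 'M[R]_2) : block_mx 1%:M 0 0 F *m block_mx A 0 0 B *m
    block_mx 1%:M 0 0 F = block_mx A 0 0 (F *m B *m F).
  by rewrite !mulmx_block !(mulmx1, mulmx0, mul1mx, mul0mx, addr0, add0r).
by rewrite [in RHS]/lens_gen mulrN intrN mulNr -FrF; exact: E.
Qed.

End OrthogonalConjugation.

(** * From symmetries of the lattice to conjugate groups *)

Section LensRigidity.
Variables (R : realType) (q : nat) (q_gt0 : (0 < q)%N).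
Local Notation L := (lens_lattice q).
Local Notation LG := (lens_group R q).

Lemma lens_latticeE (p1 p2 a b : int) :
  L p1 p2 (Z_of_int (a + b)) (Z_of_int (a - b)) <-> (q%:Z %| a * p1 + b * p2)%Z.
Proof.
split=> [[a' [b' [E1 E2 H]]]|H]; last by exists a, b.
have -> : a = a' by lia.
have -> : b = b' by lia.
exact: H.
Qed.

Lemma rot2_congr (a b : int) : (q%:Z %| a - b)%Z ->
  rot2 (a%:~R / q%:R) = rot2 (b%:~R / q%:R) :> 'M[R]_2.
Proof.
rewrite -(turn_eq1 R q_gt0) => /eqP ab.
have : turn R q a = turn R q b by rewrite -[a](subrK b) turnD ab mul1r.
rewrite /turn /cexp => -[cE /oppr_inj sE].
by apply/matrixP => i j; rewrite !mxE cE sE.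
Qed.

(* With m . p = 1 mod q, the vectors e_i - p_i m lie in the first lattice, so
   s_i = (m . s) p_i mod q. *)
Lemma lens_group_sub (p1 p2 s1 s2 : int) : gcdz (gcdz p1 p2) q%:Z = 1 ->
  (forall a b : int, (q%:Z %| a * p1 + b * p2)%Z -> (q%:Z %| a * s1 + b * s2)%Z) ->
  LG s1 s2 `<=` LG p1 p2.
Proof.
move=> cop sub; have [u [v uv]] := Bezoutz (gcdz p1 p2) q%:Z.
have [x [y xy]] := Bezoutz p1 p2; rewrite cop -xy in uv.
pose c := u * (x * s1 + y * s2).
have d1 : (q%:Z %| s1 - c * p1)%Z.
  have := sub (1 - p1 * u * x) (- p1 * u * y); rewrite (_ : _ + _ = p1 * v * q%:Z).
    by rewrite dvdz_mull // => /(_ isT); congr (_ %| _)%Z; rewrite /c; ring.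
  have -> : p1 * v * q%:Z = p1 * (1 - u * (x * p1 + y * p2)) by rewrite -uv; ring.
  by ring.
have d2 : (q%:Z %| s2 - c * p2)%Z.
  have := sub (- p2 * u * x) (1 - p2 * u * y); rewrite (_ : _ + _ = p2 * v * q%:Z).
    by rewrite dvdz_mull // => /(_ isT); congr (_ %| _)%Z; rewrite /c; ring.
  have -> : p2 * v * q%:Z = p2 * (1 - u * (x * p1 + y * p2)) by rewrite -uv; ring.
  by ring.
move=> g /lens_groupP[k ->]; apply/lens_groupP; exists (k * c).
rewrite /lens_gen (rot2_congr (a := k * s1) (b := k * c * p1)).
  rewrite (rot2_congr (a := k * s2) (b := k * c * p2)) //.
  by rewrite -mulrA -mulrBr dvdz_mull.
by rewrite -mulrA -mulrBr dvdz_mull.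
Qed.

Lemma D4eq_ortho_conj (P Q : Z -> Z -> Prop) (p1 p2 s1 s2 : int) : D4eq P Q ->
  gcdz (gcdz p1 p2) q%:Z = 1 -> gcdz (gcdz s1 s2) q%:Z = 1 ->
  (forall X Y, P X Y <-> L p1 p2 X Y) -> (forall X Y, Q X Y <-> L s1 s2 X Y) ->
  ortho_conj (LG p1 p2) (LG s1 s2).
Proof.
move=> PQ; elim: PQ p1 p2 => {P Q} [P Q PQ|P Q _ IH|P Q _ IH] p1 p2 cp cs PE QE.
- have E a b : (q%:Z %| a * p1 + b * p2)%Z <-> (q%:Z %| a * s1 + b * s2)%Z.
    by rewrite -!lens_latticeE -PE -QE.
  rewrite (_ : LG p1 p2 = LG s1 s2); first exact: ortho_conj_refl.
  apply/seteqP; split; apply: lens_group_sub => // a b; first by rewrite E.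
  by rewrite -E.
(* Swapping [a + b] and [a - b] changes the sign of [b], which amounts to changing that of [p2]. *)
- apply: ortho_conj_trans (lens_conj_flip R q p1 p2) _; apply: IH => //.
    by rewrite /gcdz abszN.
  move=> X Y; rewrite PE; split=> -[a [b [XE YE H]]]; exists a, (- b).
    by split; [lia|lia|rewrite mulrNN].
  by split; [lia|lia|rewrite mulNr -mulrN].
(* Changing the sign of [a + b] maps [(a, b)] to [(- b, - a)], which exchanges [p1] and [p2] up to a
   common sign. *)
- apply: ortho_conj_trans (lens_conj_swap R q p1 p2) _; apply: IH => //.
    by rewrite (gcdzC p2).
  move=> X Y; rewrite PE; split=> -[a [b [XE YE H]]]; exists (- b), (- a).
    by split; [lia|lia|rewrite !mulNr -opprD addrC dvdzE abszN -dvdzE].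
  by split; [lia|lia|rewrite !mulNr -opprD addrC dvdzE abszN -dvdzE].
Qed.

End LensRigidity.

Theorem theorem3p1 (R : realType) (q : nat) (p1 p2 s1 s2 : int)
    (q_gt0 : (0 < q)%N)
    (gcd_p : gcdz (gcdz p1 p2) q%:Z = 1)
    (gcd_s : gcdz (gcdz s1 s2) q%:Z = 1)
    (iso : isospectral (lens_group R q p1 p2) (lens_group R q s1 s2)) :
  isometric (lens_group R q p1 p2) (lens_group R q s1 s2).
Proof.
apply: ortho_conj_isometric;
  [exact: lens_group1|exact: lens_group1|exact: lens_groupM|exact: lens_groupM|
   exact: lens_groupV|exact: lens_groupV|].
have sc := same_count_lens (isospectral_count q_gt0 iso).
exact: (D4eq_ortho_conj R q_gt0 (lens_lattice_rigidity q_gt0 gcd_p gcd_s sc)).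
Qed.
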